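(* Fix an integer $r\ge 2$. For every $q_0\in\mathbb{C}$ with $|q_0-1|=r$ and every $\epsilon>0$, there exists $n_0=n_0(q_0,\epsilon)$ such that for all $n\ge n_0$ the chromatic polynomial of $G_n^r$ has a root $q$ with $|q-q_0|<\epsilon$. In particular every point of the circle $|q-1|=r$ is a limit point of chromatic roots of the family $\{G_n^r\}_{n\ge1}$.
   Context: For integers $r\ge2$ and $n\ge1$, the leaf-joined tree $G_n^r$ is the graph obtained from the complete $r$-ary rooted tree of height $n$ (every internal vertex has exactly $r$ children and all leaves are at distance $n$ from the root) by identifying all leaves into a single vertex. The chromatic polynomial of a graph $G=(V,E)$ is $P_G(q)=\sum_{A\subseteq E}(-1)^{|A|}q^{k(A)}$, where $k(A)$ is the number of connected components of $(V,A)$; its roots in $\mathbb C$ are the chromatic roots of $G$. *)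

(* Defs.v *)
From Stdlib Require Import Reals.
From mathcomp Require Import all_boot.

Set Implicit Arguments.
Unset Strict Implicit.
Unset Printing Implicit Defensive.

Definition Cplx : Type := (R * R)%type.
Definition Czero : Cplx := (R0, R0).
Definition Cone : Cplx := (R1, R0).
Definition Cadd (z w : Cplx) : Cplx := (Rplus (fst z) (fst w), Rplus (snd z) (snd w)).
Definition Copp (z : Cplx) : Cplx := (Ropp (fst z), Ropp (snd z)).
Definition Csub (z w : Cplx) : Cplx := Cadd z (Copp w).
Definition Cmul (z w : Cplx) : Cplx :=
  (Rminus (Rmult (fst z) (fst w)) (Rmult (snd z) (snd w)),
   Rplus (Rmult (fst z) (snd w)) (Rmult (snd z) (fst w))).
Fixpoint Cpow (z : Cplx) (k : nat) : Cplx :=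
  match k with O => Cone | S k' => Cmul z (Cpow z k') end.
Definition Cnorm (z : Cplx) : R :=
  sqrt (Rplus (Rmult (fst z) (fst z)) (Rmult (snd z) (snd z))).

(* Nodes of the complete r-ary tree of height n are words over 'I_r of
   length 0..n (the root is the empty word, the children of w are w ++ [i]).
   Vertices of G_n^r: internal nodes (words of length k < n), plus one extra
   vertex [None] obtained by identifying all leaves (words of length n). *)
Definition internal (r n : nat) := {k : 'I_n & k.-tuple 'I_r}.
Definition vertex (r n : nat) := option (internal r n).

(* Edges of the tree (hence of G_n^r, as a multigraph): one edge for each
   non-root node w (a word of length k+1 <= n), joining its parent to w. *)
Definition edge (r n : nat) := {k : 'I_n & (k.+1).-tuple 'I_r}.

(* the vertex of G_n^r corresponding to the tree node given by the word s of
   length m (m <= n); all words of length n are sent to the merged leaf None *)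
Definition node_of (r n m : nat) (s : seq 'I_r) : vertex r n :=
  match (insub m : option 'I_n) with
  | Some j =>
      omap (fun t : j.-tuple 'I_r => existT (fun k : 'I_n => k.-tuple 'I_r) j t)
           (insub s : option (j.-tuple 'I_r))
  | None => None
  end.

Definition ends (r n : nat) (e : edge r n) : vertex r n * vertex r n :=
  let: existT k w := e in
  (@node_of r n k (take k (val w)), @node_of r n k.+1 (val w)).

Definition adjA (r n : nat) (A : {set edge r n}) : rel (vertex r n) :=
  fun x y => [exists e in A, (ends e == (x, y)) || (ends e == (y, x))].

Definition ncomp (r n : nat) (A : {set edge r n}) : nat :=
  n_comp (adjA A) predT.

Definition chrom (r n : nat) (q : Cplx) : Cplx :=
  List.fold_right Cadd Czero
    (map (fun A : {set edge r n} => Cmul (Cpow (Copp Cone) #|A|) (Cpow q (ncomp A)))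
         (enum [set: {set edge r n}])).

(* Main.v *)
(** Put w = q - 1. Eliminating the vertices of the tree level by level gives
    P(q) = q (S_n + w D_n) with (S_0, D_0) = (1, 0), S_(n+1) = (w D_n)^r and
    D_(n+1) = (S_n + (w - 1) D_n)^r. So y_n = S_n / D_n is the orbit of infinity under
    f(y) = (w / (y + w - 1))^r, a map with the fixed point 1 of multiplier - r / w, all of whose
    critical points lie on the grand orbit of infinity.

    - If |w| > r, the fixed point is attracting, and y_n converges to 1 (Fatou). Otherwise the
      inverse branches of the f^n fixing 1 would all be defined, injective and zero-free on one disc
      about 1; taking square roots, this bounds their derivatives at 1 uniformly (as for
      Bieberbach-Eilenberg functions), while these derivatives are (- w / r)^n.
    - Suppose that S_n + w D_n has no zero near a point of |w| = r for infinitely many n. With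
      w = - k^r, S_(n+1) + w D_(n+1) = a^r - (k b)^r, where a = w D_n and b = S_n + (w - 1) D_n, so that
      the linear factors of this polynomial are zero-free as well; r^n-th roots of these functions exist, and
      agree up to O(r^(-n)) where |w| > r because y_n converges to 1. By Hadamard's three circles theorem they nearly
      agree across the circle, hence |S_n + w D_n| is as large as (|S_n| + |D_n|) up to a factor
      (1 + o(1))^(r^n). A second use of the three circles theorem, for
      (S_k - D_k)^(r^(n-k)) / (S_n + w D_n) with k fixed, shows that y_k converges to 1 exponentially at
      points with |w| < r too. There the fixed point is repelling, so S_k = D_k on an open set for
      some k, hence identically, which fails at w = 0.

    The only function theory needed is that of uniform limits of polynomials on a disc: the Cauchy
    estimate comes from averaging over roots of unity, and a zero-free function has N-th roots
    because consecutive members of a fine chain of dilates of it have a quotient close to 1. *)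

Require Import Defs.
From Stdlib Require Import Reals.
From mathcomp Require Import all_boot all_order all_algebra.
From mathcomp Require Import cyclic separable cyclotomic complex.
From mathcomp Require Import zify ring lra.

Set Implicit Arguments.
Unset Strict Implicit.
Unset Printing Implicit Defensive.
Import Order.TTheory GRing.Theory Num.Theory.
Local Open Scope ring_scope.

(** * The chromatic polynomial of the leaf-joined tree *)

Section State.
Variables (K : comNzRingType) (r : nat).

(* The pair (S, D) collects the weights of the colourings of a tree whose root has the same
   colour as, resp. another colour than, the merged leaf; w stands for q - 1. *)
Definition tree_step (w : K) (p : K * K) : K * K :=
  ((w * p.2) ^+ r, (p.1 + (w - 1) * p.2) ^+ r).

Definition tree_state (n : nat) (w : K) : K * K := iter n (tree_step w) (1, 0).

Lemma tree_stateS n w : tree_state n.+1 w = tree_step w (tree_state n w).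
Proof. by []. Qed.

Lemma tree_step_scale w c (p : K * K) :
  tree_step w (c * p.1, c * p.2) = (c ^+ r * (tree_step w p).1, c ^+ r * (tree_step w p).2).
Proof. by rewrite /tree_step /= -!exprMn; congr (_ ^+ _, _ ^+ _); ring. Qed.

(** The step is homogeneous of degree [r], so the dynamics only concerns the ratio [p.1 / p.2]; this
    tracks the scalar that appears when states are compared projectively. *)
Lemma iter_tree_step_scale n w c (p : K * K) :
  iter n (tree_step w) (c * p.1, c * p.2) =
  (c ^+ (r ^ n) * (iter n (tree_step w) p).1, c ^+ (r ^ n) * (iter n (tree_step w) p).2).
Proof.
elim: n => [|n IH]; first by rewrite expn0 expr1.
by rewrite !iterS IH tree_step_scale -!exprM expnSr.
Qed.

Lemma tree_state1 w : (0 < r)%N -> tree_state 1 w = (0, 1).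
Proof.
by move=> r0; rewrite /tree_state /= /tree_step /= !mulr0 addr0 expr1n expr0n (gtn_eqF r0).
Qed.

End State.

Section Polynomial.
Variables (K : comNzRingType) (r : nat).

(** Running the recursion over [{poly K}] commutes with evaluation, which makes both components
    polynomial in the weight. *)
Lemma tree_state_horner n (W : {poly K}) x :
  tree_state r n W.[x] = ((tree_state r n W).1.[x], (tree_state r n W).2.[x]).
Proof.
elim: n => [|n IH]; first by rewrite /= hornerC horner0.
by rewrite !tree_stateS IH /tree_step /= !(hornerD, hornerM, horner_exp, hornerN, hornerC).
Qed.

(** At [w = 0] each step kills the first component and makes the second the [r]-th power of the
    previous difference, so the difference remains a sign. This rules out [S_k = D_k]
    identically. *)
Lemma tree_state_w0 n : (0 < r)%N ->
  exists m, (tree_state r n (0 : K)).1 - (tree_state r n (0 : K)).2 = (-1) ^+ m.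
Proof.
move=> r0; elim: n => [|n [m IH]]; first by exists 0%N; rewrite /= subr0 expr0.
exists (m * r).+1; rewrite tree_stateS /= mul0r expr0n (gtn_eqF r0) !sub0r mulN1r IH.
by rewrite exprS mulN1r exprM.
Qed.
End Polynomial.

Section ComponentCount.
Variables (T : finType) (e : rel T) (m : nat).
Hypothesis e_sym : connect_sym e.

(** A function constant along edges amounts to a free choice of one value per component, made here
    on the representatives [fingraph.root e x]. *)
Lemma card_locally_constant :
  #|[set s : {ffun T -> 'I_m} | [forall x, forall y, e x y ==> (s x == s y)]]| = (m ^ n_comp e predT)%N.
Proof.
pose U := {x : T | roots e x}.
have rt x : roots e (fingraph.root e x) by apply: roots_root.
pose F (f : {ffun U -> 'I_m}) : {ffun T -> 'I_m} := [ffun x => f (Sub (fingraph.root e x) (rt x))].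
have Finj : injective F.
  move=> f g /ffunP fg; apply/ffunP => -[x rx]; have := fg x; rewrite !ffunE.
  suff -> : Sub (fingraph.root e x) (rt x) = Sub x rx :> U by [].
  by apply: val_inj; apply/eqP.
have -> : [set s : {ffun T -> 'I_m} | [forall x, forall y, e x y ==> (s x == s y)]] = F @: setT.
  apply/setP => s; rewrite inE; apply/forallP/imsetP => [H|[f _ ->] x].
    exists [ffun u : U => s (val u)] => //; apply/ffunP => x; rewrite !ffunE /=.
    have /connectP[p] : connect e x (fingraph.root e x) by apply: connect_root.
    move: (fingraph.root e x) => y; elim: p x => [|z p IH] x /=; first by move=> _ ->.
    by case/andP => exz pz /(IH _ pz) <-; have /forallP/(_ z) := H x; rewrite exz => /eqP.
  apply/forallP => y; apply/implyP => exy; rewrite !ffunE; apply/eqP; congr (f _).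
  by apply: val_inj; apply/eqP; rewrite /= root_connect // connect1.
rewrite card_imset // cardsT card_ffun card_ord card_sig; congr (_ ^ _)%N.
by apply: eq_card => x; rewrite !inE andbT.
Qed.
End ComponentCount.

(** * Colourings of the tree with a common leaf colour *)

Section Colourings.
Variables (r m : nat).

(** Only internal nodes carry a colour here; the common colour of the leaves is a separate parameter
    [b]. The nesting along the tree lets sums over colourings factor over the subtrees. *)
Fixpoint colouring (n : nat) : finType :=
  if n is n'.+1 then ('I_m * {ffun 'I_r -> colouring n'})%type : finType else unit.

Fixpoint look (b : 'I_m) n : colouring n -> seq 'I_r -> 'I_m :=
  match n return colouring n -> seq 'I_r -> 'I_m with
  | 0 => fun _ _ => b
  | n'.+1 => fun c s => if s is i :: s' then look b (c.2 i) s' else c.1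
  end.

Fixpoint build n (f : seq 'I_r -> 'I_m) : colouring n :=
  match n return colouring n with
  | 0 => tt
  | n'.+1 => (f [::], [ffun i => build n' (fun s => f (i :: s))])
  end.

Lemma look_build b n f s : (size s < n)%N -> look b (build n f) s = f s.
Proof. by elim: n f s => // n IH f [|i s] //= ltsn; rewrite ffunE IH. Qed.

Lemma eq_build n f g : (forall s, (size s < n)%N -> f s = g s) -> build n f = build n g.
Proof.
elim: n f g => //= n IH f g fg; rewrite fg //; congr (_, _).
by apply/ffunP => i; rewrite !ffunE; apply: IH => s hs; apply: fg.
Qed.

Lemma build_look b n (c : colouring n) : build n (look b c) = c.
Proof.
elim: n c => [[]|n IH [a g]] //=; congr (_, _); apply/ffunP => i.
by rewrite ffunE; apply: etrans (IH (g i)); apply: eq_build.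
Qed.

Lemma look_size b n (c : colouring n) s : size s = n -> look b c s = b.
Proof. by elim: n c s => [|n IH] c [|i s] //= [/IH]. Qed.

Definition word n (v : internal r n) : seq 'I_r := val (tagged v).

Lemma node_of_word n (v : internal r n) : @node_of r n (size (word v)) (word v) = Some v.
Proof.
case: v => j t; rewrite /node_of /word /= size_tuple.
case: insubP => [i _ ij|]; last by rewrite ltn_ord.
have -> : i = j by apply: val_inj.
by rewrite valK.
Qed.

Lemma node_of_lt n s : (size s < n)%N -> exists2 v : internal r n,
  @node_of r n (size s) s = Some v & word v = s.
Proof.
move=> ltsn; exists (existT (fun k : 'I_n => k.-tuple 'I_r) (Ordinal ltsn) (in_tuple s)) => //.
exact: (node_of_word (existT (fun k : 'I_n => k.-tuple 'I_r) (Ordinal ltsn) (in_tuple s))).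
Qed.

Lemma node_of_leaf n s : size s = n -> @node_of r n (size s) s = None.
Proof. by move=> ->; rewrite /node_of insubF // ltnn. Qed.

Definition vertex_colouring n (bc : 'I_m * colouring n) : {ffun vertex r n -> 'I_m} :=
  [ffun v => if v is Some u then look bc.1 bc.2 (word u) else bc.1].

Lemma vertex_colouring_node n (bc : 'I_m * colouring n) s : (size s <= n)%N ->
  vertex_colouring bc (@node_of r n (size s) s) = look bc.1 bc.2 s.
Proof.
rewrite leq_eqVlt => /predU1P[sn|ltsn].
  by rewrite ffunE node_of_leaf // look_size.
by have [v -> <-] := node_of_lt ltsn; rewrite ffunE.
Qed.

Lemma vertex_colouring_bij n : bijective (@vertex_colouring n).
Proof.
pose G (s : {ffun vertex r n -> 'I_m}) : 'I_m * colouring n :=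
  (s None, build n (fun u => s (@node_of r n (size u) u))).
exists G => [[b c]|s].
  rewrite /G {1}ffunE; congr (_, _); apply: etrans (build_look b c).
  by apply: eq_build => u hu; rewrite vertex_colouring_node // ltnW.
apply/ffunP => -[v|]; rewrite ffunE //= look_build ?node_of_word //.
by case: v => j t; rewrite /word /= size_tuple.
Qed.

End Colourings.

(** * The partition function and its recursion *)

Section Partition.
Variables (K : comNzRingType) (r m : nat).

(** An edge is named by the word of its lower end. The empty word, which names no edge, is left out
    of [edge_words]. *)
Definition proper_edge n (b : 'I_m) (c : colouring r m n) (s : seq 'I_r) : K :=
  1 - (look b c (take (size s).-1 s) == look b c s)%:R.

Fixpoint edge_words (n : nat) : seq (seq 'I_r) :=
  if n is n'.+1 then
    flatten [seq [:: i] :: [seq i :: s | s <- edge_words n'] | i <- enum 'I_r] else [::].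

Lemma mem_edge_words n s : (s \in edge_words n) = (0 < size s <= n)%N.
Proof.
elim: n s => [|n IH] s; first by rewrite in_nil; case: s.
apply/flatten_mapP/idP => [[i _]|].
  rewrite in_cons => /predU1P[->//|/mapP[s' + ->]].
  by rewrite IH /= ltnS => /andP[].
case: s => // i s /=; rewrite ltnS => hs; exists i; first by rewrite mem_enum.
rewrite in_cons; case: s hs => [|j s] hs; first by rewrite eqxx.
by rewrite map_f ?orbT // IH.
Qed.

Lemma uniq_edge_words n : uniq (edge_words n).
Proof.
elim: n => //= n IH; elim: (enum 'I_r) (enum_uniq 'I_r) => //= i l IHl /andP[il ul].
rewrite cat_uniq IHl // andbT map_inj_uniq ?IH; last by move=> ? ? [].
apply/andP; split.
  rewrite mem_cat negb_or; apply/andP; split.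
    by apply/mapP => -[s + [E]]; rewrite mem_edge_words -E.
  apply/flatten_mapP => -[j jl]; rewrite in_cons => /predU1P[[ij]|/mapP[s _ [ij]]].
    by rewrite ij jl in il.
  by rewrite ij jl in il.
apply/hasPn => x /flatten_mapP[j jl]; rewrite in_cons => /predU1P[->|/mapP[s _ ->]].
  by apply/mapP => -[s + [_ E]]; rewrite mem_edge_words -E.
by apply/mapP => -[s' _ [ji _]]; rewrite -ji jl in il.
Qed.

Definition weight n (b : 'I_m) (c : colouring r m n) : K :=
  \prod_(s <- edge_words n) proper_edge b c s.

Lemma weightS n b (c : colouring r m n.+1) :
  weight b c = \prod_i ((1 - (c.1 == look b (c.2 i) [::])%:R) * weight b (c.2 i)).
Proof.
rewrite /weight /= big_flatten /= big_map big_enum; apply: eq_bigr => i _.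
rewrite big_cons big_map; congr (_ * _).
rewrite !big_seq; apply: eq_bigr => s; rewrite mem_edge_words => /andP[s0 _].
by rewrite /proper_edge /=; case: s s0.
Qed.

(** The sum over the colour [c] of one child, from which [tree_step] arises: if the parent has the
    leaf colour, the [m - 1] other colours contribute [D]; otherwise one colour contributes [S] and
    [m - 2] contribute [D]. *)
Lemma sum_proper (a b : 'I_m) (S D : K) :
  \sum_c (1 - (a == c)%:R) * (if c == b then S else D) =
  if a == b then (m%:R - 1) * D else S + (m%:R - 1 - 1) * D.
Proof.
have E (c : 'I_m) : (1 - (a == c)%:R) * (if c == b then S else D) =
   D + (c == b)%:R * (S - D) - (a == c)%:R * (if a == b then S else D).
  case: (eqVneq c b) => [->|cb]; first by case: (eqVneq a b) => [_|_] /=; ring.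
  case: (eqVneq a c) => [->|_]; first by rewrite (negPf cb) /=; ring.
  by case: (a == b) => /=; ring.
have sum1 (x : 'I_m) : \sum_(c < m) (c == x)%:R = 1 :> K.
  by rewrite (bigD1 x) //= eqxx big1 ?addr0 // => c /negPf ->.
rewrite (eq_bigr _ (fun c _ => E c)) sumrB big_split /= sumr_const card_ord -!mulr_suml.
under [X in _ - X * _]eq_bigr => c _ do rewrite eq_sym.
by rewrite !sum1; case: eqP => _; ring.
Qed.

(** Once the colour of the root is fixed, the [r] subtrees are coloured independently, so the sum is
    the [r]-th power of the sum for one child. *)
Lemma partition_root n (a b : 'I_m) :
  \sum_(c : colouring r m n) (look b c [::] == a)%:R * weight b c =
  if a == b then (tree_state r n (m%:R - 1 : K)).1 else (tree_state r n (m%:R - 1 : K)).2.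
Proof.
elim: n a => [|n IH] a.
  rewrite (big_pred1 tt) => [|[]] //=; rewrite /weight big_nil mulr1 eq_sym.
  by case: eqP.
transitivity (\sum_(g : {ffun 'I_r -> colouring r m n})
    \prod_i ((1 - (a == look b (g i) [::])%:R) * weight b (g i))).
  rewrite (eq_bigr (fun c : 'I_m * {ffun 'I_r -> colouring r m n} => (c.1 == a)%:R *
    \prod_i ((1 - (c.1 == look b (c.2 i) [::])%:R) * weight b (c.2 i)))); last first.
    by move=> c _; rewrite weightS.
  rewrite -(pair_bigA _ (fun (x : 'I_m) (g : {ffun 'I_r -> colouring r m n}) => (x == a)%:R *
    \prod_i ((1 - (x == look b (g i) [::])%:R) * weight b (g i)))) /=.
  rewrite (bigD1 a) //= [X in _ + X]big1 ?addr0.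
    by apply: eq_bigr => g _; rewrite eqxx mul1r.
  by move=> x xa; rewrite big1 // => g _; rewrite (negPf xa) mul0r.
rewrite -(bigA_distr_bigA (fun (i : 'I_r) (c : colouring r m n) =>
   (1 - (a == look b c [::])%:R) * weight b c)) /= prodr_const card_ord.
have -> : \sum_(c : colouring r m n) (1 - (a == look b c [::])%:R) * weight b c =
   \sum_(x : 'I_m) (1 - (a == x)%:R) * (if x == b then (tree_state r n (m%:R - 1 : K)).1
      else (tree_state r n (m%:R - 1 : K)).2).
  under [RHS]eq_bigr => x _ do rewrite -IH mulr_sumr.
  rewrite exchange_big /=; apply: eq_bigr => c _.
  rewrite (bigD1 (look b c [::])) //= eqxx mul1r big1 ?addr0 // => x xl.
  by rewrite (eq_sym (look _ _ _)) (negPf xl) mul0r mulr0.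
by rewrite sum_proper; case: eqP.
Qed.

Lemma sum_proper_colourings n :
  \sum_(s : {ffun vertex r n -> 'I_m}) \prod_(e : edge r n)
     (1 - (s (ends e).1 == s (ends e).2)%:R) =
  m%:R * ((tree_state r n (m%:R - 1 : K)).1 + (m%:R - 1) * (tree_state r n (m%:R - 1 : K)).2).
Proof.
rewrite (reindex _ (onW_bij _ (vertex_colouring_bij r m n))) /=.
transitivity (\sum_(bc : 'I_m * colouring r m n) weight bc.1 bc.2).
  apply: eq_bigr => bc _; rewrite /weight.
  pose ew (e : edge r n) : seq 'I_r := val (tagged e).
  (* The recursive list of words and the type [edge r n] enumerate the same edges. *)
  have -> : \prod_(s <- edge_words n) proper_edge bc.1 bc.2 s =
            \prod_(s <- map ew (index_enum (edge r n))) proper_edge bc.1 bc.2 s.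
    apply: perm_big; apply: uniq_perm; rewrite ?uniq_edge_words //.
      rewrite map_inj_uniq ?index_enum_uniq // => -[j t] [j' t'] /= E.
      have jj' : j = j' by apply: val_inj; have := congr1 size E; rewrite /ew /= !size_tuple => -[].
      by case: j' / jj' t' E => t' E; congr existT; apply: val_inj.
    move=> s; rewrite mem_edge_words; apply/andP/mapP => [[s0 sn]|[[j t] _ ->]].
      have ltsn : ((size s).-1 < n)%N by rewrite prednK.
      have Hs : size s == (Ordinal ltsn).+1 by rewrite /= prednK.
      exists (existT (fun k : 'I_n => (k.+1).-tuple 'I_r) (Ordinal ltsn) (Tuple Hs)) => //.
      exact: mem_index_enum.
    by rewrite /ew /= size_tuple /=.
  rewrite big_map; apply: eq_bigr => -[j t] _; rewrite /proper_edge /ew /= size_tuple /=.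
  have st := size_tuple t; have ltjn := ltn_ord j.
  have E1 : size (take j (val t)) = j by rewrite size_take st ltnS leqnn.
  have := @vertex_colouring_node r m n bc (take j (val t)); rewrite E1 => -> //; last exact: ltnW.
  by have := @vertex_colouring_node r m n bc (val t); rewrite st => ->.
rewrite -(pair_bigA _ (fun b c => weight b c)) /=.
transitivity (\sum_(b < m) ((tree_state r n (m%:R - 1 : K)).1 + (m%:R - 1) * (tree_state r n (m%:R - 1 : K)).2)).
  apply: eq_bigr => b _.
  transitivity (\sum_(a < m) \sum_(c : colouring r m n) (look b c [::] == a)%:R * weight b c).
    rewrite exchange_big /=; apply: eq_bigr => c _.
    rewrite (bigD1 (look b c [::])) //= eqxx mul1r big1 ?addr0 // => x xl.
    by rewrite eq_sym (negPf xl) mul0r.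
  under eq_bigr => a _ do rewrite partition_root.
  (* The root has the leaf colour in one term and another colour in [m - 1] terms. *)
  rewrite (bigD1 b) //= eqxx; congr (_ + _).
  rewrite (eq_bigr (fun=> (tree_state r n (m%:R - 1 : K)).2)); last by move=> a /negPf ->.
  rewrite sumr_const -(mulr_natl _ #|_|); congr (_ * _).
  rewrite cardC1 card_ord -[in RHS](prednK (leq_ltn_trans (leq0n b) (ltn_ord b))).
  by rewrite -addn1 natrD addrK.
by rewrite sumr_const card_ord mulr_natl.
Qed.

(** Expanding the product over edges gives a sum over edge sets [A]; for fixed [A] the surviving
    colourings are those constant on the components of [A], and there are [m ^ ncomp A] of them. *)
Lemma subgraph_expansion n :
  \sum_(A : {set edge r n}) (-1) ^+ #|A| * m%:R ^+ ncomp A =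
  m%:R * ((tree_state r n (m%:R - 1 : K)).1 + (m%:R - 1) * (tree_state r n (m%:R - 1 : K)).2).
Proof.
rewrite -sum_proper_colourings.
transitivity (\sum_(s : {ffun vertex r n -> 'I_m}) \sum_(A : {set edge r n})
    \prod_(e : edge r n) (if e \in A then - (s (ends e).1 == s (ends e).2)%:R else 1 : K)).
  rewrite exchange_big /=; apply: eq_bigr => A _.
  have asym : symmetric (adjA A).
    by move=> x y; apply/exists_inP/exists_inP => -[e eA h]; exists e => //; rewrite orbC.
  rewrite /ncomp -natrX -(card_locally_constant m (sym_connect_sym asym)).
  rewrite -sum1dep_card natr_sum mulr_sumr [RHS](bigID (fun s : {ffun vertex r n -> 'I_m} =>
    [forall x, forall y, adjA A x y ==> (s x == s y)])) /= [X in _ + X]big1 ?addr0 => [|s].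
    apply: eq_bigr => s /forallP Hs.
    rewrite -big_mkcond /= mulr1 -prodr_const; apply: eq_bigr => e eA.
    have /forallP/(_ (ends e).2)/implyP -> := Hs (ends e).1; first by [].
    by apply/exists_inP; exists e => //; rewrite -surjective_pairing eqxx.
  rewrite negb_forall => /existsP[x]; rewrite negb_forall => /existsP[y].
  rewrite negb_imply => /andP[/exists_inP[e eA he] sxy].
  rewrite (bigD1 e) //= eA (_ : (s (ends e).1 == s (ends e).2) = false) ?oppr0 ?mul0r //.
  by case/orP: he => /eqP -> /=; [|rewrite eq_sym]; apply: negbTE.
apply: eq_bigr => s _.
transitivity (\prod_(e : edge r n) (- (s (ends e).1 == s (ends e).2)%:R + 1 : K)).
  by rewrite bigA_distr.
by apply: eq_bigr => e _; rewrite addrC.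
Qed.

End Partition.

(** Both sides are polynomials in [q] that agree at every natural number, hence everywhere in
    characteristic zero. *)
Theorem chrom_tree_state (K : numDomainType) (r n : nat) (q : K) :
  \sum_(A : {set edge r n}) (-1) ^+ #|A| * q ^+ ncomp A =
  q * ((tree_state r n (q - 1)).1 + (q - 1) * (tree_state r n (q - 1)).2).
Proof.
have [W WE] : exists W : {poly K}, forall x, W.[x] = x - 1.
  by exists ('X - 1) => x; rewrite !hornerE.
pose P : {poly K} := \sum_(A : {set edge r n}) (-1) ^+ #|A| *: 'X^(ncomp A).
pose Q : {poly K} := 'X * ((tree_state r n W).1 + W * (tree_state r n W).2).
have PE x : P.[x] = \sum_(A : {set edge r n}) (-1) ^+ #|A| * x ^+ ncomp A.
  by rewrite horner_sum; apply: eq_bigr => A _; rewrite hornerZ hornerXn.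
have QE x : Q.[x] = x * ((tree_state r n (x - 1)).1 + (x - 1) * (tree_state r n (x - 1)).2).
  by rewrite -WE tree_state_horner /Q !(hornerM, hornerD, hornerX).
suff -> : \sum_(A : {set edge r n}) (-1) ^+ #|A| * q ^+ ncomp A = Q.[q] by rewrite QE.
rewrite -PE; congr (_.[q]); apply/eqP; rewrite -subr_eq0; apply/eqP.
apply: (@roots_geq_poly_eq0 _ _ [seq j%:R | j <- iota 0 (size (P - Q))]).
- apply/allP => _ /mapP[j _ ->]; rewrite rootE hornerD hornerN PE QE.
  by rewrite subgraph_expansion subrr.
- rewrite map_inj_uniq ?iota_uniq // => i j /eqP.
  by rewrite eqr_nat; apply/eqP.
by rewrite size_map size_iota.
Qed.

(** * Moduli of complex numbers and Cauchy's estimate *)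

Notation cabs := Normc.normc.

Section ComplexModulus.
Variable R : rcfType.
Local Notation C := (complex R).
Implicit Types x y : C.

Lemma cabs0 : cabs (0 : C) = 0. Proof. exact: Normc.normc0. Qed.
Lemma cabs1 : cabs (1 : C) = 1. Proof. exact: Normc.normc1. Qed.
Lemma cabsM x y : cabs (x * y) = cabs x * cabs y.
Proof. exact: Normc.normcM. Qed.
Lemma cabsN x : cabs (- x) = cabs x. Proof. exact: normcN. Qed.
Lemma cabsD x y : cabs (x + y) <= cabs x + cabs y.
Proof. exact: le_normcD. Qed.
Lemma cabsB x y : cabs (x - y) <= cabs x + cabs y.
Proof. by rewrite -(cabsN y) cabsD. Qed.
Lemma cabsC x y : cabs (x - y) = cabs (y - x).
Proof. by rewrite -cabsN opprB. Qed.
Lemma cabsV x : cabs x^-1 = (cabs x)^-1. Proof. exact: Normc.normcV. Qed.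
Lemma cabs_div x y : cabs (x / y) = cabs x / cabs y.
Proof. by rewrite cabsM cabsV. Qed.
Lemma cabsX x n : cabs (x ^+ n) = cabs x ^+ n.
Proof. by elim: n => [|n IH]; rewrite ?expr0 ?cabs1 // !exprS cabsM IH. Qed.
Lemma cabs_ge0 x : 0 <= cabs x.
Proof. by case: x => a b; apply: sqrtr_ge0. Qed.
Lemma cabs_eq0 x : (cabs x == 0) = (x == 0).
Proof. by apply/eqP/eqP => [/Normc.eq0_normc //|->]; rewrite cabs0. Qed.
Lemma cabs_gt0 x : (0 < cabs x) = (x != 0).
Proof. by rewrite lt_def cabs_eq0 cabs_ge0 andbT. Qed.
Lemma cabs_real (a : R) : cabs (a%:C)%C = `|a|.
Proof. by rewrite /= expr0n addr0 sqrtr_sqr. Qed.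
Lemma cabs_nat n : cabs (n%:R : C) = n%:R.
Proof. by rewrite normcMn cabs1. Qed.
Lemma cabs_sum (I : Type) (s : seq I) (P : pred I) (F : I -> C) :
  cabs (\sum_(i <- s | P i) F i) <= \sum_(i <- s | P i) cabs (F i).
Proof.
elim/big_rec2: _ => [|i y x _ le_xy]; first by rewrite cabs0.
by apply: le_trans (cabsD _ _) _; rewrite lerD2l.
Qed.
Lemma cabs_le_sub x y : cabs x - cabs y <= cabs (x - y).
Proof. by rewrite lerBlDr; apply: le_trans (cabsD _ _); rewrite subrK. Qed.
Lemma cabs_distD x y z : cabs (x - z) <= cabs (x - y) + cabs (y - z).
Proof. by apply: le_trans (cabsD _ _); rewrite addrA subrK. Qed.

Lemma prim_root_exists n : (0 < n)%N -> {z : C | n.-primitive_root z}.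
Proof.
pose p : {poly C} := 'X^n - 1; have [r Dp] := closed_field_poly_normal p.
move=> n_gt0; apply/sigW; rewrite (monicP _) ?monicXnsubC // scale1r in Dp.
have rn1: all n.-unity_root r by apply/allP=> z; rewrite -root_prod_XsubC -Dp.
have sz_r: (n < (size r).+1)%N.
  by rewrite -(size_prod_XsubC r id) -Dp size_XnsubC.
have [|z] := hasP (has_prim_root n_gt0 rn1 _ sz_r); last by exists z.
by rewrite -separable_prod_XsubC -Dp separable_Xn_sub_1 // pnatr_eq0 -lt0n.
Qed.

Lemma cabs_unity_root n (z : C) : (0 < n)%N -> z ^+ n = 1 -> cabs z = 1.
Proof.
move=> n_gt0 /(congr1 (@cabs R)); rewrite cabsX cabs1 => /eqP.
by rewrite pexpr_eq1 ?cabs_ge0 // => /eqP.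
Qed.

Lemma sum_unity_root n (z : C) : z ^+ n = 1 -> z != 1 ->
  \sum_(k < n) z ^+ k = 0.
Proof.
move=> zn1 z1; apply/eqP; have /eqP := subrX1 z n.
by rewrite zn1 subrr eq_sym mulf_eq0 subr_eq0 (negPf z1).
Qed.

(** Averaging [P] against [N]-th roots of unity on the circle of radius [rho] isolates the
    coefficient of index [j]: a finite form of Cauchy's integral. *)
Lemma cauchy_estimate (P : {poly C}) (rho B : R) : 0 < rho ->
    (forall t, cabs t <= rho -> cabs P.[t] <= B) ->
  forall j, cabs P`_j * rho ^+ j <= B.
Proof.
(* [N] exceeds [j] and every exponent of [P], so no other index is congruent to [j] modulo [N]. *)
move=> rho_gt0 PB j; pose N := (size P + j).+1.
have [z zN] := prim_root_exists (isT : (0 < N)%N).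
have z1 := prim_expr_order zN.
have cz : cabs z = 1 by rewrite (cabs_unity_root _ z1).
have crho : cabs (rho%:C)%C = rho by rewrite cabs_real gtr0_norm.
have sum_eq : \sum_(k < N) (z ^+ k) ^+ (N - j) * P.[(rho%:C)%C * z ^+ k]
            = N%:R * (P`_j * (rho%:C)%C ^+ j).
  under eq_bigr => k _ do rewrite horner_coef big_distrr /=.
  rewrite exchange_big /=.
  have inner (i : 'I_(size P)) : \sum_(k < N)
       (z ^+ k) ^+ (N - j) * (P`_i * ((rho%:C)%C * z ^+ k) ^+ i) =
       P`_i * (rho%:C)%C ^+ i * (if i == j :> nat then N%:R else 0).
    rewrite (eq_bigr (fun k : 'I_N =>
        P`_i * (rho%:C)%C ^+ i * (z ^+ (N - j + i)) ^+ k)); last first.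
      by move=> k _; rewrite exprMn -!exprM mulnDl exprD !(mulnC _ k); ring.
    rewrite -big_distrr /=; congr (_ * _).
    have ltiN : (i < N)%N by rewrite (leq_trans (ltn_ord i)) // leqW // leq_addr.
    have ltjN : (j < N)%N by rewrite ltnS leq_addl.
    case: eqP => [->|/eqP ij].
      rewrite subnK ?(ltnW ltjN) // z1.
      by under eq_bigr do rewrite expr1n; rewrite sumr_const card_ord.
    rewrite sum_unity_root ?mulr0; [by []|by rewrite exprAC z1 expr1n|].
    (* A multiple of [N] strictly between [0] and [2 * N] is [N] itself, which would force
       [i = j]. *)
    rewrite -(prim_order_dvd zN); apply/negP => /dvdnP[q Eq].
    have : (N - j + i < 2 * N)%N by rewrite mul2n -addnn -addnS leq_add // leq_subr.
    have : (0 < N - j + i)%N by rewrite addn_gt0 subn_gt0 ltjN.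
    rewrite Eq ltn_mul2r muln_gt0 => /andP[q0 _] /=; rewrite ltnS leq_eqVlt ltnS leqn0.
    rewrite [q == 0]eqn0Ngt q0 orbF => /eqP q1.
    move: Eq; rewrite q1 mul1n => /eqP; rewrite -(eqn_add2r j).
    rewrite addnAC subnK ?(ltnW ltjN) // eqn_add2l (negPf ij) //.
  under eq_bigr => i _ do rewrite inner.
  have [ltjP|lePj] := ltnP j (size P).
    rewrite (bigD1 (Ordinal ltjP)) //= eqxx big1 ?addr0 1?mulrC // => i.
    by rewrite -val_eqE /= => /negPf ->; rewrite mulr0.
  rewrite nth_default // mul0r mulr0 big1 // => i _.
  by rewrite ltn_eqF ?mulr0 // (leq_trans _ lePj).
have : cabs (N%:R * (P`_j * (rho%:C)%C ^+ j)) <= N%:R * B.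
  rewrite -sum_eq; apply: le_trans (cabs_sum _ _ _) _.
  rewrite -[N in N%:R]card_ord mulr_natl -sumr_const ler_sum // => k _.
  rewrite cabsM cabsX cabsX cz !expr1n mul1r; apply: PB.
  by rewrite cabsM cabsX cz expr1n mulr1 crho.
by rewrite !cabsM cabs_nat cabsX crho ler_pM2l // ltr0n.
Qed.

End ComplexModulus.

(** * Schwarz lemma and three circles theorem for polynomials *)

Section PolynomialBounds.
Variable R : rcfType.
Local Notation C := (complex R).
Implicit Types (P Q : {poly C}) (rho B : R).

Lemma sum_expr_half_le (x : R) n : 0 <= x <= 2^-1 -> \sum_(j < n) x ^+ j <= 2.
Proof.
move=> /andP[x0 x1].
suff: \sum_(j < n) x ^+ j <= 2 - 2 * x ^+ n.
  by move=> /le_trans; apply; rewrite gerBl mulr_ge0 ?exprn_ge0.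
elim: n => [|n IH]; first by rewrite big_ord0 expr0; lra.
rewrite big_ord_recr /= exprS.
have := exprn_ge0 n x0; nra.
Qed.

(** At half the radius the coefficient bounds are summed by a geometric series of ratio [1/2]. *)
Lemma coef_bound_horner P rho B : 0 < rho -> (forall j, cabs P`_j * rho ^+ j <= B) ->
  forall t, cabs t <= rho / 2 -> cabs P.[t] <= 2 * B.
Proof.
move=> rho0 PB t le_t; rewrite horner_coef.
have B0 : 0 <= B.
  by apply: le_trans (PB 0%N); rewrite expr0 mulr1 cabs_ge0.
apply: le_trans (cabs_sum _ _ _) _.
have: \sum_(j < size P) B * (cabs t / rho) ^+ j <= 2 * B.
  rewrite -mulr_sumr mulrC ler_wpM2r // sum_expr_half_le //.
  apply/andP; split; first by rewrite divr_ge0 ?cabs_ge0 // ltW.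
  by rewrite ler_pdivrMr // mulrC.
apply: le_trans; apply: ler_sum => j _.
rewrite cabsM cabsX exprMn exprVn mulrA ler_pdivlMr ?exprn_gt0 //.
by rewrite mulrAC ler_wpM2r // exprn_ge0 // cabs_ge0.
Qed.

Lemma horner_bounded P rho : exists2 B, 0 < B & forall t, cabs t <= rho -> cabs P.[t] <= B.
Proof.
exists (1 + \sum_(j < size P) cabs P`_j * `|rho| ^+ j).
  rewrite ltr_wpDr // sumr_ge0 // => j _.
  by rewrite mulr_ge0 ?exprn_ge0 ?cabs_ge0.
move=> t le_t; rewrite horner_coef; apply: le_trans (cabs_sum _ _ _) _.
rewrite ler_wpDl // ler_sum // => j _; rewrite cabsM cabsX ler_wpM2l ?cabs_ge0 //.
by rewrite lerXn2r ?nnegrE ?cabs_ge0 // (le_trans le_t) // ler_norm.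
Qed.

Lemma horner_lipschitz P rho : exists2 L, 0 < L &
  forall s t, cabs s <= rho -> cabs t <= rho -> cabs (P.[s] - P.[t]) <= L * cabs (s - t).
Proof.
elim/poly_ind: P => [|P c [L L0 HL]].
  by exists 1 => // s t _ _; rewrite !horner0 subrr cabs0 mul1r cabs_ge0.
have [B B0 HB] := horner_bounded P rho.
exists (B + L * `|rho|); first by rewrite ltr_wpDr // mulr_ge0 // ltW.
move=> s t hs ht; rewrite !hornerMXaddC.
have -> : P.[s] * s + c - (P.[t] * t + c) = P.[s] * (s - t) + (P.[s] - P.[t]) * t.
  ring.
apply: le_trans (cabsD _ _) _; rewrite !cabsM mulrDl.
apply: lerD; first by rewrite ler_wpM2r ?cabs_ge0 // HB.
rewrite mulrAC; apply: ler_pM; rewrite ?cabs_ge0 ?HL //.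
by rewrite (le_trans ht) // ler_norm.
Qed.

(** A Schwarz lemma with a lossy constant: near the rim the trivial bound [2 * B] suffices, and
    within half the radius Cauchy's estimate bounds the coefficients of [(P - P(0)) / X]. *)
Lemma polyr_schwarz P rho B : 0 < rho -> 
    (forall t, cabs t <= rho -> cabs P.[t] <= B) ->
  forall t, cabs t <= rho -> cabs (P.[t] - P.[0]) <= 4 * B / rho * cabs t.
Proof.
move=> rho0 PB t le_t.
have [small|big] := lerP (cabs t) (rho / 2); last first.
  have B0 : 0 <= B by apply: le_trans (PB 0 _); rewrite ?cabs_ge0 // cabs0 ltW.
  apply: le_trans (cabsB _ _) _.
  have : cabs P.[0] <= B by rewrite PB // cabs0 ltW.
  have := PB _ le_t.
  have : 4 * B / rho * (rho / 2) = 2 * B by field; rewrite gt_eqF.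
  have : 4 * B / rho * (rho / 2) <= 4 * B / rho * cabs t.
    by rewrite ler_wpM2l ?(ltW big) // divr_ge0 ?(ltW rho0) // mulr_ge0.
  lra.
pose Q : {poly C} := \poly_(i < size P) P`_i.+1.
have PE : P = Q * 'X + (P`_0)%:P.
  apply/polyP => -[|i]; rewrite coefD coefMX coefC /= ?add0r // addr0 coef_poly.
  by case: ltnP => // /leqW h; rewrite nth_default.
have -> : P.[t] - P.[0] = Q.[t] * t.
  by rewrite [P in P.[t]]PE [P in P.[0]]PE !hornerMXaddC mulr0 add0r addrK.
have QB j : cabs Q`_j * rho ^+ j <= B / rho.
  have := cauchy_estimate rho0 PB j.+1.
  by rewrite {1}PE coefD coefMX coefC /= addr0 exprS mulrCA mulrC -ler_pdivlMr.
have := coef_bound_horner rho0 QB small.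
have B0 : 0 <= B / rho.
  by apply: le_trans (QB 0%N); rewrite expr0 mulr1 cabs_ge0.
have := cabs_ge0 t; rewrite cabsM => t0 H.
by rewrite ler_wpM2r // (le_trans H) // -mulrA; lra.
Qed.

(** A form of Hadamard's theorem. The coefficient bounds on the two circles are combined in a
    geometric mean with exponents [(m - 1) / m] and [1 / m]; since
    [(rho2 / 2) ^ m <= rho2 ^ (m - 1) * rho1], this bounds the coefficients at radius [rho2 / 2],
    and the series is summed at [rho2 / 4]. *)
Lemma polyr_three_circles P rho1 rho2 B a m : (0 < m)%N -> 0 < rho1 -> 0 < rho2 ->
    rho2 <= 2 ^+ m * rho1 -> 0 <= a -> 0 <= B ->
    (forall t, cabs t <= rho2 -> cabs P.[t] <= B) ->
    (forall t, cabs t <= rho1 -> cabs P.[t] <= B * a ^+ m) ->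
  forall t, cabs t <= rho2 / 4 -> cabs P.[t] <= 2 * (B * a).
Proof.
move=> m0 r1 r2 le_r a0 B0 P2 P1 t le_t.
apply: (@coef_bound_horner P (rho2 / 2)); first by rewrite divr_gt0.
  move=> j; have c2 := cauchy_estimate r2 P2 j; have c1 := cauchy_estimate r1 P1 j.
  set x := cabs P`_j in c1 c2 *; have x0 : 0 <= x := cabs_ge0 _.
  have h2 : 0 <= rho2 / 2 by rewrite divr_ge0 // ltW.
  rewrite -(@ler_pXn2r _ m) // ?nnegrE ?mulr_ge0 ?exprn_ge0 //.
  case: m m0 le_r P1 c1 => // m _ le_r _ c1.
  have y0 : 0 <= x * rho2 ^+ j by rewrite mulr_ge0 // exprn_ge0 // ltW.
  have -> : (x * (rho2 / 2) ^+ j) ^+ m.+1 =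
            (x * rho2 ^+ j) ^+ m * (x * (rho2 / 2 ^+ m.+1) ^+ j).
    rewrite !exprMn -!exprM !exprVn -!exprM (mulnC j) !exprS.
    by rewrite mulSn !exprD (mulnC j m); ring.
  rewrite [leRHS]exprMn [X in _ <= X * _]exprSr -mulrA; apply: ler_pM => //; rewrite ?exprn_ge0 //.
  - by rewrite mulr_ge0 // exprn_ge0 // divr_ge0 ?exprn_ge0 // ltW.
  - by rewrite lerXn2r ?nnegrE.
  - apply: le_trans c1; rewrite ler_wpM2l // lerXn2r ?nnegrE ?(ltW r1) //.
      by rewrite divr_ge0 ?exprn_ge0 // ltW.
    by rewrite ler_pdivrMr ?exprn_gt0 // mulrC.
by rewrite -mulrA -invfM -natrM.
Qed.

End PolynomialBounds.

(** * Uniform limits of polynomials on a disc *)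

Section DiscAlgebra.
Variable R : rcfType.
Local Notation C := (complex R).
Implicit Types (f g h u : C -> C) (rho B e : R).

(** The disc algebra as the uniform closure of the polynomials: values outside the closed disc do
    not matter, and estimates for [{poly C}] pass to the limit. *)
Definition disc_alg rho f := forall e, 0 < e ->
  exists P : {poly C}, forall t, cabs t <= rho -> cabs (f t - P.[t]) <= e.

Lemma disc_alg_ext rho f g : (forall t, cabs t <= rho -> f t = g t) ->
  disc_alg rho f -> disc_alg rho g.
Proof.
by move=> fg Af e /Af[P HP]; exists P => t ht; rewrite -fg ?HP.
Qed.

Lemma disc_alg_sub rho rho' f : rho' <= rho -> disc_alg rho f -> disc_alg rho' f.
Proof.
by move=> le_r Af e /Af[P HP]; exists P => t ht; rewrite HP // (le_trans ht).
Qed.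

Lemma disc_alg_horner rho (P : {poly C}) : disc_alg rho (fun t => P.[t]).
Proof. by move=> e e0; exists P => t _; rewrite subrr cabs0 ltW. Qed.

Lemma disc_alg_cst rho (c : C) : disc_alg rho (fun=> c).
Proof. by apply: disc_alg_ext (disc_alg_horner _ c%:P) => t _; rewrite hornerC. Qed.

Lemma disc_alg_id rho : disc_alg rho id.
Proof. by apply: disc_alg_ext (disc_alg_horner _ 'X) => t _; rewrite hornerX. Qed.

Lemma disc_alg_bounded rho f : disc_alg rho f ->
  exists2 B, 0 < B & forall t, cabs t <= rho -> cabs (f t) <= B.
Proof.
move=> /(_ 1 ltr01)[P HP]; have [B B0 HB] := horner_bounded P rho.
exists (1 + B) => [|t ht]; first by rewrite addr_gt0.
by rewrite -(subrK P.[t] (f t)); apply: le_trans (cabsD _ _) _; rewrite lerD ?HP ?HB.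
Qed.

Lemma disc_algD rho f g : disc_alg rho f -> disc_alg rho g ->
  disc_alg rho (fun t => f t + g t).
Proof.
move=> Af Ag e e0; have e20 : 0 < e / 2 by rewrite divr_gt0.
have [P HP] := Af _ e20; have [Q HQ] := Ag _ e20.
exists (P + Q) => t ht; rewrite hornerD opprD addrACA.
by apply: le_trans (cabsD _ _) _; rewrite [e]splitr lerD ?HP ?HQ.
Qed.

Lemma disc_algM rho f g : disc_alg rho f -> disc_alg rho g ->
  disc_alg rho (fun t => f t * g t).
Proof.
move=> Af Ag e e0.
have [B B0 HB] := disc_alg_bounded Ag.
have [P HP] := Af (e / 2 / B) ltac:(by rewrite !divr_gt0).
have [B' B'0 HB'] := horner_bounded P rho.
have [Q HQ] := Ag (e / 2 / B') ltac:(by rewrite !divr_gt0).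
exists (P * Q) => t ht; rewrite hornerM.
have -> : f t * g t - P.[t] * Q.[t] = (f t - P.[t]) * g t + P.[t] * (g t - Q.[t]).
  ring.
apply: le_trans (cabsD _ _) _; rewrite !cabsM [e]splitr lerD //.
  rewrite -[leRHS](divfK (lt0r_neq0 B0)).
  by apply: ler_pM; rewrite ?cabs_ge0 ?HP ?HB.
rewrite mulrC -[leRHS](divfK (lt0r_neq0 B'0)).
by apply: ler_pM; rewrite ?cabs_ge0 ?HQ ?HB'.
Qed.

Lemma disc_algN rho f : disc_alg rho f -> disc_alg rho (fun t => - f t).
Proof.
by move=> /(disc_algM (disc_alg_cst rho (-1))); apply: disc_alg_ext => t _; rewrite mulN1r.
Qed.

Lemma disc_algB rho f g : disc_alg rho f -> disc_alg rho g ->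
  disc_alg rho (fun t => f t - g t).
Proof. by move=> Af Ag; apply: disc_algD => //; apply: disc_algN. Qed.

Lemma disc_algX rho f n : disc_alg rho f -> disc_alg rho (fun t => f t ^+ n).
Proof.
move=> Af; elim: n => [|n IH].
  by apply: disc_alg_ext (disc_alg_cst rho 1) => t _; rewrite expr0.
by apply: disc_alg_ext (disc_algM Af IH) => t _; rewrite exprS.
Qed.

Lemma disc_alg_sum rho (I : Type) (s : seq I) (F : I -> C -> C) :
  (forall i, disc_alg rho (F i)) -> disc_alg rho (fun t => \sum_(i <- s) F i t).
Proof.
move=> AF; elim: s => [|i s IH].
  by apply: disc_alg_ext (disc_alg_cst rho 0) => t _; rewrite big_nil.
by apply: disc_alg_ext (disc_algD (AF i) IH) => t _; rewrite big_cons.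
Qed.

Lemma disc_alg_lim rho f :
    (forall e, 0 < e -> exists2 g, disc_alg rho g &
       forall t, cabs t <= rho -> cabs (f t - g t) <= e) ->
  disc_alg rho f.
Proof.
move=> lim e e0; have e20 : 0 < e / 2 by rewrite divr_gt0.
have [g Ag fg] := lim _ e20; have [P HP] := Ag _ e20.
exists P => t ht; apply: le_trans (cabs_distD _ (g t) _) _.
by rewrite [e]splitr lerD ?fg ?HP.
Qed.

Lemma disc_alg_dilate rho f (s : R) : 0 <= s <= 1 -> disc_alg rho f ->
  disc_alg rho (fun t => f ((s%:C)%C * t)).
Proof.
move=> /andP[s0 s1] Af e /Af[P HP].
exists (P \Po ((s%:C)%C *: 'X)) => t ht.
rewrite horner_comp hornerZ hornerX HP // cabsM cabs_real ger0_norm //.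
by apply: le_trans ht; rewrite ler_piMl ?cabs_ge0.
Qed.

Lemma disc_alg_ucont rho f : disc_alg rho f -> forall e, 0 < e ->
  exists2 d, 0 < d & forall s t, cabs s <= rho -> cabs t <= rho ->
    cabs (s - t) <= d -> cabs (f s - f t) <= e.
Proof.
move=> Af e e0; have e30 : 0 < e / 3 by rewrite divr_gt0.
have [P HP] := Af _ e30; have [L L0 HL] := horner_lipschitz P rho.
exists (e / 3 / L) => [|s t hs ht st]; first by rewrite divr_gt0.
have h1 := HP s hs; have h2 := HP t ht.
have h3 : cabs (P.[s] - P.[t]) <= e / 3.
  by apply: le_trans (HL _ _ hs ht) _; rewrite mulrC -ler_pdivlMr.
apply: le_trans (cabs_distD _ P.[s] _) _.
have := cabs_distD P.[s] P.[t] (f t); rewrite (cabsC P.[t] (f t)); lra.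
Qed.

Lemma disc_alg_schwarz rho f B : 0 < rho -> disc_alg rho f ->
    (forall t, cabs t <= rho -> cabs (f t) <= B) ->
  forall t, cabs t <= rho -> cabs (f t - f 0) <= 4 * B / rho * cabs t.
Proof.
move=> r0 Af fB t ht; apply/ler_addgt0Pr => e e0.
have e60 : 0 < e / 6 by rewrite divr_gt0.
have [P HP] := Af _ e60.
have PB s : cabs s <= rho -> cabs P.[s] <= B + e / 6.
  move=> hs; have := HP s hs; rewrite cabsC => h; have := fB s hs.
  by rewrite -(subrK (f s) P.[s]); have := cabsD (P.[s] - f s) (f s); lra.
have h0 : cabs (0 : C) <= rho by rewrite cabs0 ltW.
have h1 := polyr_schwarz r0 PB ht.
have := HP t ht; have := HP 0 h0.
have h2 := cabs_distD (f t) P.[t] (f 0).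
have h3 := cabs_distD P.[t] P.[0] (f 0).
rewrite (cabsC (f 0)) => h4 h5.
have : 4 * (B + e / 6) / rho * cabs t <= 4 * B / rho * cabs t + 4 * e / 6.
  have -> : 4 * (B + e / 6) / rho * cabs t = 4 * B / rho * cabs t + 4 * e / 6 * (cabs t / rho).
    by field; rewrite gt_eqF.
  by rewrite lerD2l ler_piMr ?ler_pdivrMr ?mul1r //; lra.
lra.
Qed.

Lemma disc_alg_three_circles rho1 rho2 f B a m : (0 < m)%N -> 0 < rho1 -> 0 < rho2 ->
    rho1 <= rho2 -> rho2 <= 2 ^+ m * rho1 -> 0 < a -> 0 < B -> disc_alg rho2 f ->
    (forall t, cabs t <= rho2 -> cabs (f t) <= B) ->
    (forall t, cabs t <= rho1 -> cabs (f t) <= B * a ^+ m) ->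
  forall t, cabs t <= rho2 / 4 -> cabs (f t) <= 5 * (B * a).
Proof.
move=> m0 r1 r2 r12 le_r a0 B0 Af f2 f1 t ht.
(* The approximation error is below all three bounds: the polynomial is bounded with [2 * B], which
   gives [4 * (B * a)], and one more [B * a] pays for the return to [f]. *)
pose e := Num.min B (Num.min (B * a ^+ m) (B * a)).
have Bam0 : 0 < B * a ^+ m by rewrite mulr_gt0 ?exprn_gt0.
have Ba0 : 0 < B * a by rewrite mulr_gt0.
have e0 : 0 < e by rewrite !lt_min B0 Bam0 Ba0.
have [e1 e2 e3] : [/\ e <= B, e <= B * a ^+ m & e <= B * a].
  by rewrite /e !ge_min !lexx !orbT.
have [P HP] := Af _ e0.
have PB s r : r <= rho2 -> cabs s <= r -> cabs P.[s] <= cabs (f s) + e.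
  move=> rr hs; have := HP s (le_trans hs rr); rewrite cabsC => h.
  by rewrite -{1}(subrK (f s) P.[s]); have := cabsD (P.[s] - f s) (f s); lra.
have P2 s : cabs s <= rho2 -> cabs P.[s] <= 2 * B.
  by move=> hs; have := PB s _ (lexx _) hs; have := f2 s hs; lra.
have P1 s : cabs s <= rho1 -> cabs P.[s] <= 2 * B * a ^+ m.
  move=> hs; have := PB s _ r12 hs; have := f1 s hs; lra.
have B20 : 0 <= 2 * B by rewrite mulr_ge0 // ltW.
have h := polyr_three_circles m0 r1 r2 le_r (ltW a0) B20 P2 P1 ht.
have ht2 : cabs t <= rho2 by apply: le_trans ht _; lra.
have := HP t ht2; have := cabsD (f t - P.[t]) P.[t]; rewrite subrK.
lra.
Qed.

End DiscAlgebra.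

From mathcomp Require Import all_classical reals topology normedtype.
From mathcomp Require Import ring lra.

(** * Lower bounds by compactness *)

Section Compact.
Import numFieldNormedType.Exports.
Local Open Scope classical_set_scope.
Local Open Scope ring_scope.
Variable R : realType.
Local Notation C := (complex R).

Lemma cabs_Re_le (z : C) : `|complex.Re z| <= cabs z.
Proof.
case: z => a b /=; rewrite -sqrtr_sqr ler_sqrt ?addr_ge0 ?sqr_ge0 //.
by rewrite lerDl sqr_ge0.
Qed.

Lemma cabs_Im_le (z : C) : `|complex.Im z| <= cabs z.
Proof.
case: z => a b /=; rewrite -sqrtr_sqr ler_sqrt ?addr_ge0 ?sqr_ge0 //.
by rewrite lerDr sqr_ge0.
Qed.

Lemma cabs_le_ReIm (z : C) : cabs z <= `|complex.Re z| + `|complex.Im z|.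
Proof.
case: z => a b /=; rewrite -(@ler_pXn2r _ 2) ?nnegrE ?sqrtr_ge0 ?addr_ge0 //.
rewrite sqr_sqrtr ?addr_ge0 ?sqr_ge0 // sqrrD !real_normK ?num_real //.
by rewrite -addrA lerD2l lerDr mulrn_wge0 // mulr_ge0.
Qed.

(** Compactness of the square around the disc turns pointwise non-vanishing into a uniform lower
    bound. *)
Lemma disc_alg_bounded_below rho (f : C -> C) : disc_alg rho f ->
    (forall t, cabs t <= rho -> f t != 0) ->
  exists2 b, 0 < b & forall t, cabs t <= rho -> b <= cabs (f t).
Proof.
move=> Af f0.
pose z (p : R * R) : C := Complex p.1 p.2.
pose K : set (R * R) := `[- rho, rho] `*` `[- rho, rho].
have cK : compact K by apply: compact_setX; apply: segment_compact.
have zB (p q : R * R) : z p - z q = Complex (p.1 - q.1) (p.2 - q.2) by [].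
have ucz (p q : R * R) d : `|p.1 - q.1| < d / 2 -> `|p.2 - q.2| < d / 2 -> cabs (z p - z q) <= d.
  move=> h1 h2; apply: le_trans (cabs_le_ReIm _) _; rewrite zB /=; lra.
pose P (b : R) (p : R * R) := cabs (z p) <= rho -> b <= cabs (f (z p)).
have : \forall b \near 0^'+, K `<=` P b.
  apply: (compact_near_coveringP K).1 => // p Kp.
  have [hp|hp] := lerP (cabs (z p)) rho.
    have fp0 : 0 < cabs (f (z p)) / 2 by rewrite divr_gt0 // cabs_gt0 f0.
    have [d d0 Hd] := disc_alg_ucont Af fp0.
    have d20 : 0 < d / 2 by rewrite divr_gt0.
    exists ([set q | `|p.1 - q.1| < d / 2 /\ `|p.2 - q.2| < d / 2], [set b | b < cabs (f (z p)) / 2]).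
      split => /=; last exact: nbhs_right_lt.
      exists (ball p.1 (d / 2), ball p.2 (d / 2)); first by split; apply: nbhsx_ballx.
      by move=> q [].
    move=> [q b] /= [[q1 q2] hb] hq.
    have := Hd _ _ hp hq (ucz _ _ _ q1 q2).
    by have := cabs_le_sub (f (z p)) (f (z q)); lra.
  (* A point of the square outside the disc has a neighbourhood outside the disc, where [P b] holds
     vacuously. *)
  pose d := cabs (z p) - rho; have d20 : 0 < d / 2 / 2 by rewrite !divr_gt0 // subr_gt0.
  exists ([set q | `|p.1 - q.1| < d / 2 / 2 /\ `|p.2 - q.2| < d / 2 / 2], setT).
    split => /=; last exact: filterT.
    exists (ball p.1 (d / 2 / 2), ball p.2 (d / 2 / 2)); first by split; apply: nbhsx_ballx.
    by move=> q [].
  move=> [q b] /= [[q1 q2] _] hq.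
  have := ucz _ _ _ q1 q2; have := cabs_le_sub (z p) (z q).
  by rewrite -/d /d; lra.
move=> near_b.
have /filter_ex[b [b0 Hb]] : \forall b \near 0^'+, 0 < b /\ K `<=` P b.
  by apply: filterI near_b; apply: nbhs_right_gt.
exists b => // t ht; have := Hb (complex.Re t, complex.Im t); rewrite /P /z /=.
case: t ht => x y /= ht; apply=> //.
split => /=; rewrite in_itv /= -ler_norml; apply: le_trans ht.
  exact: (cabs_Re_le (Complex x y)).
exact: (cabs_Im_le (Complex x y)).
Qed.
End Compact.

(** * Inverses and [N]-th roots of zero-free functions *)

Section Roots.
Variable R : realType.
Local Notation C := (complex R).
Implicit Types (f g h u : C -> C) (rho B e : R).

Lemma expr_small (x e : R) : 0 <= x -> x < 1 -> 0 < e -> exists k, x ^+ k <= e.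
Proof.
move=> x0 x1 e0; have [->|xn0] := eqVneq x 0; first by exists 1%N; rewrite expr1 ltW.
have xp : 0 < x by rewrite lt_def xn0.
pose y := x^-1 - 1; have y0 : 0 < y by rewrite subr_gt0 invf_gt1.
have xE : x = (1 + y)^-1 by rewrite /y addrC subrK invrK.
have y1 : 0 < 1 + y by rewrite addr_gt0.
exists (Num.bound (e^-1 / y)); set k := Num.bound _.
have hk : e^-1 / y < k%:R by apply: archi_boundP; rewrite divr_ge0 ?invr_ge0 ?ltW.
rewrite xE exprVn -[e]invrK lef_pV2 ?posrE ?exprn_gt0 ?invr_gt0 //.
have : 1 + y *+ k <= (1 + y) ^+ k.
  elim: (k) => [|j IH]; first by rewrite mulr0n addr0 expr0.
  rewrite exprS mulrSr; apply: le_trans (_ : (1 + y) * (1 + y *+ j) <= _); last first.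
    by rewrite ler_wpM2l // addr_ge0 // ltW.
  have : 0 <= y * (y *+ j) by rewrite mulr_ge0 ?mulrn_wge0 // ltW.
  by lra.
apply: le_trans; rewrite -mulr_natr mulrC; move: hk; rewrite ltr_pdivrMr //; lra.
Qed.

(** Partial sums of the geometric series in [1 - u] converge uniformly to the inverse. *)
Lemma disc_algV_near1 rho u : disc_alg rho u ->
    (forall t, cabs t <= rho -> cabs (u t - 1) <= 2^-1) ->
  disc_alg rho (fun t => (u t)^-1).
Proof.
move=> Au u1; apply: disc_alg_lim => e e0.
have [k ke] := @expr_small 2^-1 (e / 2) ltac:(lra) ltac:(lra) ltac:(lra).
exists (fun t => \sum_(i < k) (1 - u t) ^+ i).
  apply: disc_alg_sum => i; apply: disc_algX.
  by apply: disc_algB => //; apply: disc_alg_cst.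
move=> t ht; have h1 := u1 t ht.
have u0 : u t != 0.
  by apply: contraTneq h1 => ->; rewrite sub0r cabsN cabs1 -ltNge; lra.
have uge : 2^-1 <= cabs (u t).
  by have := cabs_le_sub 1 (u t); rewrite cabs1 cabsC; lra.
have -> : (u t)^-1 - \sum_(i < k) (1 - u t) ^+ i = (1 - u t) ^+ k / u t.
  apply: (mulfI u0); rewrite mulrBr mulfV // [RHS]mulrCA mulfV // mulr1.
  have -> : u t * \sum_(i < k) (1 - u t) ^+ i = - ((1 - u t) ^+ k - 1).
    by rewrite subrX1 -mulNr; congr (_ * _); ring.
  ring.
rewrite cabs_div cabsX cabsC ler_pdivrMr; last by apply: lt_le_trans uge; lra.
have : cabs (u t - 1) ^+ k <= 2^-1 ^+ k by rewrite lerXn2r ?nnegrE ?cabs_ge0 ?invr_ge0.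
have : e / 2 <= e * cabs (u t) by rewrite ler_pM2l.
lra.
Qed.

(** The condition on [n] and [d] keeps the quadratic term of [z ^+ j.+1 - 1] below a linear one, so
    the induction loses only a factor [2]. *)
Lemma cabs_expr_sub1 (z : C) d n j : cabs (z - 1) <= d -> 2 * n%:R * d <= 1 -> (j <= n)%N ->
  cabs (z ^+ j - 1) <= 2 * j%:R * d.
Proof.
move=> zd nd; have d0 : 0 <= d := le_trans (cabs_ge0 _) zd.
elim: j => [_|j IH jn]; first by rewrite expr0 subrr cabs0 mulr0 mul0r.
have {}IH := IH (ltnW jn).
have -> : z ^+ j.+1 - 1 = (z ^+ j - 1) * (z - 1) + (z - 1) + (z ^+ j - 1).
  by rewrite exprS; ring.
have h1 := cabsD ((z ^+ j - 1) * (z - 1) + (z - 1)) (z ^+ j - 1).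
have h2 := cabsD ((z ^+ j - 1) * (z - 1)) (z - 1).
apply: le_trans h1 _; apply: le_trans (lerD h2 (lexx _)) _.
rewrite cabsM -[j.+1]addn1 natrD.
have : cabs (z ^+ j - 1) * cabs (z - 1) <= 1 * d.
  apply: ler_pM; rewrite ?cabs_ge0 //; apply: le_trans IH _.
  apply: le_trans nd; rewrite ler_wpM2r // ler_wpM2l // ler_nat ltnW //.
lra.
Qed.

(** One Newton step for the [N]-th root, with the derivative frozen at its value [N] at [1]. Close
    to [1] it halves the distance to the root [x], and it is polynomial in [c] and [x ^+ N]. *)
Lemma newton_step (N : nat) (c x : C) d : (0 < N)%N -> cabs (c - 1) <= d -> cabs (x - 1) <= d ->
    8 * N%:R * d <= 1 ->
  cabs (c - (c ^+ N - x ^+ N) / N%:R - x) <= 2^-1 * cabs (c - x).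
Proof.
move=> N0 cd xd Nd; have d0 : 0 <= d := le_trans (cabs_ge0 _) cd.
have Nn0 : (N%:R : C) != 0 by rewrite pnatr_eq0 -lt0n.
have NR0 : 0 < (N%:R : R) by rewrite ltr0n.
have -> : c - (c ^+ N - x ^+ N) / N%:R - x =
    (c - x) * (- (\sum_(i < N) (c ^+ (N.-1 - i) * x ^+ i - 1)) / N%:R).
  rewrite sumrB sumr_const card_ord subrXX.
  by field.
rewrite cabsM mulrC ler_wpM2r ?cabs_ge0 // cabs_div cabsN cabs_nat ler_pdivrMr //.
apply: le_trans (cabs_sum _ _ _) _.
apply: (@le_trans _ _ (\sum_(i < N) 2^-1)); last by rewrite sumr_const card_ord -[leLHS]mulr_natr lexx.
apply: ler_sum => i _.
have N2 : 2 * N%:R * d <= 1 by apply: le_trans Nd; rewrite ler_wpM2r //; lra.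
have le1 : (N.-1 - i <= N)%N by rewrite (leq_trans (leq_subr _ _)) // leq_pred.
have le2 : (i <= N)%N by apply: ltnW.
have p1 := cabs_expr_sub1 cd N2 le1; have p2 := cabs_expr_sub1 xd N2 le2.
set a := c ^+ _ in p1 *; set b := x ^+ _ in p2 *.
have -> : a * b - 1 = (a - 1) * (b - 1) + (a - 1) + (b - 1) by ring.
have h1 := cabsD ((a - 1) * (b - 1) + (a - 1)) (b - 1).
have h2 := cabsD ((a - 1) * (b - 1)) (a - 1).
apply: le_trans h1 _; apply: le_trans (lerD h2 (lexx _)) _.
rewrite cabsM.
have leN : ((N.-1 - i) + i <= N)%N.
  by rewrite subnK ?leq_pred // -ltnS prednK.
have sumd : ((N.-1 - i)%:R + i%:R) * d <= N%:R * d.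
  by rewrite -natrD ler_wpM2r // ler_nat.
have p0 : 0 <= (N.-1 - i)%:R * d by rewrite mulr_ge0.
have q0 : 0 <= i%:R * d by rewrite mulr_ge0.
have : cabs (a - 1) * cabs (b - 1) <= cabs (b - 1).
  by rewrite ler_piMl ?cabs_ge0 //; lra.
rewrite mulrDl in sumd.
lra.
Qed.

Lemma near1_root_unique (N : nat) (x y : C) d : (0 < N)%N -> cabs (x - 1) <= d ->
  cabs (y - 1) <= d -> 8 * N%:R * d <= 1 -> x ^+ N = y ^+ N -> x = y.
Proof.
move=> N0 xd yd Nd xy; have := newton_step N0 xd yd Nd.
rewrite xy subrr mul0r subr0 => h; apply/eqP; rewrite -subr_eq0 -cabs_eq0.
by have := cabs_ge0 (x - y); rewrite eq_le => ->; rewrite andbT; lra.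
Qed.

(** The product of the distances from [1] to all [N]-th roots of [u] is [|1 - u|], so they cannot
    all exceed [s]. *)
Lemma near1_root_exists (N : nat) (u : C) (s : R) : (0 < N)%N -> 0 <= s ->
  cabs (u - 1) <= s ^+ N -> exists2 x, x ^+ N = u & cabs (x - 1) <= s.
Proof.
move=> N0 s0 us; pose p : {poly C} := 'X^N - u%:P.
have [r Dp] := closed_field_poly_normal p.
rewrite (monicP _) ?monicXnsubC // scale1r in Dp.
have sz_r: size r = N.
  by apply: succn_inj; rewrite -(size_prod_XsubC r id) -Dp size_XnsubC.
have [/hasP[x xr xs]|/hasPn none] := boolP (has (fun x => cabs (x - 1) <= s) r).
  exists x => //; apply/eqP; rewrite -subr_eq0.
  by move: xr; rewrite -root_prod_XsubC -Dp rootE !hornerE.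
have E : 1 - u = \prod_(x <- r) (1 - x).
  have := congr1 (fun q => q.[1]) Dp; rewrite !hornerE expr1n => ->.
  by rewrite horner_prod; apply: eq_bigr => x _; rewrite !hornerE.
move: us; rewrite cabsC E leNgt => /negP[].
rewrite -sz_r; have : (0 < size r)%N by rewrite sz_r.
have : {in r, forall x, s < cabs (1 - x)}.
  by move=> x /none; rewrite -ltNge cabsC.
elim: r {none Dp sz_r E} => // x [|y r] IH far _.
  by rewrite big_seq1 expr1 far ?mem_head.
rewrite big_cons exprS cabsM ltr_pM ?exprn_ge0 ?far ?mem_head //.
by apply: IH => // w wr; rewrite far // in_cons wr orbT.
Qed.

Lemma disc_alg_root_near1 (N : nat) rho u s : (0 < N)%N -> 16 * N%:R * s = 1 ->
    disc_alg rho u -> (forall t, cabs t <= rho -> cabs (u t - 1) <= s ^+ N) ->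
  exists2 x, disc_alg rho x & forall t, cabs t <= rho ->
    x t ^+ N = u t /\ cabs (x t - 1) <= s.
Proof.
move=> N0 Ns Au us.
have NR0 : 0 < (N%:R : R) by rewrite ltr0n.
have s0 : 0 < s by rewrite -(pmulr_rgt0 s (_ : 0 < 16 * N%:R)) ?Ns ?mulr_gt0.
have Nd : 8 * N%:R * (2 * s) <= 1 by lra.
have /choice[x Hx] t : exists y, cabs t <= rho -> y ^+ N = u t /\ cabs (y - 1) <= s.
  have [ht|_] := boolP (cabs t <= rho); last by exists 0.
  by have [y] := near1_root_exists N0 (ltW s0) (us t ht); exists y.
exists x => //; apply: disc_alg_lim => e e0.
pose c := fix c (j : nat) (t : C) : C :=
  if j is j'.+1 then c j' t - (c j' t ^+ N - u t) / N%:R else 1.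
have Ac j : disc_alg rho (c j).
  elim: j => [|j IH]; first exact: disc_alg_cst.
  apply: disc_algB => //; apply: disc_algM; last exact: disc_alg_cst.
  by apply: disc_algB => //; apply: disc_algX.
have conv t j : cabs t <= rho -> cabs (c j t - x t) <= 2^-1 ^+ j * s.
  move=> ht; have [xN x1] := Hx t ht.
  have x2 : cabs (x t - 1) <= 2 * s by lra.
  elim: j => [|j IH]; first by rewrite expr0 mul1r cabsC.
  have jle : 2^-1 ^+ j * s <= s.
    by rewrite ler_piMl ?(ltW s0) // exprn_ile1 //; lra.
  have cj1 : cabs (c j t - 1) <= 2 * s.
    by have := cabs_distD (c j t) (x t) 1; lra.
  have := newton_step N0 cj1 x2 Nd; rewrite xN /= exprS; lra.
have [k ke] := @expr_small 2^-1 (e / s) ltac:(lra) ltac:(lra) ltac:(by rewrite divr_gt0).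
exists (c k) => // t ht; rewrite cabsC; apply: le_trans (conv _ _ ht) _.
by rewrite -ler_pdivlMr.
Qed.

(** Inverse and root are carried together along the dilates [f(j t / J)], from the constant [f(0)]
    to [f]: the inverse at stage [j] forms the quotient [u], whose root and inverse near [1] give
    stage [j + 1]. *)
Lemma disc_alg_root (N : nat) rho f (x0 : C) : (0 < N)%N -> 0 <= rho -> disc_alg rho f ->
    (forall t, cabs t <= rho -> f t != 0) -> x0 ^+ N = f 0 ->
  disc_alg rho (fun t => (f t)^-1) /\
  exists m, [/\ disc_alg rho m, m 0 = x0 & forall t, cabs t <= rho -> m t ^+ N = f t].
Proof.
move=> N0 rho0 Af f0 x0N.
have NR0 : 0 < (N%:R : R) by rewrite ltr0n.
pose s : R := (16 * N%:R)^-1.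
have s0 : 0 < s by rewrite invr_gt0 mulr_gt0.
have Ns : 16 * N%:R * s = 1 by rewrite mulfV // mulf_neq0 // gt_eqF.
have [b b0 Hb] := disc_alg_bounded_below Af f0.
pose e := Num.min 2^-1 (s ^+ N) * b.
have e0 : 0 < e by rewrite mulr_gt0 // lt_min invr_gt0 exprn_gt0 // andbT ltr0n.
have [d d0 Hd] := disc_alg_ucont Af e0.
pose J := (Num.bound (rho / d)).+1.
have J0 : 0 < (J%:R : R) by rewrite ltr0n.
have Jd : rho / J%:R <= d.
  rewrite ler_pdivrMr // mulrC -ler_pdivrMr //.
  apply/ltW/(lt_trans (archi_boundP _)); first by rewrite divr_ge0 // ltW.
  by rewrite ltr_nat.
(* f is compared with its dilates: consecutive dilates differ by a factor close to 1 *)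
pose F j t := f (((j%:R / J%:R)%:C)%C * t).
have dil j t : (j <= J)%N -> cabs t <= rho -> cabs (((j%:R / J%:R : R)%:C)%C * t) <= rho.
  move=> jJ ht; rewrite cabsM cabs_real ger0_norm ?divr_ge0 //.
  by apply: le_trans ht; rewrite ler_piMl ?cabs_ge0 // ler_pdivrMr // mul1r ler_nat.
have AF j : (j <= J)%N -> disc_alg rho (F j).
  move=> jJ; apply: disc_alg_dilate Af.
  by rewrite divr_ge0 //= ler_pdivrMr // mul1r ler_nat.
have main j : (j <= J)%N -> disc_alg rho (fun t => (F j t)^-1) /\
  exists m, [/\ disc_alg rho m, m 0 = x0 & forall t, cabs t <= rho -> m t ^+ N = F j t].
  elim: j => [_|j IH jJ].
    have F0 t : F 0%N t = f 0 by rewrite /F mul0r mul0r.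
    split; first by apply: disc_alg_ext (disc_alg_cst rho (f 0)^-1) => t _; rewrite F0.
    by exists (fun=> x0); split=> // [|t _]; [exact: disc_alg_cst|rewrite F0].
  have [AV [m [Am m0 mN]]] := IH (ltnW jJ).
  pose u t := F j.+1 t * (F j t)^-1.
  have Au : disc_alg rho u by apply: disc_algM => //; apply: AF.
  have uE t : cabs t <= rho -> cabs (u t - 1) <= e / b.
    move=> ht; have Fj0 := f0 _ (dil _ _ (ltnW jJ) ht).
    have -> : u t - 1 = (F j.+1 t - F j t) / F j t by rewrite mulrBl mulfV.
    rewrite cabs_div; apply: ler_pM; rewrite ?cabs_ge0 ?invr_ge0 ?cabs_ge0 //.
      apply: Hd; rewrite ?dil ?(ltnW jJ) // -mulrBl cabsM.
      have -> : (((j.+1%:R / J%:R : R)%:C)%C - ((j%:R / J%:R : R)%:C)%C) = ((J%:R^-1 : R)%:C)%C.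
        by rewrite -rmorphB -mulrBl -addn1 natrD addrAC subrr add0r mul1r.
      rewrite cabs_real ger0_norm ?invr_ge0 // mulrC.
      by apply: le_trans Jd; rewrite ler_pM2r ?invr_gt0.
    by rewrite lef_pV2 ?posrE ?Hb ?dil ?(ltnW jJ) // (lt_le_trans b0) // Hb ?dil ?(ltnW jJ).
  have eb : e / b = Num.min 2^-1 (s ^+ N) by rewrite /e mulfK // gt_eqF.
  split.
    apply: disc_alg_ext (disc_algM AV (disc_algV_near1 Au _)) => [t ht|t ht].
      have Fj0 := f0 _ (dil _ _ (ltnW jJ) ht).
      by rewrite /u invfM invrK mulrCA mulVf // mulr1.
    by apply: le_trans (uE t ht) _; rewrite eb ge_min lexx.
  have [|x Ax Hx] := disc_alg_root_near1 N0 Ns Au.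
    by move=> t ht; apply: le_trans (uE t ht) _; rewrite eb ge_min lexx orbT.
  have h0 : cabs (0 : C) <= rho by rewrite cabs0.
  exists (fun t => m t * x t); split; first exact: disc_algM.
    have [xN x1] := Hx 0 h0; rewrite m0 (_ : x 0 = 1) ?mulr1 //.
    (* All dilates agree at [0], so [u 0 = 1] and its root near [1] is [1]; the prescribed value
       [x0] is preserved. *)
    apply: (near1_root_unique N0 x1 (d := s)).
    - by rewrite subrr cabs0 ltW.
    - have : 0 <= N%:R * s by rewrite mulr_ge0 // ltW.
      lra.
    have F0 i : F i 0 = f 0 by rewrite /F mulr0.
    by rewrite xN expr1n /u !F0 mulfV // f0.
  move=> t ht; have [xN _] := Hx t ht.
  have Fj0 := f0 _ (dil _ _ (ltnW jJ) ht).
  by rewrite exprMn mN // xN /u mulrCA mulfV // mulr1.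
have FJ t : F J t = f t by rewrite /F divff ?gt_eqF // rmorph1 mul1r.
have [AV [m [Am m0 mN]]] := main J (leqnn J).
split; first by apply: disc_alg_ext AV => t _; rewrite FJ.
by exists m; split=> // t ht; rewrite mN // FJ.
Qed.
End Roots.

(** * Comparison of growth and Bieberbach-Eilenberg functions *)

Section Comparison.
Variable R : realType.
Local Notation C := (complex R).
Implicit Types (f g h u : C -> C) (rho B e : R).

Lemma archi_nat (x : R) : exists n : nat, x <= n%:R.
Proof.
have [x0|x0] := lerP 0 x; last by exists 0%N; apply: ltW.
by exists (Num.bound x); apply/ltW/archi_boundP.
Qed.

(** [z] stays near [N]-th roots of unity, and continuity from [z 0 = 1] singles out [1]. A distance
    [1 / (4 N)] from [1] improves to [1 / (10 N)], because [z ^ N - 1] is [z - 1] times a sum of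
    modulus at least [N / 2]; moving along a radius so that [z] changes by at most [1 / (8 N)] at a
    time never leaves this regime. *)
Lemma near_unity_continuation (N : nat) r (z : C -> C) : (0 < N)%N -> 0 <= r ->
    disc_alg r z -> z 0 = 1 -> (forall t, cabs t <= r -> cabs (z t ^+ N - 1) <= 20^-1) ->
  forall t, cabs t <= r -> cabs (z t - 1) <= 10^-1 / N%:R.
Proof.
move=> N0 r0 Az z0 zN t ht; have NR0 : 0 < (N%:R : R) by rewrite ltr0n.
have local s : cabs s <= r -> cabs (z s - 1) <= 4^-1 / N%:R -> cabs (z s - 1) <= 10^-1 / N%:R.
  move=> hs zs; have := zN s hs; rewrite subrX1 cabsM.
  have Nd : 2 * N%:R * (4^-1 / N%:R) <= 1 :> R.
    have -> : 2 * N%:R * (4^-1 / N%:R) = 2^-1 :> R by field; rewrite gt_eqF.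
    lra.
  have : N%:R / 2 <= cabs (\sum_(i < N) z s ^+ i).
    have : cabs (\sum_(i < N) (z s ^+ i - 1)) <= N%:R / 2.
      apply: le_trans (cabs_sum _ _ _) _.
      apply: (@le_trans _ _ (\sum_(i < N) 2^-1)); last first.
        by rewrite sumr_const card_ord -[leLHS]mulr_natr mulrC.
      apply: ler_sum => i _; apply: le_trans (cabs_expr_sub1 zs Nd (ltnW (ltn_ord i))) _.
      rewrite mulrA ler_pdivrMr //.
      by have : (i%:R : R) <= N%:R; [rewrite ler_nat ltnW|lra].
    rewrite sumrB sumr_const card_ord -[1 *+ N]/(N%:R).
    have := cabs_le_sub (N%:R : C) (\sum_(i < N) z s ^+ i).
    by rewrite cabs_nat cabsC; lra.
  move=> h1 h2; rewrite ler_pdivlMr //.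
  have : cabs (z s - 1) * (N%:R / 2) <= cabs (z s - 1) * cabs (\sum_(i < N) z s ^+ i).
    by rewrite ler_wpM2l ?cabs_ge0.
  lra.
have e0 : 0 < 8^-1 / N%:R :> R by rewrite divr_gt0 ?invr_gt0.
have [d d0 Hd] := disc_alg_ucont Az e0.
have [J' HJ'] := archi_nat (r / d); pose J := J'.+1.
have J0 : 0 < (J%:R : R) by rewrite ltr0n.
have Jd : r / J%:R <= d.
  rewrite ler_pdivrMr // mulrC -ler_pdivrMr //; apply: le_trans HJ' _.
  by rewrite ler_nat.
pose s (j : nat) : C := ((j%:R / J%:R : R)%:C)%C * t.
have hs j : (j <= J)%N -> cabs (s j) <= r.
  move=> jJ; rewrite cabsM cabs_real ger0_norm ?divr_ge0 //.
  by apply: le_trans ht; rewrite ler_piMl ?cabs_ge0 // ler_pdivrMr // mul1r ler_nat.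
have step j : (j <= J)%N -> cabs (z (s j) - 1) <= 10^-1 / N%:R.
  elim: j => [_|j IH jJ].
    by rewrite /s mul0r mul0r z0 subrr cabs0 divr_ge0 ?invr_ge0.
  apply: local; rewrite ?hs //.
  apply: le_trans (cabs_distD _ (z (s j)) _) _.
  have h1 := IH (ltnW jJ).
  have : cabs (z (s j.+1) - z (s j)) <= 8^-1 / N%:R.
    apply: Hd; rewrite ?hs ?(ltnW jJ) // /s -mulrBl cabsM.
    have -> : (((j.+1%:R / J%:R : R)%:C)%C - ((j%:R / J%:R : R)%:C)%C) = ((J%:R^-1 : R)%:C)%C.
      by rewrite -rmorphB -mulrBl -addn1 natrD addrAC subrr add0r mul1r.
    rewrite cabs_real ger0_norm ?invr_ge0 // mulrC.
    by apply: le_trans Jd; rewrite ler_pM2r ?invr_gt0.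
  have : 0 < N%:R^-1 :> R by rewrite invr_gt0.
  lra.
by have := step J (leqnn J); rewrite /s divff ?gt_eqF // rmorph1 mul1r.
Qed.

(** The [N]-th roots [x] and [y] of [X] and [Y] are bounded by [B]. Near [0] the hypothesis on
    [X / Y] makes [x - y] of order [1 / N], and the three circles theorem makes it small on a disc
    independent of [N]. The threshold [N0] is uniform in [X] and [Y]. *)
Lemma growth_comparison B eta rho rho1 : 1 <= B -> 0 < eta -> 0 < rho -> 0 < rho1 ->
  exists N0 : nat, forall N (X Y : C -> C), (N0 <= N)%N ->
    disc_alg rho X -> disc_alg rho Y -> X 0 = 1 -> Y 0 = 1 ->
    (forall t, cabs t <= rho -> X t != 0 /\ Y t != 0) ->
    (forall t, cabs t <= rho -> cabs (X t) <= B ^+ N /\ cabs (Y t) <= B ^+ N) ->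
    (forall t, cabs t <= rho -> cabs t <= rho1 -> cabs (X t / Y t - 1) <= 20^-1) ->
  forall t, cabs t <= rho / (64 * B) -> cabs (X t) <= (1 + eta) ^+ N * cabs (Y t).
Proof.
move=> B1 eta0 r0 r10; have B0 : 0 < B by lra.
(* At radius [r3] the Schwarz bound [4 * B / rho * r3] equals [1/4], so both roots stay near [1]. *)
pose r3 := rho / (16 * B); have r30 : 0 < r3 by rewrite divr_gt0 // mulr_gt0.
have r3r : r3 <= rho by rewrite ler_pdivrMr ?mulr_gt0 // ler_peMr ?(ltW r0) //; lra.
pose r1 := Num.min rho1 r3; have r1p : 0 < r1 by rewrite lt_min r10.
have [k Hk] := @expr_small R 2^-1 (r1 / r3) ltac:(lra) ltac:(lra) ltac:(by rewrite divr_gt0).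
(* The final bound [5 * a] for [x - y] is below [eta * (3/4)], and [3/4] is a lower bound for
   [|y|]. *)
pose m := k.+1; pose a := eta / 8; have a0 : 0 < a by rewrite divr_gt0.
have am0 : 0 < a ^+ m by rewrite exprn_gt0.
have [n Hn] := archi_nat (a ^+ m)^-1; exists n.+1 => N X Y nN AX AY X0 Y0 XYn0 XYB XY t ht.
have N0 : (0 < N)%N by apply: leq_trans nN.
have NR0 : 0 < (N%:R : R) by rewrite ltr0n.
have Na : N%:R^-1 <= a ^+ m.
  rewrite -[a ^+ m]invrK lef_pV2 ?posrE ?invr_gt0 //; apply: le_trans Hn _.
  by rewrite ler_nat ltnW.
have root1 F : disc_alg rho F -> F 0 = 1 -> (forall t, cabs t <= rho -> F t != 0) ->
    (forall t, cabs t <= rho -> cabs (F t) <= B ^+ N) ->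
  exists x, [/\ disc_alg rho x, x 0 = 1, forall t, cabs t <= rho -> x t ^+ N = F t &
    forall t, cabs t <= r3 -> cabs (x t - 1) <= 4^-1].
  move=> AF F0 Fn0 FB.
  have [|_ [x [Ax x0 xN]]] := @disc_alg_root _ N rho F 1 N0 (ltW r0) AF Fn0.
    by rewrite F0 expr1n.
  exists x; split=> // s hs; have hs' := le_trans hs r3r.
  have xB w : cabs w <= rho -> cabs (x w) <= B.
    move=> hw; rewrite -(@ler_pXn2r _ N) ?nnegrE ?cabs_ge0 ?(ltW B0) //.
    by rewrite -cabsX xN // FB.
  rewrite -x0; apply: le_trans (disc_alg_schwarz r0 Ax xB hs') _.
  have -> : 4^-1 = 4 * B / rho * r3 :> R by rewrite /r3; field; rewrite !gt_eqF.
  by rewrite ler_wpM2l // divr_ge0 ?(ltW r0) // mulr_ge0 // ltW.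
have [x [Ax x0 xN x1]] := root1 X AX X0
  ltac:(by move=> s /XYn0[]) ltac:(by move=> s /XYB[]).
have [y [Ay y0 yN y1]] := root1 Y AY Y0
  ltac:(by move=> s /XYn0[]) ltac:(by move=> s /XYB[]).
have Axr3 := disc_alg_sub r3r Ax; have Ayr3 := disc_alg_sub r3r Ay.
have r1r3 : r1 <= r3 by rewrite ge_min lexx orbT.
have r1rho1 : r1 <= rho1 by rewrite ge_min lexx.
have yge s : cabs s <= r3 -> 3 / 4 <= cabs (y s).
  by move=> /y1; have := cabs_le_sub 1 (y s); rewrite cabs1 cabsC; lra.
have ylt s : cabs s <= r3 -> cabs (y s) <= 5 / 4.
  by move=> /y1; have := cabsD (y s - 1) 1; rewrite subrK cabs1; lra.
have yn0 s : cabs s <= r3 -> y s != 0.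
  by move=> hs; rewrite -cabs_gt0 (lt_le_trans _ (yge s hs)) //; lra.
have Az : disc_alg r1 (fun s => x s / y s).
  apply: (disc_alg_sub r1r3); apply: disc_algM => //; apply: disc_algV_near1 => // s hs.
  by apply: le_trans (y1 s hs) _; lra.
have zclose s : cabs s <= r1 -> cabs (x s / y s - 1) <= 10^-1 / N%:R.
  apply: (near_unity_continuation N0 (ltW r1p) Az); first by rewrite x0 y0 divr1.
  move=> {}s hs; have hsr : cabs s <= rho by rewrite (le_trans hs) // (le_trans r1r3).
  by rewrite expr_div_n xN ?yN // XY // (le_trans hs).
have d1 s : cabs s <= r3 -> cabs (x s - y s) <= 1.
  move=> hs; have := cabs_distD (x s) 1 (y s); rewrite (cabsC 1).
  by have := x1 s hs; have := y1 s hs; lra.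
have d2 s : cabs s <= r1 -> cabs (x s - y s) <= 1 * a ^+ m.
  move=> hs; have hs3 := le_trans hs r1r3; have yn := yn0 s hs3.
  have -> : x s - y s = (x s / y s - 1) * y s by rewrite mulrBl divfK // mul1r.
  rewrite mul1r; apply: le_trans Na; rewrite cabsM.
  apply: (@le_trans _ _ (10^-1 / N%:R * (5 / 4))).
    by apply: ler_pM; rewrite ?cabs_ge0 ?zclose ?ylt.
  have : 0 < N%:R^-1 :> R by rewrite invr_gt0.
  lra.
have r3m : r3 <= 2 ^+ m * r1.
  rewrite -ler_pdivrMl ?exprn_gt0 // mulrC -ler_pdivlMl // mulrC.
  apply: le_trans Hk; rewrite -exprVn exprS ler_piMl ?exprn_ge0 ?invr_ge0 //; lra.
have ht3 : cabs t <= r3 / 4.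
  apply: le_trans ht _; rewrite le_eqVlt; apply/orP; left; apply/eqP.
  by rewrite /r3; field; rewrite gt_eqF.
have ht3' : cabs t <= r3 by lra.
have htr : cabs t <= rho by apply: le_trans r3r.
have := disc_alg_three_circles (ltn0Sn k) r1p r30 r1r3 r3m a0 ltr01
  (disc_algB Axr3 Ayr3) d1 d2 ht3.
rewrite mul1r -xN // -yN // !cabsX -exprMn => h.
have eta1 : 0 <= 1 + eta by lra.
rewrite lerXn2r ?nnegrE ?mulr_ge0 ?cabs_ge0 //.
have h1 := cabsD (x t - y t) (y t); rewrite subrK in h1.
have h2 := yge t ht3'.
have : eta * (3 / 4) <= eta * cabs (y t) by rewrite ler_pM2l.
rewrite /a in h; lra.
Qed.

Lemma exists_almost_max rho f : 0 <= rho -> disc_alg rho f ->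
    (exists2 t, cabs t <= rho & f t != 0) ->
  exists t0, [/\ cabs t0 <= rho, 0 < cabs (f t0) &
    forall t, cabs t <= rho -> cabs (f t) <= 2 * cabs (f t0)].
Proof.
move=> r0 Af [t1 ht1 ft1].
have [B B0 HB] := disc_alg_bounded Af.
pose S : set R := [set cabs (f t) | t in [set t | cabs t <= rho]]%classic.
have hS : has_sup S.
  by split; [exists (cabs (f t1)), t1|exists B => _ [t ht <-]; apply: HB].
have ub t : cabs t <= rho -> cabs (f t) <= sup S.
  by move=> ht; apply: sup_upper_bound => //; exists t.
have s0 : 0 < sup S by apply: lt_le_trans (ub _ ht1); rewrite cabs_gt0.
have [_ [t0 ht0 <-] h] := @sup_adherent _ S (sup S / 2) ltac:(by rewrite divr_gt0) hS.
exists t0; split=> // [|t /ub]; lra.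
Qed.

(** The slope [128 / rho] does not depend on [f]; only the radius [rho'] does. If [f] is large, let
    [M = |f(t0)|] be nearly its maximum: [1 - f * f(t0)] is zero-free, its root of an order [N]
    comparable to [M] is bounded by [4], and the Schwarz lemma for this root controls [M * |f|]. *)
Lemma bieberbach_eilenberg rho f : 0 < rho -> disc_alg rho f -> f 0 = 0 ->
    (forall s t, cabs s <= rho -> cabs t <= rho -> f s * f t != 1) ->
  exists2 rho', 0 < rho' & forall t, cabs t <= rho' -> cabs (f t) <= 128 / rho * cabs t.
Proof.
move=> r0 Af f0 ff1.
have [ex|none] := pselect (exists2 t, cabs t <= rho & f t != 0); last first.
  exists rho => // t ht; have [->|ft] := eqVneq (f t) 0.
    by rewrite cabs0 mulr_ge0 ?cabs_ge0 // divr_ge0 // ltW.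
  by case: none; exists t.
have [t0 [ht0 M0 Hmax]] := exists_almost_max (ltW r0) Af ex.
set M := cabs (f t0) in M0 Hmax.
have [Msmall|Mbig] := lerP (2 * M) 1.
  exists rho => // t ht.
  have f1 s : cabs s <= rho -> cabs (f s) <= 1 by move=> /Hmax h; lra.
  have := disc_alg_schwarz r0 Af f1 ht; rewrite f0 subr0 => /le_trans; apply.
  by rewrite ler_wpM2r ?cabs_ge0 // ler_wpM2r ?invr_ge0 ?(ltW r0) //; lra.
have M20 : 0 <= 2 * M by lra.
have /andP[N1 N2] := truncn_itv M20.
set N := (Num.truncn (2 * M)).+1 in N2.
have NR : N%:R <= 4 * M by rewrite -[N%:R]natr1; lra.
have N0 : (0 < N)%N by [].
have NR0 : 0 < (N%:R : R) by rewrite ltr0n.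
pose F t := 1 - f t * f t0.
have AF : disc_alg rho F.
  apply: disc_algB; first exact: disc_alg_cst.
  by apply: disc_algM => //; apply: disc_alg_cst.
have Fn0 t : cabs t <= rho -> F t != 0 by move=> ht; rewrite subr_eq0 eq_sym ff1.
have [|_ [m [Am m0 mN]]] := @disc_alg_root _ N rho F 1 N0 (ltW r0) AF Fn0.
  by rewrite /F f0 mul0r subr0 expr1n.
(* As [2 * M < N], the modulus of [F] is at most [1 + 2 * M ^ 2 <= 1 + N ^ 2 <= 4 ^ N]. *)
have pow4 k : 1 + k%:R * k%:R <= 4 ^+ k :> R.
  elim: k => [|k IH]; first by rewrite expr0; lra.
  rewrite exprS -[k.+1%:R]natr1; have : 0 <= (k%:R : R) by [].
  nra.
have mB t : cabs t <= rho -> cabs (m t) <= 4.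
  move=> ht; rewrite -(@ler_pXn2r _ N) ?nnegrE ?cabs_ge0 // -cabsX mN //.
  apply: le_trans (pow4 N); rewrite /F; apply: le_trans (cabsB _ _) _.
  rewrite cabs1 cabsM lerD2l -/M; have := Hmax t ht; have := cabs_ge0 (f t); nra.
exists (Num.min rho (rho / (32 * N%:R))).
  by rewrite lt_min r0 divr_gt0 // mulr_gt0.
move=> t; rewrite le_min => /andP[ht ht'].
have := disc_alg_schwarz r0 Am mB ht; rewrite m0 => hm.
have Nd : 2 * N%:R * (4 * 4 / rho * cabs t) <= 1.
  have E : 2 * N%:R * (4 * 4 / rho * (rho / (32 * N%:R))) = 1.
    by field; rewrite !gt_eqF.
  rewrite -[leRHS]E ler_wpM2l ?mulr_ge0 // ler_wpM2l // divr_ge0 ?(ltW r0) //; lra.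
have := cabs_expr_sub1 hm Nd (leqnn N).
rewrite mN // /F addrAC subrr add0r cabsN cabsM -/M => h.
rewrite -(ler_pM2r M0); apply: le_trans h _.
have tr0 : 0 <= cabs t / rho by rewrite divr_ge0 ?cabs_ge0 // ltW.
have : N%:R * (cabs t / rho) <= 4 * M * (cabs t / rho) by rewrite ler_wpM2r.
rewrite (_ : 128 / rho * cabs t * M = 32 * (4 * M * (cabs t / rho))); last by ring.
rewrite (_ : 2 * N%:R * (4 * 4 / rho * cabs t) = 32 * (N%:R * (cabs t / rho))); last by ring.
lra.
Qed.

End Comparison.

(** * The fixed point y = 1 *)

Section Dynamics.
Variables (R : realType) (r : nat).
Hypothesis r_gt0 : (0 < r)%N.
Local Notation C := (complex R).
Implicit Types (w e : C) (p : C * C).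

Let rR0 : 0 < (r%:R : R). Proof. by rewrite ltr0n. Qed.

(** The map [(1 + e) ^ (-r) - 1] has derivative [- r] at [0]; up to the factor [1 / w] it is the
    dynamics in the coordinate [dev] below. *)
Lemma fixpoint_multiplier (sg : R) : 0 < sg -> exists2 tau : R, 0 < tau &
  forall e, cabs e <= tau -> 1 + e != 0 /\
    (r%:R - sg) * cabs e <= cabs ((1 + e) ^- r - 1) <= (r%:R + sg) * cabs e.
Proof.
(* This [eta] solves [r * (1 + eta) = (r + sg) * (1 - eta)]. *)
move=> sg0; pose eta := sg / (2 * r%:R + sg).
have den0 : 0 < 2 * r%:R + sg by rewrite addr_gt0 // mulr_gt0.
have eta0 : 0 < eta by rewrite divr_gt0.
have etaE : eta * (2 * r%:R + sg) = sg by rewrite /eta divfK // gt_eqF.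
have eta1 : eta < 1 by rewrite /eta ltr_pdivrMr // mul1r ltrDr mulr_gt0.
exists (eta / (2 * r%:R)) => [|e he]; first by rewrite divr_gt0 // mulr_gt0.
have zd : cabs ((1 + e) - 1) <= eta / (2 * r%:R) by rewrite addrC addKr.
have tE : 2 * r%:R * (eta / (2 * r%:R)) = eta by rewrite mulrC divfK // mulf_neq0 // gt_eqF.
have Nd : 2 * r%:R * (eta / (2 * r%:R)) <= 1 by rewrite tE ltW.
have hz := cabs_expr_sub1 zd Nd (leqnn r); rewrite tE in hz.
have zn0 : (1 + e) ^+ r != 0.
  by apply: contraTneq hz => ->; rewrite sub0r cabsN cabs1 -ltNge.
split; first by apply: contraNneq zn0 => ->; rewrite expr0n gtn_eqF.
pose T := \sum_(i < r) (1 + e) ^+ i.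
have TE : (1 + e) ^- r - 1 = - (e * T / (1 + e) ^+ r).
  have := subrX1 (1 + e) r; rewrite [1 + e - 1]addrC addKr -/T => <-.
  by rewrite mulrBl mulfV // mul1r opprB.
have hT : cabs (T - r%:R) <= eta * r%:R.
  rewrite /T -[r in r%:R](card_ord r) -sumr_const -sumrB.
  apply: le_trans (cabs_sum _ _ _) _.
  rewrite mulr_natr -[X in _ <= _ *+ X](card_ord r) -sumr_const; apply: ler_sum => i _.
  apply: le_trans (cabs_expr_sub1 zd Nd (ltnW (ltn_ord i))) _.
  rewrite -[leRHS]tE; apply: ler_wpM2r; last by rewrite ler_wpM2l // ler_nat ltnW.
  by rewrite divr_ge0 ?(ltW eta0) // ltW // mulr_gt0.
have T1 : cabs T <= r%:R * (1 + eta).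
  by have := cabsD (T - r%:R) r%:R; rewrite subrK cabs_nat; lra.
have T2 : r%:R * (1 - eta) <= cabs T.
  by have := cabs_le_sub (r%:R : C) T; rewrite cabs_nat cabsC; lra.
have Z1 : cabs ((1 + e) ^+ r) <= 1 + eta.
  by have := cabsD ((1 + e) ^+ r - 1) 1; rewrite subrK cabs1; lra.
have Z2 : 1 - eta <= cabs ((1 + e) ^+ r).
  by have := cabs_le_sub 1 ((1 + e) ^+ r); rewrite cabs1 cabsC; lra.
rewrite TE cabsN cabs_div cabsM; have e0 := cabs_ge0 e.
move: (cabs T) (cabs ((1 + e) ^+ r)) (cabs e) T1 T2 Z1 Z2 e0 => U Z x U1 U2 Z1 Z2 x0.
have rR := rR0; have Z0 : 0 < Z by apply: lt_le_trans Z2; lra.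
rewrite ler_pdivlMr // ler_pdivrMr // ![_ * x * Z]mulrAC ![x * U]mulrC.
apply/andP; split; apply: ler_wpM2r => //.
  have [sgr|rsg] := lerP sg r%:R.
    apply: le_trans U2; apply: (@le_trans _ _ ((r%:R - sg) * (1 + eta))).
      by rewrite ler_wpM2l // subr_ge0.
    have : 0 <= eta * sg by rewrite mulr_ge0 // ltW.
    lra.
  apply: (@le_trans _ _ 0); last by apply: le_trans U2; rewrite mulr_ge0 ?subr_ge0 ?ltW.
  by rewrite mulr_le0_ge0 ?subr_le0 ?ltW // ltr_wpDr // ltW.
apply: (le_trans U1); apply: (@le_trans _ _ ((r%:R + sg) * (1 - eta))); first lra.
by rewrite ler_wpM2l // addr_ge0 ?ltW.
Qed.

(** This is [(y - 1) / w] for [y = p.1 / p.2]. Since [y + w - 1 = w * (1 + dev w p)], a step sends a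
    deviation [e] to [((1 + e) ^ (-r) - 1) / w]. *)
Definition dev w p : C := (p.1 - p.2) / (w * p.2).

Lemma dev_step w p : w != 0 -> p.2 != 0 -> 1 + dev w p != 0 ->
  (tree_step r w p).2 != 0 /\ dev w (tree_step r w p) = ((1 + dev w p) ^- r - 1) / w.
Proof.
move=> w0 p0 d0.
have E : p.1 + (w - 1) * p.2 = w * p.2 * (1 + dev w p).
  by rewrite /dev; field; rewrite w0 p0.
have n0 : (tree_step r w p).2 != 0 by rewrite /= E expf_neq0 // !mulf_neq0.
split=> //; rewrite [LHS]/dev.
have -> : (tree_step r w p).1 = (tree_step r w p).2 * (1 + dev w p) ^- r.
  by rewrite /= E [in RHS]exprMn mulfK // expf_neq0.
by move: ((1 + dev w p) ^- r) (tree_step r w p).2 n0 => Z D D0; field; rewrite w0 D0.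
Qed.

(** The radius [tau] is chosen before [w], so the contraction is uniform over all [w] with
    [|w| >= r + 2 * sg]. *)
Lemma attracting_step (sg : R) : 0 < sg -> exists2 tau : R, 0 < tau &
  forall w p, r%:R + 2 * sg <= cabs w -> p.2 != 0 -> cabs (dev w p) <= tau ->
    (tree_step r w p).2 != 0 /\
    cabs (dev w (tree_step r w p)) <= (r%:R + sg) / (r%:R + 2 * sg) * cabs (dev w p).
Proof.
move=> sg0; have [tau tau0 Htau] := fixpoint_multiplier sg0; exists tau => // w p hw p0 hd.
have rR := rR0; have wp : 0 < cabs w by apply: lt_le_trans hw; lra.
have w0 : w != 0 by rewrite -cabs_gt0.
have [d0 /andP[_ h]] := Htau _ hd; have [D0 ->] := dev_step w0 p0 d0.
split=> //; rewrite cabs_div ler_pdivrMr //; apply: (le_trans h).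
have sg2 : 0 < r%:R + 2 * sg by lra.
rewrite (_ : (r%:R + sg) * _ = (r%:R + sg) / (r%:R + 2 * sg) * cabs (dev w p) * (r%:R + 2 * sg)).
  by rewrite ler_wpM2l // mulr_ge0 ?cabs_ge0 // divr_ge0 ?ltW //; lra.
by field; rewrite gt_eqF.
Qed.

Lemma repelling_step (sg : R) : 0 < sg -> exists2 tau : R, 0 < tau &
  forall w p, w != 0 -> cabs w <= r%:R - sg -> p.2 != 0 -> cabs (dev w p) <= tau ->
    (tree_step r w p).2 != 0 /\ cabs (dev w p) <= cabs (dev w (tree_step r w p)).
Proof.
move=> sg0; have [tau tau0 Htau] := fixpoint_multiplier sg0; exists tau => // w p w0 hw p0 hd.
have wp : 0 < cabs w by rewrite cabs_gt0.
have [d0 /andP[h _]] := Htau _ hd; have [D0 ->] := dev_step w0 p0 d0.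
split=> //; rewrite [leRHS]cabs_div ler_pdivlMr //; apply: le_trans h.
by rewrite mulrC ler_wpM2r ?cabs_ge0.
Qed.

Lemma attracting_iter (sg : R) : 0 < sg -> exists2 tau : R, 0 < tau &
  forall w p n, r%:R + 2 * sg <= cabs w -> p.2 != 0 -> cabs (dev w p) <= tau ->
    (iter n (tree_step r w) p).2 != 0 /\
    cabs (dev w (iter n (tree_step r w) p)) <=
      ((r%:R + sg) / (r%:R + 2 * sg)) ^+ n * cabs (dev w p).
Proof.
move=> sg0; have [tau tau0 Htau] := attracting_step sg0; exists tau => // w p n hw p0 hd.
have rR := rR0; have sg1 : 0 < r%:R + sg by rewrite addr_gt0.
have sg2 : 0 < r%:R + 2 * sg by lra.
elim: n => [|n [IH1 IH2]]; first by rewrite expr0 mul1r.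
have mu0 : 0 <= (r%:R + sg) / (r%:R + 2 * sg) by rewrite divr_ge0 ?ltW.
have mu1 : (r%:R + sg) / (r%:R + 2 * sg) <= 1 by rewrite ler_pdivrMr ?mul1r //; lra.
have small : cabs (dev w (iter n (tree_step r w) p)) <= tau.
  by apply: le_trans IH2 _; apply: le_trans hd; rewrite ler_piMl ?cabs_ge0 // exprn_ile1.
have [h1 h2] := Htau _ _ hw IH1 small; rewrite iterS; split=> //.
by apply: le_trans h2 _; rewrite exprS -[leRHS]mulrA ler_wpM2l.
Qed.

End Dynamics.

(** * Fatou's argument: the critical orbit is attracted *)

Section Fatou.
Variables (R : realType) (r : nat).
Hypothesis r_gt0 : (0 < r)%N.
Local Notation C := (complex R).

Section InverseBranches.
Variables (w : C) (d : R).
Hypotheses (w0 : w != 0) (d0 : 0 < d).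
(** Free of division: [y_n] stays at distance at least [d] from [1], including the case [D_n = 0],
    where [y_n] is infinite. *)
Hypothesis far : forall n, d * cabs (tree_state r n w).2 <=
  cabs ((tree_state r n w).1 - (tree_state r n w).2).

(** [G] is an inverse branch, [f^n(G(t)) = 1 + t], in homogeneous coordinates with an unspecified
    scalar [c]. *)
Definition is_branch n (G : C -> C) := forall t, cabs t <= d / 2 ->
  exists2 c, c != 0 & iter n (tree_step r w) (G t, 1) = (c * (1 + t), c).

(** [0] is the point [y_1] of the critical orbit, so [G t = 0] would put [y_(n+1) = 1 + t] within
    [d / 2] of [1]. *)
Lemma branch_neq0 n G : is_branch n G -> forall t, cabs t <= d / 2 -> G t != 0.
Proof.
move=> bG t ht; apply/eqP => Gt0; have [c c0] := bG t ht.
rewrite Gt0 -(tree_state1 w r_gt0) -iterD addn1 => E.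
have := far n.+1; rewrite /tree_state E /=.
have -> : c * (1 + t) - c = c * t by ring.
rewrite cabsM mulrC ler_pM2l ?cabs_gt0 // => h.
by have d_gt0 := d0; lra.
Qed.

Lemma branch_inj n G : is_branch n G -> forall s t, cabs s <= d / 2 -> cabs t <= d / 2 ->
  G s = G t -> s = t.
Proof.
move=> bG s t hs ht Gst; have [c c0] := bG s hs; have [c' c'0] := bG t ht.
rewrite Gst => -> [E1 E2]; move: E1; rewrite E2 => /(mulfI c0).
by move=> /addrI.
Qed.

(** A branch is lifted by solving [(w / (y + w - 1)) ^ r = G]: the solution is [y = 1 + w * (m - 1)]
    with [m] an [r]-th root of [1 / G], which exists because [G] is zero-free; [m(0) = 1] keeps the
    fixed point. *)
Lemma branch_exists n : exists G, [/\ disc_alg (d / 2) G, G 0 = 1 & is_branch n G].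
Proof.
have d20 : 0 <= d / 2 by rewrite divr_ge0 // ltW.
elim: n => [|n [G [AG G0 bG]]].
  exists (fun t => 1 + t); split; last by move=> t _; exists 1; rewrite ?oner_neq0 // mul1r.
    by apply: disc_algD; [exact: disc_alg_cst|exact: disc_alg_id].
  by rewrite addr0.
have Gn0 := branch_neq0 bG.
have [|AGV _] := @disc_alg_root _ 1 _ G 1 isT d20 AG Gn0; first by rewrite G0 expr1.
have GVn0 t : cabs t <= d / 2 -> (G t)^-1 != 0 by move=> ht; rewrite invr_eq0 Gn0.
have [|_ [m [Am m0 mr]]] := @disc_alg_root _ r _ _ 1 r_gt0 d20 AGV GVn0.
  by rewrite G0 invr1 expr1n.
exists (fun t => 1 + w * (m t - 1)); split.
- apply: disc_algD; first exact: disc_alg_cst.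
  apply: disc_algM; first exact: disc_alg_cst.
  by apply: disc_algB => //; apply: disc_alg_cst.
- by rewrite m0 subrr mulr0 addr0.
move=> t ht; have [c c0 E] := bG t ht.
exists ((w ^+ r / G t) ^+ (r ^ n) * c).
  by rewrite mulf_neq0 // expf_neq0 // mulf_neq0 ?expf_neq0 // invr_eq0 Gn0.
have step1 : tree_step r w (1 + w * (m t - 1), 1) =
    (w ^+ r / G t * (G t, 1 : C).1, w ^+ r / G t * (G t, 1 : C).2).
  rewrite /tree_step /= !mulr1 divfK ?Gn0 //; congr (_, _).
  by rewrite -mr // -exprMn; congr (_ ^+ _); ring.
by rewrite iterSr step1 iter_tree_step_scale E /= mulrA.
Qed.

(** For the square root [k] of the branch, injectivity and zero-freeness give [k(s) + k(t) != 0],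
    which for the Cayley transform [f = (k - 1) / (k + 1)] says [f(s) * f(t) != 1]. The bound for
    [f] passes to [G] by [G - 1 = 4 * f / (1 - f) ^ 2]. *)
Lemma branch_koebe n G : disc_alg (d / 2) G -> G 0 = 1 -> is_branch n G ->
  exists2 rho, 0 < rho & forall t, cabs t <= rho -> cabs (G t - 1) <= 2048 / d * cabs t.
Proof.
move=> AG G0 bG; have d20 : 0 < d / 2 by rewrite divr_gt0.
have h0 : cabs (0 : C) <= d / 2 by rewrite cabs0 ltW.
have Gn0 := branch_neq0 bG.
have [|_ [k [Ak k0 kG]]] := @disc_alg_root _ 2 _ G 1 isT (ltW d20) AG Gn0.
  by rewrite G0 expr1n.
have kk s t : cabs s <= d / 2 -> cabs t <= d / 2 -> k s + k t != 0.
  move=> hs ht; apply/eqP => /eqP; rewrite addr_eq0 => /eqP kst.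
  have st : s = t.
    by apply: (branch_inj bG) => //; rewrite -!kG // kst sqrrN.
  move: kst => /eqP; rewrite st -addr_eq0 -mulr2n mulrn_eq0 /= => /eqP kt.
  by have := Gn0 t ht; rewrite -kG // kt expr0n eqxx.
have k1 t : cabs t <= d / 2 -> k t + 1 != 0 by move=> ht; rewrite -k0 kk.
have Ak1 : disc_alg (d / 2) (fun t => k t + 1).
  by apply: disc_algD => //; apply: disc_alg_cst.
have [|Ak1V _] := @disc_alg_root _ 1 _ _ 2 isT (ltW d20) Ak1 k1.
  by rewrite k0 expr1.
pose f t := (k t - 1) * (k t + 1)^-1.
have Af : disc_alg (d / 2) f.
  by apply: disc_algM => //; apply: disc_algB => //; apply: disc_alg_cst.
have f0 : f 0 = 0 by rewrite /f k0 subrr mul0r.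
have ff s t : cabs s <= d / 2 -> cabs t <= d / 2 -> f s * f t != 1.
  move=> hs ht; apply: contraNneq (kk s t hs ht) => E.
  have E2 : (k s - 1) * (k t - 1) = (k s + 1) * (k t + 1).
    move: E => /(congr1 (fun z => z * ((k s + 1) * (k t + 1)))); rewrite mul1r => <-.
    by rewrite /f; field; rewrite !k1.
  have : 2 * (k s + k t) = 0.
    by rewrite -(subrr ((k s - 1) * (k t - 1))) {1}E2; ring.
  by move/eqP; rewrite mulf_eq0 pnatr_eq0.
have [rho rho0 Hrho] := bieberbach_eilenberg d20 Af f0 ff.
exists (Num.min (d / 2) (Num.min rho (d / 1024))).
  by rewrite !lt_min d20 rho0 divr_gt0.
move=> t; rewrite !le_min => /and3P[h1 h2 h3].
have hf := Hrho t h2.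
have fsmall : cabs (f t) <= 4^-1.
  apply: (le_trans hf); rewrite -[leRHS](_ : 128 / (d / 2) * (d / 1024) = 4^-1).
    by rewrite ler_wpM2l // divr_ge0 // ltW.
  by field; rewrite gt_eqF.
have f1 : 3 / 4 <= cabs (1 - f t).
  by have := cabs_le_sub 1 (f t); rewrite cabs1; lra.
have f10 : 1 - f t != 0 by rewrite -cabs_gt0 (lt_le_trans _ f1) //; lra.
have kE : k t = (1 + f t) / (1 - f t).
  apply: (mulIf f10); rewrite divfK // /f; field; exact: k1.
have -> : G t - 1 = 4 * f t / (1 - f t) ^+ 2.
  rewrite -kG // kE; field; exact: f10.
rewrite cabs_div cabsM cabs_nat cabsX.
have f2 : 2^-1 <= cabs (1 - f t) ^+ 2 by rewrite expr2; nra.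
rewrite ler_pdivrMr; last by apply: lt_le_trans f2; lra.
have t0 : 0 <= cabs t / d by rewrite divr_ge0 ?cabs_ge0 // ltW.
have E : 2048 / d * cabs t = 2048 * (cabs t / d) by ring.
have E' : 128 / (d / 2) * cabs t = 256 * (cabs t / d) by field; rewrite gt_eqF.
rewrite E' in hf; rewrite E.
have : 2048 * (cabs t / d) * 2^-1 <= 2048 * (cabs t / d) * cabs (1 - f t) ^+ 2.
  by rewrite ler_wpM2l // mulr_ge0.
lra.
Qed.

End InverseBranches.

(** If the orbit stayed away from [1], the branches would expand by at most [2048 / d] at [1] for
    all [n], while [f^n], which they invert, contracts by [mu ^ n] there. *)
Lemma critical_orbit_attracted (w : C) (d : R) : r%:R < cabs w -> 0 < d ->
  exists n, cabs ((tree_state r n w).1 - (tree_state r n w).2) < d * cabs (tree_state r n w).2.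
Proof.
move=> hw d0; apply: contrapT => /forallNP none.
have far n : d * cabs (tree_state r n w).2 <= cabs ((tree_state r n w).1 - (tree_state r n w).2).
  by rewrite leNgt; apply/negP; apply: none.
have rR : 0 < (r%:R : R) by rewrite ltr0n.
have wp : 0 < cabs w by lra.
have w0 : w != 0 by rewrite -cabs_gt0.
pose sg := (cabs w - r%:R) / 2; have sg0 : 0 < sg by rewrite divr_gt0 // subr_gt0.
have hw' : r%:R + 2 * sg <= cabs w by rewrite /sg; lra.
have [tau tau0 Htau] := attracting_iter r_gt0 sg0.
set mu := (r%:R + sg) / (r%:R + 2 * sg) in Htau.
have mu0 : 0 <= mu by rewrite divr_ge0 //; lra.
have mu1 : mu < 1 by rewrite ltr_pdivrMr; lra.
clearbody mu.
(* With [mu ^ n <= d / 4096], going back along the branch and forward again would at least halve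
   [|t|]. *)
have [n Hn] := @expr_small _ mu (d / 4096) mu0 mu1 ltac:(by rewrite divr_gt0).
have [G [AG G0 bG]] := branch_exists w0 d0 far n.
have [rho rho0 Hrho] := branch_koebe d0 far AG G0 bG.
(* [x] lies in the domain of the branch and in the radius of its slope bound, and it puts [G(t)] in
   the disc where the iteration contracts. *)
pose x := Num.min (d / 2) (Num.min rho (tau * cabs w * (d / 2048))).
have y0 : 0 < tau * cabs w * (d / 2048) by rewrite !mulr_gt0 ?invr_gt0.
have x0 : 0 < x by rewrite !lt_min rho0 y0 divr_gt0.
have [x1 x2 x3] : [/\ x <= d / 2, x <= rho & x <= tau * cabs w * (d / 2048)].
  by rewrite /x !ge_min !lexx !orbT.
pose t : C := (x%:C)%C; have ct : cabs t = x by rewrite cabs_real gtr0_norm.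
have [c c0 E] : exists2 c, c != 0 & iter n (tree_step r w) (G t, 1) = (c * (1 + t), c).
  by apply: bG; rewrite ct.
have hG := Hrho t; rewrite ct in hG; have {}hG := hG x2.
have dE : dev w (G t, 1) = (G t - 1) / w by rewrite /dev /= mulr1.
have dE' : dev w (c * (1 + t), c) = t / w by rewrite /dev /=; field; rewrite w0 c0.
have hdev : cabs (dev w (G t, 1)) <= tau.
  rewrite dE cabs_div ler_pdivrMr //; apply: (le_trans hG).
  have -> : tau * cabs w = 2048 / d * (tau * cabs w * (d / 2048)) by field; rewrite gt_eqF.
  by apply: ler_wpM2l => //; rewrite divr_ge0 // ltW.
have [_] := Htau w (G t, 1) n hw' (oner_neq0 _) hdev.
rewrite E dE' dE !cabs_div mulrA ler_pM2r ?invr_gt0 // ct => h.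
have : mu ^+ n * cabs (G t - 1) <= d / 4096 * (2048 / d * x).
  by apply: ler_pM; rewrite ?exprn_ge0 ?cabs_ge0.
have -> : d / 4096 * (2048 / d * x) = x / 2 by field; rewrite gt_eqF.
move/(le_trans h); rewrite ler_pdivlMr // => x2x.
by have : x < x * 2; [rewrite ltr_pMr // ltr1n|rewrite ltNge x2x].
Qed.

End Fatou.

(** * Zero-free polynomials near the circle *)

Section Growth.
Variables (R : realType) (r : nat).
Hypothesis r_gt1 : (1 < r)%N.
Local Notation C := (complex R).
Implicit Types (w : C) (p : C * C).

(** Measures the size of a state even where one of its components vanishes. *)
Definition height p : R := Num.max (cabs p.1) (cabs p.2).

Lemma height1 p : cabs p.1 <= height p. Proof. by rewrite le_max lexx. Qed.
Lemma height2 p : cabs p.2 <= height p. Proof. by rewrite le_max lexx orbT. Qed.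
Lemma height_ge0 p : 0 <= height p. Proof. exact: le_trans (cabs_ge0 _) (height1 p). Qed.
Lemma height_le p x : cabs p.1 <= x -> cabs p.2 <= x -> height p <= x.
Proof. by rewrite ge_max => -> ->. Qed.
Lemma heightB p : cabs (p.1 - p.2) <= 2 * height p.
Proof. by have := cabsB p.1 p.2; have := height1 p; have := height2 p; lra. Qed.

Lemma height_diff_le p d : cabs (p.1 - p.2) <= d * height p -> d <= 2^-1 ->
  height p <= 2 * cabs p.1 /\ height p <= 2 * cabs p.2.
Proof.
move=> h hd; have h0 := height_ge0 p.
have {}h : cabs (p.1 - p.2) <= height p / 2.
  by apply: (le_trans h); rewrite mulrC ler_wpM2l.
have h1 := cabs_le_sub p.1 p.2; have h2 := cabs_le_sub p.2 p.1; rewrite cabsC in h2.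
have [E|E] : height p = cabs p.1 \/ height p = cabs p.2.
- by rewrite /height; case: leP; [right|left].
- by split; lra.
by split; lra.
Qed.

Variable L : R.
Hypothesis L1 : 1 <= L.

Lemma height_step_le w p : cabs w <= L -> height (tree_step r w p) <= (3 * L * height p) ^+ r.
Proof.
have hL := L1; move=> hw; have h0 := height_ge0 p.
have h1 := height1 p; have h2 := height2 p.
have hLh : height p <= L * height p by rewrite ler_peMl.
have wp : cabs (w * p.2) <= L * height p by rewrite cabsM ler_pM ?cabs_ge0.
apply: height_le; rewrite /= cabsX lerXn2r ?nnegrE ?cabs_ge0 ?mulr_ge0 //; try lra.
have -> : p.1 + (w - 1) * p.2 = p.1 + w * p.2 - p.2 by ring.
have := cabsB (p.1 + w * p.2) p.2; have := cabsD p.1 (w * p.2); lra.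
Qed.

(** For [|w| >= 1] the pair is recovered from [a = w * p.2] and [b] through [p.1 = b - a + p.2], so
    a step cannot shrink the height much. *)
Lemma height_step_ge w p : cabs w <= L -> 1 <= cabs w ->
  height p ^+ r <= (3 * L) ^+ r * height (tree_step r w p).
Proof.
have hL := L1; move=> hw w1; have wn0 : w != 0 by rewrite -cabs_gt0; lra.
pose a := w * p.2; pose b := p.1 + (w - 1) * p.2; pose m := height (a, b).
have ma : cabs a <= m := height1 (a, b); have mb : cabs b <= m := height2 (a, b).
have m0 : 0 <= m := height_ge0 _.
have mL : m <= L * m by rewrite ler_peMl.
have mr : m ^+ r = height (tree_step r w p).
  rewrite /m /height /= -/a -/b !cabsX; case: (leP (cabs a)) => h.
    by apply/esym/max_idPr; rewrite lerXn2r ?nnegrE ?cabs_ge0.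
  by apply/esym/max_idPl; rewrite lerXn2r ?nnegrE ?cabs_ge0 // ltW.
rewrite -mr -exprMn lerXn2r ?nnegrE ?height_ge0 ?mulr_ge0 //; first lra.
have p2a : cabs p.2 <= cabs a by rewrite cabsM ler_peMl ?cabs_ge0.
apply: height_le; last lra.
have -> : p.1 = b - a + p.2 by rewrite /a /b; ring.
have := cabsD (b - a) p.2; have := cabsB b a; lra.
Qed.

(** Up to a factor exponential in [r ^ j], [j] steps raise the height to the power [r ^ j]. *)
Lemma height_iter w n j : cabs w <= L -> 1 <= cabs w ->
  height (tree_state r n w) ^+ (r ^ j) <= (3 * L) ^+ (2 * r ^ j) * height (tree_state r (n + j) w) /\
  height (tree_state r (n + j) w) <= (3 * L) ^+ (2 * r ^ j) * height (tree_state r n w) ^+ (r ^ j).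
Proof.
have hL := L1; move=> hw w1; have K1 : 1 <= 3 * L by lra.
have K0 : 0 <= 3 * L by lra.
(* The exponent [2 * r ^ j - 2] reproduces itself in the induction: [(2 * r ^ j - 2) * r + r <= 2 *
   r ^ j.+1 - 2] because [r >= 2]. *)
suff [h1 h2] : height (tree_state r n w) ^+ (r ^ j) <=
    (3 * L) ^+ (2 * r ^ j - 2) * height (tree_state r (n + j) w) /\
    height (tree_state r (n + j) w) <=
    (3 * L) ^+ (2 * r ^ j - 2) * height (tree_state r n w) ^+ (r ^ j).
  split.
    by apply: (le_trans h1); rewrite ler_wpM2r ?height_ge0 // ler_weXn2l // leq_subr.
  by apply: (le_trans h2); rewrite ler_wpM2r ?exprn_ge0 ?height_ge0 // ler_weXn2l // leq_subr.
elim: j => [|j [IH1 IH2]]; first by rewrite expn0 expr1 addn0 expr0 !mul1r.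
have rj : (0 < r ^ j)%N by rewrite expn_gt0 (ltnW r_gt1).
have le_e : ((2 * r ^ j - 2) * r + r <= 2 * r ^ j.+1 - 2)%N.
  rewrite expnSr mulnBl mulnA -[X in (_ - _ + X <= _)%N]mul1n.
  have : (2 * r <= 2 * r ^ j * r)%N by rewrite leq_mul2r leq_pmulr ?orbT.
  move: (2 * r ^ j * r)%N => x; lia.
have hn k := height_ge0 (tree_state r k w).
rewrite addnS tree_stateS; split.
  rewrite expnSr exprM; apply: (@le_trans _ _ (((3 * L) ^+ (2 * r ^ j - 2) * height (tree_state r (n + j) w)) ^+ r)).
    by rewrite lerXn2r ?nnegrE ?mulr_ge0 ?exprn_ge0.
  rewrite exprMn -exprM; apply: le_trans (ler_wpM2l _ (height_step_ge _ hw w1)) _.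
    by rewrite exprn_ge0.
  by rewrite mulrA -exprD ler_wpM2r ?height_ge0 // ler_weXn2l // -expnSr.
apply: le_trans (height_step_le _ hw) _; rewrite [X in X <= _]exprMn expnSr exprM.
apply: (@le_trans _ _ ((3 * L) ^+ r * ((3 * L) ^+ (2 * r ^ j - 2) * height (tree_state r n w) ^+ (r ^ j)) ^+ r)).
  by rewrite ler_wpM2l ?exprn_ge0 // lerXn2r ?nnegrE ?mulr_ge0 ?exprn_ge0.
rewrite [X in _ * X <= _]exprMn -[(_ ^+ (_ - _)) ^+ r]exprM mulrA -exprD ler_wpM2r ?exprn_ge0 // ler_weXn2l //.
by rewrite addnC -expnSr.
Qed.

Lemma height_tree_state w n : cabs w <= L -> 1 <= cabs w ->
  height (tree_state r n w) <= (3 * L) ^+ (2 * r ^ n) /\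
  1 <= (3 * L) ^+ (2 * r ^ n) * height (tree_state r n w).
Proof.
move=> hw w1; have [] := height_iter 0 n hw w1; rewrite add0n.
have -> : height (tree_state r 0 w) = 1.
  rewrite -[LHS]/(Num.max (cabs (1 : C)) (cabs (0 : C))) cabs1 cabs0.
  exact/max_idPl.
by rewrite expr1n mulr1.
Qed.

End Growth.

Section NearlyConstant.
Variable R : realType.
Local Notation C := (complex R).

(** If the uniform limit is nonzero at [0], the terms of large index are nearly constant, in ratio,
    on one small disc common to all of them. *)
Lemma near_const (rho : R) (u : nat -> C -> C) (ui : C -> C) : 0 < rho -> disc_alg rho ui ->
    ui 0 != 0 ->
    (forall e, 0 < e -> exists n1, forall n t, (n1 <= n)%N -> cabs t <= rho -> cabs (u n t - ui t) <= e) ->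
  forall e, 0 < e -> exists n1, exists2 rho', 0 < rho' <= rho &
    forall n t, (n1 <= n)%N -> cabs t <= rho' ->
    [/\ cabs (ui 0) / 2 <= cabs (u n 0), cabs (u n 0) <= 2 * cabs (ui 0), u n t != 0,
        cabs (u n t / u n 0 - 1) <= e & cabs (u n 0 / u n t - 1) <= e].
Proof.
move=> r0 Aui ui0 lim e e0; pose c := cabs (ui 0).
have c0 : 0 < c by rewrite cabs_gt0.
pose d := c * Num.min e 1 / 8.
have m0 : 0 < Num.min e 1 by rewrite lt_min e0 ltr01.
have d0 : 0 < d by rewrite divr_gt0 // mulr_gt0.
have d1 : d <= c / 8 by rewrite ler_pM2r ?invr_gt0 // ler_piMr ?(ltW c0) // ge_min lexx orbT.
have de : 8 * d <= c * e.
  have -> : 8 * d = c * Num.min e 1 by rewrite /d; field.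
  by rewrite ler_pM2l // ge_min lexx.
have [n1 Hn1] := lim d d0; have [dd dd0 Hdd] := disc_alg_ucont Aui d0.
exists n1; exists (Num.min rho dd); first by rewrite lt_min r0 dd0 ge_min lexx.
move=> n t hn; rewrite le_min => /andP[ht ht'].
have h0 : cabs (0 : C) <= rho by rewrite cabs0 ltW.
have a1 := Hn1 n 0 hn h0; have a2 := Hn1 n t hn ht.
have a3 : cabs (ui t - ui 0) <= d by apply: Hdd; rewrite ?subr0.
have b1 : c - d <= cabs (u n 0).
  by have := cabs_le_sub (ui 0) (u n 0); rewrite (cabsC (ui 0)) -/c; lra.
have b1' : cabs (u n 0) <= c + d.
  by have := cabs_le_sub (u n 0) (ui 0); rewrite -/c; lra.
have b2 : c - 2 * d <= cabs (u n t).
  have := cabs_le_sub (ui t) (u n t); have := cabs_le_sub (ui 0) (ui t).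
  by rewrite (cabsC (ui t) (u n t)) (cabsC (ui 0) (ui t)) -/c; lra.
have b3 : cabs (u n t - u n 0) <= 3 * d.
  have := cabs_distD (u n t) (ui t) (u n 0); have := cabs_distD (ui t) (ui 0) (u n 0).
  by rewrite (cabsC (ui 0) (u n 0)); lra.
have n0 : u n 0 != 0 by rewrite -cabs_gt0; lra.
have nt : u n t != 0 by rewrite -cabs_gt0; lra.
split=> //; rewrite -?/c; try lra.
  have -> : u n t / u n 0 - 1 = (u n t - u n 0) / u n 0 by rewrite mulrBl divff.
  rewrite cabs_div ler_pdivrMr ?cabs_gt0 //; apply: (le_trans b3).
  have : e * (c / 2) <= e * cabs (u n 0) by rewrite ler_pM2l //; lra.
  lra.
have -> : u n 0 / u n t - 1 = - ((u n t - u n 0) / u n t) by rewrite mulrBl divff // opprB.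
rewrite cabsN cabs_div ler_pdivrMr ?cabs_gt0 //; apply: (le_trans b3).
have : e * (c / 2) <= e * cabs (u n t) by rewrite ler_pM2l //; lra.
lra.
Qed.

End NearlyConstant.

Lemma gap_persists (R : realFieldType) (tau g D0 Dt E0 Et : R) : 0 < tau -> 0 < g ->
  2 * (1 + tau) * g = tau * D0 - E0 -> D0 - Dt <= g -> Et - E0 <= g -> Et < tau * Dt.
Proof.
move=> tau0 g0 gE hD hE; have tg : 0 < tau * g by rewrite mulr_gt0.
have : tau * (D0 - Dt) <= tau * g by rewrite ler_pM2l.
lra.
Qed.

(** * The recursion in the coordinate [k = v + t] *)

Section Stages.
Variables (R : realType) (r : nat).
Hypothesis r_gt1 : (1 < r)%N.
Local Notation C := (complex R).
Variable v : C.

Let r_gt0 : (0 < r)%N := ltnW r_gt1.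

(** With [w = - k ^ r], the form [a ^ r + w * b ^ r] splits into linear factors in [a] and [b]. *)
Definition w_at (t : C) : C := - (v + t) ^+ r.
Definition state_at n t := tree_state r n (w_at t).
Definition p_at n t := (state_at n t).1 + w_at t * (state_at n t).2.
Definition diff_at n t := (state_at n t).1 - (state_at n t).2.

Lemma w_at_horner t : w_at t = (- ('X + v%:P) ^+ r).[t].
Proof. by rewrite hornerN horner_exp hornerD hornerX hornerC addrC. Qed.

Lemma disc_alg_w rho : disc_alg rho w_at.
Proof. by apply: disc_alg_ext (disc_alg_horner _ (- ('X + v%:P) ^+ r)) => t _; rewrite -w_at_horner. Qed.

Lemma disc_alg_S rho n : disc_alg rho (fun t => (state_at n t).1).
Proof.
apply: disc_alg_ext (disc_alg_horner _ (tree_state r n (- ('X + v%:P) ^+ r)).1) => t _.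
by rewrite /state_at w_at_horner tree_state_horner.
Qed.

Lemma disc_alg_D rho n : disc_alg rho (fun t => (state_at n t).2).
Proof.
apply: disc_alg_ext (disc_alg_horner _ (tree_state r n (- ('X + v%:P) ^+ r)).2) => t _.
by rewrite /state_at w_at_horner tree_state_horner.
Qed.

Lemma disc_alg_p rho n : disc_alg rho (p_at n).
Proof.
by apply: disc_algD (disc_alg_S _ _) (disc_algM (disc_alg_w _) (disc_alg_D _ _)).
Qed.

Lemma disc_alg_diff rho n : disc_alg rho (diff_at n).
Proof. exact: disc_algB (disc_alg_S _ _) (disc_alg_D _ _). Qed.

(** Exponential convergence of [y_n] to [1], stated relative to the height so that no quotient
    appears. *)
Definition attracted (A theta rho1 : R) := forall n t, cabs t <= rho1 ->
  cabs (diff_at n t) <= A * theta ^+ n * height (state_at n t).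

(** By Fatou's argument some [y_(n0)] is in the contracting disc at [t = 0], hence also for [t] near
    [0] by continuity; from there on the contraction is geometric. *)
Lemma outside_attracted : r%:R < cabs (w_at 0) ->
  exists A theta rho1 : R, [/\ 2 <= A, 0 < theta < 1, 0 < rho1 & attracted A theta rho1].
Proof.
move=> hw; pose sg := (cabs (w_at 0) - r%:R) / 4.
have rR : 1 <= (r%:R : R) by rewrite ler1n.
have sg0 : 0 < sg by rewrite divr_gt0 // subr_gt0.
have [tau tau0 Htau] := attracting_iter r_gt0 sg0.
set mu := (r%:R + sg) / (r%:R + 2 * sg) in Htau.
have mu0 : 0 < mu by rewrite divr_gt0; lra.
have mu1 : mu < 1 by rewrite ltr_pdivrMr; lra.
clearbody mu.
have [n0 Hn0] := critical_orbit_attracted r_gt0 hw tau0.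
rewrite -/(state_at n0 0) -/(diff_at n0 0) in Hn0.
(* Both terms of [Hn0] may move by [g] without losing the strict inequality. *)
pose g := (tau * cabs (state_at n0 0).2 - cabs (diff_at n0 0)) / (2 * (1 + tau)).
have tau1 : 0 < 1 + tau by lra.
have g0 : 0 < g by rewrite divr_gt0 ?subr_gt0 // mulr_gt0.
have gE : 2 * (1 + tau) * g = tau * cabs (state_at n0 0).2 - cabs (diff_at n0 0).
  by rewrite mulrC divfK // mulf_neq0 // gt_eqF.
clearbody g.
have [d1 d10 Hd1] := disc_alg_ucont (disc_alg_w 1) sg0.
have [d2 d20 Hd2] := disc_alg_ucont (disc_alg_D 1 n0) g0.
have [d3 d30 Hd3] := disc_alg_ucont (disc_alg_diff 1 n0) g0.
pose rho1 := Num.min 1 (Num.min d1 (Num.min d2 d3)).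
have [Lw Lw0 HLw] := disc_alg_bounded (disc_alg_w 1).
have pmu0 : 0 < mu ^+ n0 by rewrite exprn_gt0.
(* Dividing by [mu ^+ n0] covers the stages before [n0], which only get the trivial bound
   [2 * height]. *)
exists ((2 + tau * Lw) / mu ^+ n0), mu, rho1.
have tL0 : 0 < tau * Lw by rewrite mulr_gt0.
have A2 : 2 + tau * Lw <= (2 + tau * Lw) / mu ^+ n0.
  by rewrite ler_pdivlMr // ler_piMr ?exprn_ile1 ?(ltW mu0) ?(ltW mu1) //; lra.
split; first lra.
- by rewrite mu0.
- by rewrite !lt_min ltr01 d10 d20.
move=> n t; rewrite !le_min => /and4P[h1 h2 h3 h4].
have z1 : cabs (0 : C) <= 1 by rewrite cabs0.
have hwt : r%:R + 2 * sg <= cabs (w_at t).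
  have := Hd1 t 0 h1 z1; rewrite subr0 => /(_ h2).
  by rewrite cabsC; have := cabs_le_sub (w_at 0) (w_at t); rewrite /sg; lra.
have wt1 : 1 <= cabs (w_at t).
  by apply: le_trans hwt; apply: (le_trans rR); rewrite lerDl mulr_ge0 // ltW.
have wt0 : 0 < cabs (w_at t) := lt_le_trans ltr01 wt1.
have hE : cabs (diff_at n0 t) < tau * cabs (state_at n0 t).2.
  have := Hd2 t 0 h1 z1; have := Hd3 t 0 h1 z1; rewrite subr0 => /(_ h4) e1 /(_ h3) e2.
  apply: (gap_persists tau0 g0 gE).
    by apply: le_trans e2; rewrite cabsC cabs_le_sub.
  exact: le_trans (cabs_le_sub _ _) e1.
have D0 : (state_at n0 t).2 != 0.
  apply: contraTneq hE => ->; rewrite cabs0 mulr0 -leNgt; exact: cabs_ge0.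
have dev0 : cabs (dev (w_at t) (state_at n0 t)) <= tau.
  rewrite /dev cabs_div cabsM ler_pdivrMr ?mulr_gt0 ?cabs_gt0 // -?cabs_gt0 //.
  by apply: (le_trans (ltW hE)); rewrite ler_pM2l // ler_peMl ?cabs_ge0.
have hh := height_ge0 (state_at n t).
have [nn0|n0n] := ltnP n n0.
  apply: (le_trans (heightB _)); rewrite ler_wpM2r //.
  rewrite mulrAC ler_pdivlMr //.
  rewrite [leRHS]mulrDl; apply: ler_wpDr; first by rewrite !mulr_ge0 ?exprn_ge0 ?ltW.
  by rewrite ler_pM2l // ler_wiXn2l ?(ltW mu0) ?(ltW mu1) // ltnW.
have [Dn0 devn] := Htau (w_at t) (state_at n0 t) (n - n0)%N hwt D0 dev0.
rewrite -iterD subnK // -/(tree_state r n (w_at t)) -/(state_at n t) in Dn0 devn.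
have -> : diff_at n t = dev (w_at t) (state_at n t) * (w_at t * (state_at n t).2).
  by rewrite /dev divfK // mulf_neq0 // -cabs_gt0.
rewrite cabsM [cabs (_ * _.2)]cabsM.
apply: (@le_trans _ _ (mu ^+ (n - n0) * tau * (Lw * height (state_at n t)))).
  apply: ler_pM; rewrite ?mulr_ge0 ?cabs_ge0 //.
    by apply: (le_trans devn); rewrite ler_wpM2l // exprn_ge0 // ltW.
  by apply: ler_pM; rewrite ?cabs_ge0 ?HLw ?height2.
rewrite !mulrA ler_wpM2r //.
have -> : mu ^+ n = mu ^+ (n - n0) * mu ^+ n0 by rewrite -exprD subnK.
rewrite (mulrC (mu ^+ (n - n0)) (mu ^+ n0)) mulrA divfK ?gt_eqF //.
rewrite [leRHS]mulrDl -mulrA [leLHS]mulrC lerDr mulr_ge0 //.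
by rewrite exprn_ge0 // ltW.
Qed.

End Stages.

(** * Real estimates for the growth bounds *)

Section RealEstimates.
Variables (R : realType) (N : nat) (K M s u : R).
Hypotheses (K3 : 3 <= K) (N0 : (0 < N)%N).

Lemma power_lower1 : 1 <= K ^+ (2 * N) * M -> M <= 2 * s -> 4^-1 <= u -> 0 <= s ->
  1 <= K ^+ (4 * N) * (s * u).
Proof.
have hK := K3; move=> h1 h2 h3 s0; apply: (le_trans h1).
have -> : (4 * N = 2 * N + ((N - 1) + (N - 1) + 2))%N by move: N0; lia.
have Kk k : 1 <= K ^+ k by rewrite exprn_ege1 //; lra.
have Kp k : 0 <= K ^+ k by apply: le_trans (Kk k).
rewrite exprD -mulrA; apply: ler_wpM2l => //; rewrite exprD -mulrA.
have su : s * 4^-1 <= s * u by apply: ler_wpM2l.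
have su0 : 0 <= s * u by apply: le_trans su; lra.
have : 9 * (s * u) <= K ^+ 2 * (s * u) by apply: ler_wpM2r => //; rewrite expr2; nra.
have : 1 * (K ^+ 2 * (s * u)) <= K ^+ (N - 1 + (N - 1)) * (K ^+ 2 * (s * u)).
  by apply: ler_wpM2r => //; apply: mulr_ge0.
lra.
Qed.

Lemma power_upper1 : M <= K ^+ (2 * N) -> K * M <= K ^+ (6 * N).
Proof.
move=> h; have K1 : 1 <= K by have := K3; lra.
apply: (@le_trans _ _ (K * K ^+ (2 * N))); first by apply: ler_wpM2l => //; lra.
by rewrite -exprS ler_weXn2l //; move: N0; lia.
Qed.

Variable r : nat.
Hypothesis rN : (r <= N)%N.

Lemma power_lower : 1 <= K ^+ (2 * N) * M -> M <= 2 * s -> 1 <= K * u -> 0 <= s ->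
  1 <= K ^+ (4 * N) * (s * u ^+ r).
Proof.
have hK := K3; move=> h1 h2 h3 s0; apply: (le_trans h1).
have -> : (4 * N = 2 * N + ((N - r) + (N - 1) + 1 + r))%N by move: N0 rN; lia.
have Kk k : 1 <= K ^+ k by rewrite exprn_ege1 //; lra.
have Kp k : 0 <= K ^+ k by apply: le_trans (Kk k).
have ur : 1 <= K ^+ r * u ^+ r by rewrite -exprMn exprn_ege1.
rewrite exprD -mulrA; apply: ler_wpM2l => //; rewrite exprD mulrACA.
have : K * s <= K ^+ (N - r + (N - 1) + 1) * s.
  apply: ler_wpM2r => //; rewrite exprD expr1; apply: ler_peMl => //; lra.
have : K ^+ (N - r + (N - 1) + 1) * s * 1 <= K ^+ (N - r + (N - 1) + 1) * s * (K ^+ r * u ^+ r).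
  by apply: ler_wpM2l => //; apply: mulr_ge0.
have : 2 * s <= K * s by apply: ler_wpM2r => //; lra.
lra.
Qed.

Lemma power_upper : M <= K ^+ (2 * N) -> K ^+ (2 * r) * (K ^+ r * M) <= K ^+ (6 * N).
Proof.
move=> h; have K1 : 1 <= K by have := K3; lra.
apply: (@le_trans _ _ (K ^+ (2 * r) * (K ^+ r * K ^+ (2 * N)))).
  by do 2![apply: ler_wpM2l; first by apply: exprn_ge0; lra].
by rewrite -!exprD ler_weXn2l //; move: rN; lia.
Qed.

End RealEstimates.

(** [K ^ (6 N)] is an upper bound for the functions compared below; [K ^ (4 N)] accounts for
    dividing them by their values at [0]. *)
Lemma expr10_split (R : realType) (K : R) N : (K ^+ 10) ^+ N = K ^+ (6 * N) * K ^+ (4 * N).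
Proof. by rewrite -exprM -exprD; congr (_ ^+ _); lia. Qed.

Lemma quotient_identity (F : fieldType) (a a0 u u0 q q0 : F) n :
    a != 0 -> a0 != 0 -> u != 0 -> u0 != 0 -> q != 0 -> q0 != 0 ->
  (a * u) ^+ n / (a0 * u0) ^+ n / (a ^+ n * q / (a0 ^+ n * q0)) = (u / u0) ^+ n * (q0 / q).
Proof.
move=> /(expf_neq0 n) a1 /(expf_neq0 n) a01 /(expf_neq0 n) u1 /(expf_neq0 n) u01 q1 q01.
rewrite !exprMn exprVn; move: (a ^+ n) (a0 ^+ n) (u ^+ n) (u0 ^+ n) a1 a01 u1 u01.
by move=> b b0 y y0 b1 b01 y1 y01; field; rewrite b01 b1 q1 q01 y01.
Qed.

Lemma expr_ratio_bound (R : realType) (r : nat) (L u0 u q s : R) : 1 <= L -> u0 <= 1 + L -> u <= 2 * u0 ->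
  0 <= u -> 4^-1 <= q -> 0 <= s -> s * u ^+ r <= (3 * L) ^+ (2 * r + 2) * (s * q).
Proof.
move=> L1 h1 h2 u_ge0 hq s0; have K9 : 9 * L <= (3 * L) ^+ 2 by rewrite expr2; nra.
have Kp : 0 <= (3 * L) ^+ (2 * r) by apply: exprn_ge0; lra.
rewrite [leRHS]mulrCA; apply: ler_wpM2l => //; rewrite exprD -mulrA.
apply: (@le_trans _ _ ((3 * L) ^+ (2 * r) * 1)).
  by rewrite mulr1 exprM lerXn2r ?nnegrE //; lra.
apply: ler_wpM2l => //; apply: (@le_trans _ _ ((3 * L) ^+ 2 * 4^-1)); first lra.
by apply: ler_wpM2l; lra.
Qed.

Lemma clear_denominators (R : realFieldType) (x x0 y y0 e k : R) : 0 < x0 -> 0 < y0 ->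
  0 <= e -> 0 <= y -> x / x0 <= e * (y / y0) -> x0 <= k * y0 -> x <= k * e * y.
Proof.
move=> x00 y00 e0 y_ge0; rewrite ler_pdivrMr // => h hk; apply: (le_trans h).
apply: (@le_trans _ _ (e * (y / y0) * (k * y0))).
  by apply: ler_wpM2l => //; rewrite mulr_ge0 // divr_ge0 // ltW.
by rewrite le_eqVlt; apply/orP; left; apply/eqP; field; rewrite gt_eqF.
Qed.

Section NearOne.
Variable R : realType.
Local Notation C := (complex R).

Lemma near1_expr (r : nat) (z : C) : (0 < r)%N -> cabs (z - 1) <= (100 * r%:R)^-1 ->
  cabs (z ^+ r - 1) <= 50^-1.
Proof.
move=> r0 hz; have rR : 0 < (r%:R : R) by rewrite ltr0n.
have E : 2 * r%:R * (100 * r%:R)^-1 = 50^-1 :> R by field; rewrite gt_eqF.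
by rewrite -E; apply: (cabs_expr_sub1 hz _ (leqnn r)); rewrite E; lra.
Qed.

Lemma near1_prod (a b : C) : cabs (a - 1) <= 50^-1 -> cabs (b - 1) <= 50^-1 ->
  cabs (a * b - 1) <= 20^-1.
Proof.
move=> ha hb; have -> : a * b - 1 = (a - 1) * (b - 1) + (a - 1) + (b - 1) by ring.
have g1 := cabsD ((a - 1) * (b - 1) + (a - 1)) (b - 1).
have g2 := cabsD ((a - 1) * (b - 1)) (a - 1).
have g3 : cabs ((a - 1) * (b - 1)) <= 50^-1 * 50^-1.
  by rewrite cabsM ler_pM ?cabs_ge0.
lra.
Qed.

End NearOne.

(** * Linear factors of a zero-free polynomial *)

Section ZeroFree.
Variables (R : realType) (r : nat).
Hypothesis r_gt1 : (1 < r)%N.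
Local Notation C := (complex R).
Variables (v : C) (rho L : R).
Hypotheses (rho0 : 0 < rho) (L1 : 1 <= L).
(** The bound [3 / 2 <= |w|] keeps the limit [1 + w] of the normalised [p] away from [0]; the last
    clause does the same for the limits [1 - x * k] of the linear factors. *)
Hypothesis box : forall t : C, cabs t <= rho ->
  [/\ cabs (w_at r v t) <= L, 3 / 2 <= cabs (w_at r v t), cabs (v + t) <= L, 1 <= cabs (v + t) &
      forall x : C, cabs x = 1 -> L^-1 <= cabs (1 - x * (v + t))].
Variables (A theta rho1 : R).
Hypotheses (A2 : 2 <= A) (theta01 : 0 < theta < 1) (rho1_gt0 : 0 < rho1).
Hypothesis attr : attracted r v A theta rho1.

Local Notation K := (3 * L).
Local Notation st := (state_at r v).
Local Notation w := (w_at r v).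
Local Notation p := (p_at r v).

Let r_gt0 : (0 < r)%N := ltnW r_gt1.
Let K3 : 3 <= K. Proof. by have h := L1; lra. Qed.
Let K1 : 1 <= K. Proof. by have h := K3; lra. Qed.
Let KL : 1 <= K * (L^-1 / 2).
Proof.
have h := L1; have -> : K * (L^-1 / 2) = 3 / 2 by field; rewrite gt_eqF //; lra.
lra.
Qed.
Let K0 : 0 < K. Proof. by have h := K3; lra. Qed.

Lemma st_height n t : cabs t <= rho ->
  [/\ 0 < height (st n t), height (st n t) <= K ^+ (2 * r ^ n) &
      1 <= K ^+ (2 * r ^ n) * height (st n t)].
Proof.
move=> /box[h1 h2 _ _ _]; have w1 : 1 <= cabs (w t) by lra.
have [H1 H2] := height_tree_state r_gt1 L1 n h1 w1.
split=> //; rewrite lt_def height_ge0 andbT; apply: contraTneq H2 => ->.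
by rewrite mulr0 -ltNge ltr01.
Qed.

Lemma attr_small e : 0 < e -> exists n1 : nat, forall n, (n1 <= n)%N -> A * theta ^+ n <= e.
Proof.
move=> e0; have /andP[t0 t1] := theta01; have A0 := A2.
have [k hk] := @expr_small _ theta (e / A) (ltW t0) t1 ltac:(by rewrite divr_gt0 //; lra).
exists k => n kn; rewrite mulrC -ler_pdivlMr; last lra.
by apply: le_trans hk; rewrite ler_wiXn2l ?(ltW t0) ?(ltW t1).
Qed.

Lemma attr_height n t : cabs t <= rho -> cabs t <= rho1 -> A * theta ^+ n <= 2^-1 ->
  [/\ height (st n t) <= 2 * cabs (st n t).1, height (st n t) <= 2 * cabs (st n t).2,
      (st n t).1 != 0 & (st n t).2 != 0].
Proof.
move=> ht ht1 hn; have [h0 _ _] := st_height n ht.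
have [h1 h2] := height_diff_le (attr n ht1) hn.
by split=> //; rewrite -cabs_gt0; lra.
Qed.

(** With [a = w * D_n], [b = S_n + (w - 1) * D_n] and [k = v + t] this is [a - x * k * b], a linear
    factor of [p n.+1 = a ^ r - (k * b) ^ r] when [x ^ r = 1]. *)
Definition lin_factor x n t : C := w t * (st n t).2 - x * (v + t) * ((st n t).1 + (w t - 1) * (st n t).2).

Lemma p_atS n t : p n.+1 t =
  (w t * (st n t).2) ^+ r + w t * ((st n t).1 + (w t - 1) * (st n t).2) ^+ r.
Proof. by []. Qed.

Lemma lin_neq0 x n t : x ^+ r = 1 -> p n.+1 t != 0 -> lin_factor x n t != 0.
Proof.
move=> xr; apply: contraNneq => /eqP; rewrite subr_eq0 => /eqP E.
by rewrite p_atS E !exprMn xr mul1r /w_at mulNr subrr.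
Qed.

Lemma disc_alg_lin x n : disc_alg rho (lin_factor x n).
Proof.
have Aw := disc_alg_w r v rho; have AS := disc_alg_S r v rho n; have AD := disc_alg_D r v rho n.
apply: disc_algB; first exact: disc_algM.
apply: disc_algM.
  apply: disc_algM; first exact: disc_alg_cst.
  by apply: disc_algD; [exact: disc_alg_cst|exact: disc_alg_id].
apply: disc_algD => //; apply: disc_algM => //; apply: disc_algB => //.
exact: disc_alg_cst.
Qed.

Lemma lin_upper x n t : cabs x = 1 -> cabs t <= rho -> cabs (lin_factor x n t) <= K ^+ 2 * height (st n t).
Proof.
move=> x1 ht; have [h1 _ h3 _ _] := box ht; have hL := L1.
have hh := height_ge0 (st n t); have h5 := height1 (st n t); have h6 := height2 (st n t).
set M := height _ in hh h5 h6 *.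
have M1 : cabs (w t * (st n t).2) <= L * M by rewrite cabsM ler_pM ?cabs_ge0.
have LM : M <= L * M by rewrite ler_peMl.
have LLM : L * M <= L * (L * M) by rewrite ler_peMl // mulr_ge0 //; lra.
have M2 : cabs ((st n t).1 + (w t - 1) * (st n t).2) <= 3 * (L * M).
  have -> : (st n t).1 + (w t - 1) * (st n t).2 = (st n t).1 + w t * (st n t).2 - (st n t).2.
    by ring.
  have := cabsB ((st n t).1 + w t * (st n t).2) (st n t).2.
  by have := cabsD (st n t).1 (w t * (st n t).2); lra.
have M3 : cabs (x * (v + t) * ((st n t).1 + (w t - 1) * (st n t).2)) <= L * (3 * (L * M)).
  by rewrite cabsM cabsM x1 mul1r ler_pM ?cabs_ge0.
have := cabsB (w t * (st n t).2) (x * (v + t) * ((st n t).1 + (w t - 1) * (st n t).2)).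
rewrite -/(lin_factor x n t) expr2; lra.
Qed.

Lemma lin_upper_pow x n t : cabs x = 1 -> cabs t <= rho ->
  cabs (lin_factor x n t) ^+ r <= K ^+ (2 * r) * (K ^+ r * height (st n.+1 t)).
Proof.
move=> x1 ht; have [c1 c2 _ _ _] := box ht; have Kp := ltW K0.
apply: (@le_trans _ _ ((K ^+ 2 * height (st n t)) ^+ r)).
  have K2h : 0 <= K ^+ 2 * height (st n t).
    by apply: mulr_ge0; [exact: exprn_ge0|exact: height_ge0].
  by rewrite lerXn2r ?nnegrE ?cabs_ge0 ?lin_upper.
rewrite exprMn -exprM; apply: ler_wpM2l; first exact: exprn_ge0.
by apply: (@height_step_ge _ _ _ L1 (w t) (st n t) c1); lra.
Qed.

Lemma p_upper n t : cabs t <= rho -> cabs (p n t) <= K * height (st n t).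
Proof.
move=> ht; have [c1 _ _ _ _] := box ht; have hL := L1.
apply: le_trans (cabsD _ _) _; rewrite cabsM.
have g1 := height1 (st n t).
have : cabs (w t) * cabs (st n t).2 <= L * height (st n t).
  by rewrite ler_pM ?cabs_ge0 ?height2.
have : height (st n t) <= L * height (st n t) by rewrite ler_peMl // height_ge0.
by have := height_ge0 (st n t); lra.
Qed.

Let lt_min_rho : 0 < Num.min rho rho1. Proof. by rewrite lt_min rho0. Qed.

(** Near [t = 0], [y_n] tends to [1], so the ratio [b / a] tends to [1]. *)
Lemma lin_limit x e : cabs x = 1 -> 0 < e -> exists n1 : nat, forall n t, (n1 <= n)%N ->
  cabs t <= Num.min rho rho1 ->
  cabs (lin_factor x n t / (w t * (st n t).2) - (1 - x * (v + t))) <= e.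
Proof.
move=> x1 e0; have hL := L1.
pose e' := Num.min 2^-1 (e / (2 * L)).
have e'0 : 0 < e' by rewrite lt_min invr_gt0 ltr0n divr_gt0 // mulr_gt0 //; lra.
have [n1 Hn1] := attr_small e'0; exists n1 => n t hn; rewrite le_min => /andP[ht ht1].
have {}Hn1 := Hn1 n hn.
have hn2 : A * theta ^+ n <= 2^-1 by apply: (le_trans Hn1); rewrite ge_min lexx.
have hne : A * theta ^+ n <= e / (2 * L) by apply: (le_trans Hn1); rewrite ge_min lexx orbT.
have [_ hD _ D0] := attr_height ht ht1 hn2; have hE := attr n ht1.
have [h1 h2 h3 h4 _] := box ht.
have wp : 0 < cabs (w t) by lra.
have w0 : w t != 0 by rewrite -cabs_gt0.
have -> : lin_factor x n t / (w t * (st n t).2) - (1 - x * (v + t)) =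
          - (x * (v + t) * diff_at r v n t / (w t * (st n t).2)).
  by rewrite /lin_factor /diff_at; field; rewrite w0 D0.
have Dp : 0 < cabs (st n t).2 by rewrite cabs_gt0.
rewrite cabsN cabs_div !cabsM x1 mul1r ler_pdivrMr ?mulr_gt0 //.
have q0 : 0 <= A * theta ^+ n.
  by have /andP[? _] := theta01; rewrite mulr_ge0 ?exprn_ge0 ?ltW //; have := A2; lra.
have E1 : cabs (diff_at r v n t) <= e / (2 * L) * (2 * cabs (st n t).2).
  apply: (le_trans hE); apply: ler_pM => //; exact: height_ge0.
have E2 : e / (2 * L) * (2 * cabs (st n t).2) = e * cabs (st n t).2 / L.
  by field; rewrite gt_eqF //; lra.
rewrite E2 in E1.
apply: (@le_trans _ _ (L * (e * cabs (st n t).2 / L))).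
  by apply: ler_pM; rewrite ?cabs_ge0.
have -> : L * (e * cabs (st n t).2 / L) = e * cabs (st n t).2 by field; rewrite gt_eqF //; lra.
by rewrite mulrCA ler_peMl ?mulr_ge0 ?cabs_ge0 ?(ltW e0) //; lra.
Qed.

(** The normaliser is [S_(n+1)], and [D_(n+1) / S_(n+1)] tends to [1]. *)
Lemma p_limit e : 0 < e -> exists n1 : nat, forall n t, (n1 <= n)%N ->
  cabs t <= Num.min rho rho1 ->
  cabs (p n.+1 t / (w t * (st n t).2) ^+ r - (1 + w t)) <= e.
Proof.
move=> e0; have hL := L1.
pose e' := Num.min 2^-1 (e / (2 * L)).
have e'0 : 0 < e' by rewrite lt_min invr_gt0 ltr0n divr_gt0 // mulr_gt0 //; lra.
have [n1 Hn1] := attr_small e'0; exists n1 => n t hn; rewrite le_min => /andP[ht ht1].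
have {}Hn1 := Hn1 n.+1 (leqW hn).
have hn2 : A * theta ^+ n.+1 <= 2^-1 by apply: (le_trans Hn1); rewrite ge_min lexx.
have hne : A * theta ^+ n.+1 <= e / (2 * L) by apply: (le_trans Hn1); rewrite ge_min lexx orbT.
have [hS _ S0 _] := attr_height ht ht1 hn2; have hE := attr n.+1 ht1.
have [h1 _ _ _ _] := box ht.
rewrite -[(w t * _) ^+ r]/((st n.+1 t).1).
have -> : p n.+1 t / (st n.+1 t).1 - (1 + w t) = - (w t * diff_at r v n.+1 t / (st n.+1 t).1).
  by rewrite /p_at /diff_at; field.
have Sp : 0 < cabs (st n.+1 t).1 by rewrite cabs_gt0.
rewrite cabsN cabs_div cabsM ler_pdivrMr //.
have q0 : 0 <= A * theta ^+ n.+1.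
  by have /andP[? _] := theta01; rewrite mulr_ge0 ?exprn_ge0 ?ltW //; have := A2; lra.
have E1 : cabs (diff_at r v n.+1 t) <= e / (2 * L) * (2 * cabs (st n.+1 t).1).
  apply: (le_trans hE); apply: ler_pM => //; exact: height_ge0.
have E2 : e / (2 * L) * (2 * cabs (st n.+1 t).1) = e * cabs (st n.+1 t).1 / L.
  by field; rewrite gt_eqF //; lra.
rewrite E2 in E1.
apply: (@le_trans _ _ (L * (e * cabs (st n.+1 t).1 / L))).
  by apply: ler_pM; rewrite ?cabs_ge0.
by rewrite le_eqVlt; apply/orP; left; apply/eqP; field; rewrite gt_eqF //; lra.
Qed.

(** [growth_comparison] with [N = r ^ n.+1] for [lin_factor ^ r] and [p n.+1], both zero-free and
    normalised at [0]. By the two limits their quotient is close to [1] near [0]; hence [p]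
    dominates the linear factor on a fixed disc up to [(1 + eta) ^ N]. *)
Lemma lin_le_p x eta : cabs x = 1 -> x ^+ r = 1 -> 0 < eta -> exists n1 : nat, forall n, (n1 <= n)%N ->
  (forall t, cabs t <= rho -> p n.+1 t != 0) ->
  forall t, cabs t <= rho / (64 * K ^+ 10) ->
    cabs (lin_factor x n t) ^+ r <= K ^+ (2 * r + 2) * (1 + eta) ^+ (r ^ n.+1) * cabs (p n.+1 t).
Proof.
move=> x1 xr eta0; have hL := L1; have hK := K3.
have h0 : cabs (0 : C) <= rho by rewrite cabs0 ltW // rho0.
have [b1 b2 b3 b4 b5] := box h0.
have rR : 0 < (r%:R : R) by rewrite ltr0n.
pose u n t := lin_factor x n t / (w t * (st n t).2); pose ui t := 1 - x * (v + t).
pose q n t := p n.+1 t / (w t * (st n t).2) ^+ r; pose qi t := 1 + w t.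
have Lp : 0 < L^-1 by rewrite invr_gt0; lra.
have ui0 : L^-1 <= cabs (ui 0) by apply: b5.
have qi0 : 2^-1 <= cabs (qi 0).
  have c1 : cabs (-1 : C) = 1 by rewrite cabsN cabs1.
  by have := cabs_le_sub (w 0) (-1); rewrite opprK c1 /qi (addrC 1); lra.
have ui2 : cabs (ui 0) <= 1 + L.
  by apply: le_trans (cabsB _ _) _; rewrite cabs1 cabsM x1 mul1r lerD2l.
have Aui : disc_alg (Num.min rho rho1) ui.
  apply: disc_algB; first exact: disc_alg_cst.
  apply: disc_algM; first exact: disc_alg_cst.
  by apply: disc_algD; [exact: disc_alg_cst|exact: disc_alg_id].
have Aqi : disc_alg (Num.min rho rho1) qi.
  by apply: disc_algD; [exact: disc_alg_cst|exact: disc_alg_w].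
have ui00 : ui 0 != 0 by rewrite -cabs_gt0 (lt_le_trans Lp).
have qi00 : qi 0 != 0 by rewrite -cabs_gt0; lra.
(* An error [1 / (100 r)] in [u] becomes [1/50] in [u ^ r], and two factors within [1/50] of [1]
   have a product within [1/20] of [1]. *)
have e10 : 0 < (100 * r%:R)^-1 :> R by rewrite invr_gt0 mulr_gt0.
have e20 : 0 < 50^-1 :> R by rewrite invr_gt0.
have [n1 [d1 /andP[d10 d1m] H1]] := near_const lt_min_rho Aui ui00 (fun e h => lin_limit x1 h) e10.
have [n2 [d2 /andP[d20 d2m] H2]] := near_const lt_min_rho Aqi qi00 p_limit e20.
have [n3 Hn3] := attr_small (ltac:(by rewrite invr_gt0) : 0 < 2^-1 :> R).
have d120 : 0 < Num.min d1 d2 by rewrite lt_min d10.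
have B1 : 1 <= K ^+ 10 by rewrite exprn_ege1.
have [N0 HN0] := growth_comparison B1 eta0 rho0 d120.
exists (maxn (maxn n1 n2) (maxn n3 N0)) => n; rewrite !geq_max.
move=> /andP[/andP[hn1 hn2] /andP[hn3 hN0]] pn0 t ht.
pose N := (r ^ n.+1)%N.
have nN : (N0 <= N)%N by apply: leq_trans hN0 _; apply/ltnW/(ltn_trans (ltnSn n))/ltn_expl.
have rN : (r <= N)%N by rewrite /N expnS leq_pmulr // expn_gt0 r_gt0.
have N1 : (0 < N)%N by apply: leq_trans rN.
have [Mp Mup Mlow] := st_height n.+1 h0; rewrite -/N in Mup Mlow.
have h01 : cabs (0 : C) <= rho1 by rewrite cabs0 ltW.
have hz1 : cabs (0 : C) <= d1 by rewrite cabs0 ltW.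
have hz2 : cabs (0 : C) <= d2 by rewrite cabs0 ltW.
have [S1 _ S0 _] := attr_height h0 h01 (Hn3 n.+1 (leqW hn3)).
have [U1 U2 U3 _ _] := H1 n 0 hn1 hz1; have [Q1 Q2 Q3 _ _] := H2 n 0 hn2 hz2.
have {}U1 : cabs (ui 0) / 2 <= cabs (u n 0) := U1.
have {}U2 : cabs (u n 0) <= 2 * cabs (ui 0) := U2.
have {}Q1 : cabs (qi 0) / 2 <= cabs (q n 0) := Q1.
have SE s : (w s * (st n s).2) ^+ r = (st n.+1 s).1 by [].
have a0 : w 0 * (st n 0).2 != 0.
  by move: S0; rewrite -SE; apply: contraNneq => ->; rewrite expr0n gtn_eqF.
have linE : cabs (lin_factor x n 0) ^+ r = cabs (st n.+1 0).1 * cabs (u n 0) ^+ r.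
  by rewrite -SE -!cabsX -cabsM -exprMn mulrC /u divfK.
have pE : cabs (p n.+1 0) = cabs (st n.+1 0).1 * cabs (q n 0).
  by rewrite -cabsM mulrC /q SE divfK.
have Ku : 1 <= K * cabs (u n 0).
  have LK : 1 <= K * (L^-1 / 2) by exact: KL.
  apply: (le_trans LK); apply: ler_wpM2l; first exact: ltW K0.
  by apply: le_trans U1; rewrite ler_pM2r ?invr_gt0.
have Qq : 4^-1 <= cabs (q n 0).
  by apply: le_trans Q1; rewrite -[4%:R]/((2 * 2)%:R) natrM invfM ler_pM2r ?invr_gt0.
have l00 := lin_neq0 xr (pn0 0 h0).
have lr0 : 0 < cabs (lin_factor x n 0) ^+ r by rewrite exprn_gt0 // cabs_gt0.
have p00 : 0 < cabs (p n.+1 0) by rewrite cabs_gt0 pn0.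
have Kk k : 0 < K ^+ k by rewrite exprn_gt0 // K0.
have linlow : 1 <= K ^+ (4 * N) * cabs (lin_factor x n 0) ^+ r.
  by rewrite linE; apply: (power_lower hK N1 rN Mlow S1 Ku (cabs_ge0 _)).
have plow : 1 <= K ^+ (4 * N) * cabs (p n.+1 0).
  by rewrite pE; apply: power_lower1 Mlow S1 Qq (cabs_ge0 _).
pose X s := lin_factor x n s ^+ r / lin_factor x n 0 ^+ r; pose Y s := p n.+1 s / p n.+1 0.
have hX : disc_alg rho X.
  by apply: disc_algM; [apply/disc_algX/disc_alg_lin|exact: disc_alg_cst].
have hY : disc_alg rho Y by apply: disc_algM; [exact: disc_alg_p|exact: disc_alg_cst].
have X0 : X 0 = 1 by rewrite /X divff // expf_neq0.
have Y0 : Y 0 = 1 by rewrite /Y divff // -cabs_gt0.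
have XYn0 s : cabs s <= rho -> X s != 0 /\ Y s != 0.
  move=> hs; split; rewrite mulf_neq0 ?invr_eq0 ?expf_neq0 ?lin_neq0 ?pn0 //.
have XE s : cabs (X s) = cabs (lin_factor x n s) ^+ r / cabs (lin_factor x n 0) ^+ r.
  by rewrite /X cabs_div; congr (_ / _); apply: cabsX.
have YE s : cabs (Y s) = cabs (p n.+1 s) / cabs (p n.+1 0) by rewrite -cabs_div.
have XYB s : cabs s <= rho -> cabs (X s) <= (K ^+ 10) ^+ N /\ cabs (Y s) <= (K ^+ 10) ^+ N.
  move=> hs; have [_ hs2 _] := st_height n.+1 hs; rewrite -/N in hs2.
  have K6 : 0 <= K ^+ (6 * N) := ltW (Kk _); rewrite expr10_split; split.
    rewrite XE (ler_pdivrMr _ _ lr0) -[leRHS]mulrA.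
    apply: (@le_trans _ _ (K ^+ (6 * N))); last exact: ler_peMr.
    apply: (le_trans (lin_upper_pow n x1 hs)); exact: power_upper hs2.
  rewrite YE (ler_pdivrMr _ _ p00) -[leRHS]mulrA.
  apply: (@le_trans _ _ (K ^+ (6 * N))); last exact: ler_peMr.
  apply: (le_trans (p_upper n.+1 hs)); exact: power_upper1 hs2.
have XYc s : cabs s <= rho -> cabs s <= Num.min d1 d2 -> cabs (X s / Y s - 1) <= 20^-1.
  move=> hs; rewrite le_min => /andP[hs1 hs2].
  have [_ _ us0 uc _] := H1 n s hn1 hs1; have [_ _ qs0 _ qc] := H2 n s hn2 hs2.
  have as0 : w s * (st n s).2 != 0.
    by move: us0; apply: contraNneq => ->; rewrite /u invr0 mulr0.
  have lE y : w y * (st n y).2 != 0 -> lin_factor x n y = w y * (st n y).2 * u n y.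
    by move=> ay; rewrite [RHS]mulrC; apply/esym/divfK.
  have pE' y : w y * (st n y).2 != 0 -> p n.+1 y = (w y * (st n y).2) ^+ r * q n y.
    by move=> ay; rewrite [RHS]mulrC; apply/esym/divfK/expf_neq0.
  have -> : X s / Y s = (u n s / u n 0) ^+ r * (q n 0 / q n s).
    rewrite /X /Y (lE s as0) (lE 0 a0) (pE' s as0) (pE' 0 a0).
    exact: (quotient_identity _ as0 a0 us0 U3 qs0 Q3).
  exact: near1_prod (near1_expr r_gt0 uc) qc.
have main := HN0 N X Y nN hX hY X0 Y0 XYn0 XYB XYc t ht.
rewrite XE YE in main.
have ratio : cabs (lin_factor x n 0) ^+ r <= K ^+ (2 * r + 2) * cabs (p n.+1 0).
  rewrite linE pE; exact: expr_ratio_bound hL ui2 U2 (cabs_ge0 _) Qq (cabs_ge0 _).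
apply: clear_denominators lr0 p00 _ (cabs_ge0 _) main ratio.
by apply: exprn_ge0; rewrite addr_ge0 // ltW.
Qed.

End ZeroFree.

(** * Passing to [N]-th powers and back *)

Section PowerEstimates.
Variable R : realType.
Implicit Types (x d M P A K a th : R).

Lemma bernoulli x m : 0 <= x <= 1 -> 1 - m%:R * x <= (1 - x) ^+ m.
Proof.
move=> /andP[x0 x1]; elim: m => [|m IH]; first by rewrite mul0r subr0 expr0.
rewrite exprS -[m.+1%:R]natr1.
have h : 0 <= m%:R * x * x by rewrite !mulr_ge0.
have : (1 - x) * (1 - m%:R * x) <= (1 - x) * (1 - x) ^+ m by rewrite ler_wpM2l ?subr_ge0.
lra.
Qed.

Lemma expr1D_le2 N : (0 < N)%N -> (1 + (2 * N%:R)^-1) ^+ N <= 2 :> R.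
Proof.
move=> N0; set x := (2 * N%:R)^-1.
have NR : 0 < N%:R :> R by rewrite ltr0n.
have x0 : 0 < x by rewrite invr_gt0 mulr_gt0.
have Nx : 2 * N%:R * x = 1 by rewrite mulfV // mulf_neq0 // gt_eqF.
suff H j : (j <= N)%N -> (1 + x) ^+ j <= 1 + 2 * j%:R * x.
  by apply: (le_trans (H N (leqnn N))); rewrite Nx; lra.
elim: j => [|j IH] jN; first by rewrite expr0 mulr0 mul0r addr0.
have {}IH := IH (ltnW jN).
have jx : 2 * j%:R * x <= 1.
  by rewrite -[leRHS]Nx; apply: ler_wpM2r; [exact: ltW|apply: ler_wpM2l => //; rewrite ler_nat ltnW].
rewrite exprS -[j.+1%:R]natr1.
have h1 : (1 + x) * (1 + x) ^+ j <= (1 + x) * (1 + 2 * j%:R * x).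
  by apply: ler_wpM2l => //; lra.
have h2 : x * (2 * j%:R * x) <= x * 1 by apply: ler_wpM2l => //; apply: ltW.
lra.
Qed.

(** In the application [d = |S_k - D_k|], [M] and [Mn] are the heights at stages [k] and [n], [P] is
    [|p_n|], and [N = r ^ (n - k)]. *)
Lemma power_transfer d M Mn P C A K th (N : nat) : 0 <= d -> 0 <= M -> 0 <= th -> 0 <= A -> 0 <= K ->
  d <= A * th * M -> M ^+ N <= K ^+ N * Mn -> Mn <= C * 2 ^+ N * P ->
  d ^+ N <= C * (2 * A * K) ^+ N * th ^+ N * P.
Proof.
move=> d0 M0 th0 A0 K0 h1 h2 h3.
apply: (@le_trans _ _ ((A * th * M) ^+ N)); first by rewrite lerXn2r ?nnegrE ?mulr_ge0.
rewrite exprMn; apply: (@le_trans _ _ ((A * th) ^+ N * (K ^+ N * (C * 2 ^+ N * P)))).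
  apply: ler_wpM2l; first by rewrite exprn_ge0 // mulr_ge0.
  by apply: (le_trans h2); apply: ler_wpM2l => //; apply: exprn_ge0.
by rewrite le_eqVlt !exprMn; apply/orP; left; apply/eqP; ring.
Qed.

(** The prefactor [5 * C * K1] is at least [1], so it is below its own [N]-th power and survives the
    [N]-th root as a constant independent of [N]. *)
Lemma power_root d M Mn P C A K K1 a (N : nat) : (0 < N)%N -> 0 <= d -> 0 <= M -> 0 <= a -> 0 <= A ->
  0 <= K -> 0 <= C -> 0 <= K1 -> 1 <= 5 * C * K1 ->
  d ^+ N <= 5 * (C * (2 * A * K) ^+ N * a ^+ N) * P -> P <= K1 * Mn -> Mn <= K ^+ N * M ^+ N ->
  d <= 5 * C * K1 * (2 * A * K) * K * a * M.
Proof.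
move=> N0 d0 M0 a0 A0 K0 C0 K10 h h1 h2 h3.
have c0 : 0 <= 5 * C * K1 by lra.
have big : 0 <= 5 * C * K1 * (2 * A * K) * K * a * M by rewrite !mulr_ge0.
rewrite -(@ler_pXn2r _ N) ?nnegrE //.
apply: (le_trans h1).
apply: (@le_trans _ _ (5 * (C * (2 * A * K) ^+ N * a ^+ N) * (K1 * (K ^+ N * M ^+ N)))).
  apply: ler_wpM2l; first by rewrite !mulr_ge0 ?exprn_ge0 ?mulr_ge0.
  by apply: (le_trans h2); apply: ler_wpM2l.
have -> : (5 * C * K1 * (2 * A * K) * K * a * M) ^+ N =
   (5 * C * K1) ^+ N * ((2 * A * K) ^+ N * K ^+ N * a ^+ N * M ^+ N).
  by rewrite -!exprMn; congr (_ ^+ _); ring.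
have -> : 5 * (C * (2 * A * K) ^+ N * a ^+ N) * (K1 * (K ^+ N * M ^+ N)) =
   5 * C * K1 * ((2 * A * K) ^+ N * K ^+ N * a ^+ N * M ^+ N) by ring.
apply: ler_wpM2r; first by rewrite !mulr_ge0 ?exprn_ge0 ?mulr_ge0.
by case: (N) N0 => // n _; rewrite exprS ler_peMr // exprn_ege1.
Qed.

End PowerEstimates.

(** * Attraction across the circle *)

Section Contradiction.
Variables (R : realType) (r : nat).
Hypothesis r_gt1 : (1 < r)%N.
Local Notation C := (complex R).
Variables (v : C) (rho L : R).
Hypotheses (rho0 : 0 < rho) (L1 : 1 <= L).
Hypothesis box : forall t : C, cabs t <= rho ->
  [/\ cabs (w_at r v t) <= L, 3 / 2 <= cabs (w_at r v t), cabs (v + t) <= L, 1 <= cabs (v + t) &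
      forall x : C, cabs x = 1 -> L^-1 <= cabs (1 - x * (v + t))].
Variables (A theta rho1 : R).
Hypotheses (A2 : 2 <= A) (theta01 : 0 < theta < 1) (rho1_gt0 : 0 < rho1).
Hypothesis attr : attracted r v A theta rho1.
Hypothesis bad : forall n0, exists2 n, (n0 <= n)%N & forall t, cabs t <= rho -> p_at r v n t != 0.

Local Notation K := (3 * L).
Local Notation st := (state_at r v).
Local Notation w := (w_at r v).
Local Notation p := (p_at r v).
Local Notation lin := (lin_factor r v).
Local Notation rho' := (rho / (64 * K ^+ 10)).

Let r_gt0 : (0 < r)%N := ltnW r_gt1.

(** Two linear factors determine [a] and [b], whose [r]-th powers form the next state:
    [a * (om - 1) = om * lin 1 - lin om] and [b * (om - 1) * k = lin 1 - lin om], where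
    [|k| >= 1]. *)
Lemma height_le_lin om n t (m := Num.max (cabs (lin 1 n t)) (cabs (lin om n t))) :
    cabs om = 1 -> om != 1 -> cabs t <= rho ->
  height (st n.+1 t) <= (2 / cabs (om - 1) * m) ^+ r.
Proof.
move=> om1 omn1 ht; have [_ _ _ k1 _] := box ht.
have o0 : 0 < cabs (om - 1) by rewrite cabs_gt0 subr_eq0.
pose a := w t * (st n t).2; pose b := (st n t).1 + (w t - 1) * (st n t).2.
have m1 : cabs (lin 1 n t) <= m by rewrite le_max lexx.
have m2 : cabs (lin om n t) <= m by rewrite le_max lexx orbT.
have m0 : 0 <= m by apply: le_trans m1; apply: cabs_ge0.
have ha : cabs a <= 2 / cabs (om - 1) * m.
  rewrite mulrAC ler_pdivlMr // -cabsM.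
  have -> : a * (om - 1) = om * lin 1 n t - lin om n t by rewrite /a /lin_factor; ring.
  by apply: le_trans (cabsB _ _) _; rewrite cabsM om1 mul1r; lra.
have hb : cabs b <= 2 / cabs (om - 1) * m.
  rewrite mulrAC ler_pdivlMr //.
  apply: (@le_trans _ _ (cabs b * cabs (om - 1) * cabs (v + t))).
    by rewrite ler_peMr // mulr_ge0 ?cabs_ge0.
  rewrite -!cabsM.
  have -> : b * (om - 1) * (v + t) = lin 1 n t - lin om n t by rewrite /b /lin_factor; ring.
  by apply: le_trans (cabsB _ _) _; lra.
have Wm : 0 <= 2 / cabs (om - 1) * m by apply: le_trans ha; apply: cabs_ge0.
apply: height_le; rewrite -[X in cabs X]/(_ ^+ r) cabsX; apply: lerXn2r;
  rewrite ?nnegrE ?cabs_ge0 //.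
Qed.

(** For a primitive root [om], distinct from [1] because [r >= 2], both [lin 1] and [lin om] are
    dominated by [p]. The constant [c] is fixed before [eta]. *)
Lemma zero_free_height : exists2 c : R, 1 <= c & forall eta, 0 < eta -> exists n1 : nat, forall n,
  (n1 <= n)%N -> (forall t, cabs t <= rho -> p n t != 0) ->
  forall t, cabs t <= rho' -> height (st n t) <= c * (1 + eta) ^+ (r ^ n) * cabs (p n t).
Proof.
have [om omr] := prim_root_exists R r_gt0.
have om_r := prim_expr_order omr; have om1 : cabs om = 1 := cabs_unity_root r_gt0 om_r.
have omn1 : om != 1.
  by rewrite -[om]expr1 -(prim_order_dvd omr) dvdn1 gtn_eqF.
pose W := 2 / cabs (om - 1); pose c1 := W ^+ r * K ^+ (2 * r + 2).
have o0 : 0 < cabs (om - 1) by rewrite cabs_gt0 subr_eq0.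
have W0 : 0 < W by rewrite divr_gt0.
exists (Num.max 1 c1); first by rewrite le_max lexx.
move=> eta eta0.
have [n1 H1] := lin_le_p r_gt1 rho0 L1 box A2 theta01 rho1_gt0 attr (cabs1 R) (expr1n _ r) eta0.
have [n2 H2] := lin_le_p r_gt1 rho0 L1 box A2 theta01 rho1_gt0 attr om1 om_r eta0.
exists (maxn n1 n2).+1 => -[//|n]; rewrite ltnS geq_max => /andP[hn1 hn2] pn0 t ht.
have K1 : 1 <= K by have := L1; lra.
have htr : cabs t <= rho.
  apply: (le_trans ht); rewrite ler_pdivrMr; last by apply: mulr_gt0 => //; apply: exprn_gt0; lra.
  apply: ler_peMr; first exact: ltW.
  by have : 1 <= K ^+ 10 by [exact: exprn_ege1]; lra.
apply: (le_trans (height_le_lin n om1 omn1 htr)).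
rewrite exprMn -/W.
apply: (@le_trans _ _ (W ^+ r * (K ^+ (2 * r + 2) * (1 + eta) ^+ (r ^ n.+1) * cabs (p n.+1 t)))).
  apply: ler_wpM2l; first by apply: exprn_ge0; apply: ltW.
  have [->|->] : Num.max (cabs (lin 1 n t)) (cabs (lin om n t)) = cabs (lin 1 n t) \/
      Num.max (cabs (lin 1 n t)) (cabs (lin om n t)) = cabs (lin om n t).
  - by rewrite /Num.max; case: ifP; [right|left].
  - exact: H1.
  exact: H2.
rewrite !mulrA -/c1; apply: ler_wpM2r; first exact: cabs_ge0.
apply: ler_wpM2r; last by rewrite le_max lexx orbT.
by apply: exprn_ge0; rewrite addr_ge0 // ltW.
Qed.

(** For fixed [k] and a large zero-free stage [n], the function [(S_k - D_k) ^ N / p_n] with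
    [N = r ^ (n - k)] is bounded by some [B] on the disc, and smaller by [theta ^ (k N)] near [0].
    Three circles and an [N]-th root carry the decay, at the slower rate [th], to radius
    [rho' / 4]. *)
Lemma attraction_propagates : exists c th : R, [/\ 0 < c, 0 < th < 1 &
  forall k t, cabs t <= rho' / 4 -> cabs (diff_at r v k t) <= c * th ^+ k * height (st k t)].
Proof.
have K1 : 1 <= K by have := L1; lra.
have K10 : 1 <= K ^+ 10 := exprn_ege1 _ K1.
have rhop : 0 < rho' by rewrite divr_gt0 // mulr_gt0 //; lra.
have rhor : rho' <= rho.
  rewrite ler_pdivrMr; last by apply: mulr_gt0 => //; lra.
  by apply: ler_peMr; [exact: ltW|lra].
pose d := Num.min rho1 rho'; have d0 : 0 < d by rewrite lt_min rho1_gt0.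
have dr : d <= rho' by rewrite ge_min lexx orbT.
have d1 : d <= rho1 by rewrite ge_min lexx.
have [m' Hm'] := @expr_small _ 2^-1 (d / rho') ltac:(by rewrite invr_ge0) ltac:(lra) ltac:(by rewrite divr_gt0).
pose m := m'.+1.
have Hm : rho' <= 2 ^+ m * d.
  have : 2^-1 ^+ m <= d / rho'.
    by apply: le_trans Hm'; rewrite exprS; apply: ler_piMl; [apply: exprn_ge0; rewrite invr_ge0|lra].
  by rewrite exprVn ler_pdivlMr // ler_pdivrMl ?exprn_gt0.
have /andP[th0 th1] := theta01; have mR : 0 < m%:R :> R by rewrite ltr0n.
(* Bernoulli's inequality gives [theta <= th ^ m], so the bound near [0] takes the form [B * a ^ m]
   with [a = (th ^ k) ^ N]. *)
pose x := (1 - theta) / m%:R; pose th := 1 - x.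
have x0 : 0 < x by rewrite divr_gt0 // subr_gt0.
have x1 : x < 1.
  by rewrite ltr_pdivrMr // mul1r; apply: (@lt_le_trans _ _ 1); rewrite ?ler1n //; lra.
have thm : theta <= th ^+ m.
  apply: le_trans (bernoulli m (x := x) _); last by rewrite !ltW.
  by rewrite /x mulrC divfK ?gt_eqF //; lra.
have thp : 0 < th by rewrite subr_gt0.
have th1' : th < 1 by rewrite /th; lra.
have [c c1 Hc] := zero_free_height.
pose K2 := K ^+ 2; have K20 : 0 < K2 by rewrite exprn_gt0 //; lra.
exists (5 * c * K * (2 * A * K2) * K2), th; split; last 1 first.
- move=> k t ht.
  pose N0 := (r ^ k)%N; have N00 : (0 < N0)%N by rewrite expn_gt0 r_gt0.
  (* As [r ^ n = r ^ k * N], this [eta] makes [(1 + eta) ^ (r ^ n)] at most [2 ^ N], which costs a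
     constant after the [N]-th root. *)
  pose eta := (2 * N0%:R : R)^-1.
  have eta0 : 0 < eta by rewrite invr_gt0 mulr_gt0 // ltr0n.
  have [n1 Hn1] := Hc eta eta0.
  have [n] := bad (maxn k n1); rewrite geq_max => /andP[kn n1n] pn0.
  pose N := (r ^ (n - k))%N; have NN : (0 < N)%N by rewrite expn_gt0 r_gt0.
  have rn : (r ^ n = N0 * N)%N by rewrite /N0 /N -expnD subnKC.
  have Mn s : cabs s <= rho' -> height (st n s) <= c * 2 ^+ N * cabs (p n s).
    move=> hs; apply: (le_trans (Hn1 n n1n pn0 s hs)).
    apply: ler_wpM2r; first exact: cabs_ge0.
    apply: ler_wpM2l; first by apply: le_trans c1.
    rewrite rn exprM; apply: lerXn2r; rewrite ?nnegrE ?exprn_ge0 ?addr_ge0 ?(ltW eta0) //.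
    exact: expr1D_le2.
  have Hit s : cabs s <= rho' -> height (st k s) ^+ N <= K2 ^+ N * height (st n s) /\
      height (st n s) <= K2 ^+ N * height (st k s) ^+ N.
    move=> hs; have [b1 b2 _ _ _] := box (le_trans hs rhor).
    have b3 : 1 <= cabs (w s) by apply: le_trans b2; lra.
    have := height_iter r_gt1 L1 k (n - k) b1 b3; rewrite subnKC // -/N.
    by rewrite /K2 -exprM.
  have Ap0 : 0 < A by apply: (lt_le_trans _ A2).
  have hA : 0 <= A := ltW Ap0.
  have pneq s : cabs s <= rho' -> p n s != 0 by move=> hs; apply/pn0/(le_trans hs).
  have Ap : disc_alg rho' (p n) := disc_alg_p _ _ _ _.
  have [|ApV _] := @disc_alg_root _ 1 _ _ (p n 0) isT (ltW rhop) Ap pneq; first by rewrite expr1.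
  pose e s := diff_at r v k s ^+ N * (p n s)^-1.
  have Ae : disc_alg rho' e by apply: disc_algM => //; apply/disc_algX/disc_alg_diff.
  have eE s : cabs (e s) = cabs (diff_at r v k s) ^+ N / cabs (p n s).
    by rewrite cabs_div; congr (_ / _); apply: cabsX.
  pose B := c * (2 * A * K2) ^+ N.
  have B0 : 0 < B.
    by apply: mulr_gt0; [exact: lt_le_trans ltr01 c1|apply/exprn_gt0/mulr_gt0 => //; exact: mulr_gt0].
  have e2 s : cabs s <= rho' -> cabs (e s) <= B.
    move=> hs; have [i1 _] := Hit s hs; have pp : 0 < cabs (p n s) by rewrite cabs_gt0 pneq.
    rewrite eE (ler_pdivrMr _ _ pp).
    have hd : cabs (diff_at r v k s) <= A * 1 * height (st k s).
      apply: (le_trans (heightB _)); rewrite mulr1.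
      by apply: ler_wpM2r => //; apply: height_ge0.
    have := power_transfer (cabs_ge0 _) (height_ge0 _) ler01 hA (ltW K20) hd i1 (Mn s hs).
    by rewrite expr1n mulr1.
  have e1 s : cabs s <= d -> cabs (e s) <= B * ((th ^+ k) ^+ N) ^+ m.
    move=> hs; have hs' := le_trans hs dr; have [i1 _] := Hit s hs'.
    have pp : 0 < cabs (p n s) by rewrite cabs_gt0 pneq.
    rewrite eE (ler_pdivrMr _ _ pp).
    have hd := attr k (le_trans hs d1).
    have thk0 : 0 <= theta ^+ k by apply/exprn_ge0/ltW.
    apply: (le_trans (power_transfer (cabs_ge0 _) (height_ge0 _) thk0 hA (ltW K20) hd i1 (Mn s hs'))).
    apply: ler_wpM2r; first exact: cabs_ge0.
    apply: ler_wpM2l; first exact: ltW.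
    rewrite (exprAC _ N m) (exprAC _ k m).
    have thm0 : 0 <= th ^+ m by apply/exprn_ge0/ltW.
    have le_k : theta ^+ k <= (th ^+ m) ^+ k by apply: lerXn2r; rewrite ?nnegrE // ltW.
    by apply: lerXn2r; rewrite ?nnegrE // exprn_ge0.
  have a0 : 0 < (th ^+ k) ^+ N by rewrite !exprn_gt0.
  have htr : cabs t <= rho' by apply: (le_trans ht); lra.
  have := disc_alg_three_circles (ltn0Sn m') d0 rhop dr Hm a0 B0 Ae e2 e1 ht.
  have pp : 0 < cabs (p n t) by rewrite cabs_gt0 pneq.
  rewrite eE (ler_pdivrMr _ _ pp) /B => h.
  have [_ i2] := Hit t htr.
  have pK := p_upper L1 box n (le_trans htr rhor).
  have thk : 0 <= th ^+ k by apply/exprn_ge0/ltW.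
  have cp : 0 <= c by apply: le_trans c1.
  have Kp : 0 <= K by apply: le_trans K1.
  apply: (power_root NN (cabs_ge0 _) (height_ge0 _) thk hA (ltW K20) cp Kp _ h pK i2).
  have : 1 * 1 <= c * K by apply: ler_pM.
  lra.
- have Ap0 : 0 < A by apply: (lt_le_trans _ A2).
  have cp : 0 < c := lt_le_trans ltr01 c1.
  have Lp : 0 < L := lt_le_trans ltr01 L1.
  by rewrite !mulr_gt0.
- by rewrite thp.
Qed.

End Contradiction.

(** * Contradiction at the repelling fixed point *)

Section ZerosNearCircle.
Variables (R : realType) (r : nat).
Hypothesis r_gt1 : (1 < r)%N.
Local Notation C := (complex R).

Let r_gt0 : (0 < r)%N := ltnW r_gt1.

Lemma poly_eq0_on_disc (P : {poly C}) (c : C) (d : R) : 0 < d ->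
  (forall t, cabs t <= d -> P.[c + t] = 0) -> P = 0.
Proof.
move=> d0 P0; have Q0 : P \Po ('X + c%:P) = 0.
  apply/polyP => j; rewrite coef0; apply/eqP; rewrite -cabs_eq0.
  have PB t : cabs t <= d -> cabs (P \Po ('X + c%:P)).[t] <= 0.
    by move=> /P0; rewrite horner_comp hornerD hornerX hornerC addrC => ->; rewrite cabs0.
  have := cauchy_estimate d0 PB j.
  by rewrite pmulr_lle0 ?exprn_gt0 // => h; rewrite eq_le h cabs_ge0.
have -> : P = (P \Po ('X + c%:P)) \Po ('X - c%:P).
  by rewrite -comp_polyA comp_polyD comp_polyX comp_polyC subrK comp_polyXr.
by rewrite Q0 comp_poly0.
Qed.

(** Where [|w| < r] the fixed point repels, so a small deviation cannot decrease, yet by hypothesis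
    it tends to [0]: it already vanishes at stage [k0], on a whole disc. Then [S_k0 = D_k0] as
    polynomials, against their values at [w = 0]. *)
Lemma repelling_contradiction (v t1 : C) (d L c th : R) : 1 <= L -> 0 < c -> 0 < th < 1 ->
    (forall t, cabs t <= d -> cabs (w_at r v t) <= L /\ 1 <= cabs (w_at r v t)) ->
    (forall k t, cabs t <= d ->
       cabs (diff_at r v k t) <= c * th ^+ k * height (state_at r v k t)) ->
  cabs t1 < d -> cabs (w_at r v t1) < r%:R -> False.
Proof.
move=> L1 c0 /andP[th0 th1] Hw Hd ht1 hwt1.
pose sg := (r%:R - cabs (w_at r v t1)) / 2.
have sg0 : 0 < sg by rewrite divr_gt0 // subr_gt0.
have [d1 d10 Hd1] := disc_alg_ucont (disc_alg_w r v d) sg0.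
pose d2 := Num.min d1 (d - cabs t1).
have d20 : 0 < d2 by rewrite lt_min d10 subr_gt0.
have [tau tau0 Htau] := repelling_step r_gt0 sg0.
pose e := Num.min 2^-1 (tau / 2).
have e0 : 0 < e by rewrite lt_min invr_gt0 ltr0n divr_gt0.
have [k0 Hk0] := @expr_small _ th (e / c) (ltW th0) th1 ltac:(by rewrite divr_gt0).
have ck k : (k0 <= k)%N -> c * th ^+ k <= e.
  move=> kk; rewrite mulrC -ler_pdivlMr //; apply: le_trans Hk0.
  by rewrite ler_wiXn2l ?(ltW th0) ?(ltW th1).
have zero s : cabs s <= d2 -> diff_at r v k0 (t1 + s) = 0.
  rewrite le_min => /andP[hs1 hs2]; set t := t1 + s.
  have ht : cabs t <= d by have := cabsD t1 s; rewrite -/t; lra.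
  have [w1 w2] := Hw t ht.
  have wn0 : w_at r v t != 0 by rewrite -cabs_gt0; lra.
  have hwt : cabs (w_at r v t) <= r%:R - sg.
    have h := Hd1 t t1 ht (ltW ht1); rewrite /t addrAC subrr add0r -/t in h.
    have := cabs_le_sub (w_at r v t) (w_at r v t1); have := h hs1; rewrite /sg; lra.
  have devk k : (k0 <= k)%N -> [/\ (state_at r v k t).2 != 0,
     cabs (dev (w_at r v t) (state_at r v k t)) <= tau &
     cabs (dev (w_at r v t) (state_at r v k t)) <= 2 * c * th ^+ k].
    move=> kk; have hck := ck k kk; have [_ M1] := height_tree_state r_gt1 L1 k w1 w2.
    have M0 : 0 < height (state_at r v k t).
      rewrite lt_def height_ge0 andbT; apply: contraTneq M1 => h0.
      by rewrite -/(state_at r v k t) h0 mulr0 -ltNge ltr01.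
    have e12 : e <= 2^-1 by rewrite ge_min lexx.
    have et : e <= tau / 2 by rewrite ge_min lexx orbT.
    have [_ hD] := height_diff_le (Hd k t ht) (le_trans hck e12).
    have Dp : 0 < cabs (state_at r v k t).2 by lra.
    have hdev : cabs (dev (w_at r v t) (state_at r v k t)) <= 2 * c * th ^+ k.
      rewrite /dev cabs_div cabsM ler_pdivrMr; last by apply: mulr_gt0 => //; lra.
      apply: (le_trans (Hd k t ht)).
      have ck0 : 0 <= c * th ^+ k by rewrite mulr_ge0 ?exprn_ge0 ?ltW.
      apply: (@le_trans _ _ (c * th ^+ k * (2 * (cabs (w_at r v t) * cabs (state_at r v k t).2)))).
        apply: ler_wpM2l => //; apply: (le_trans hD); apply: ler_wpM2l => //.
        by apply: ler_peMl => //; apply: ltW.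
      by rewrite le_eqVlt; apply/orP; left; apply/eqP; ring.
    split=> //; first by rewrite -cabs_gt0.
    by apply: (le_trans hdev); lra.
  have mono j : cabs (dev (w_at r v t) (state_at r v k0 t)) <=
                cabs (dev (w_at r v t) (state_at r v (k0 + j) t)).
    elim: j => [|j IH]; first by rewrite addn0.
    have [D0 ht' _] := devk (k0 + j)%N (leq_addr _ _).
    by apply: (le_trans IH); rewrite addnS; apply: (Htau _ _ wn0 hwt D0 ht').2.
  have [D0 _ _] := devk k0 (leqnn _).
  suff : dev (w_at r v t) (state_at r v k0 t) = 0.
    move/eqP; rewrite /dev mulf_eq0 invr_eq0 mulf_eq0 (negPf wn0) (negPf D0) !orbF.
    by move/eqP.
  apply/eqP; rewrite -cabs_eq0 eq_le cabs_ge0 andbT leNgt; apply/negP => pos.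
  set x := cabs _ in pos mono.
  have [j Hj] := @expr_small _ th (x / (4 * c)) (ltW th0) th1 ltac:(by rewrite divr_gt0 // mulr_gt0).
  have [_ _ h] := devk (k0 + j)%N (leq_addr _ _).
  have h1 : th ^+ (k0 + j) <= x / (4 * c).
    by apply: le_trans Hj; rewrite exprD ler_piMl ?exprn_ge0 ?exprn_ile1 ?(ltW th0) ?(ltW th1).
  rewrite ler_pdivlMr ?mulr_gt0 // in h1.
  have := mono j; lra.
(* The variable of [P] is [k] rather than [t], so that evaluation at [0] means [w = 0]. *)
pose P := (tree_state r k0 (- 'X^r : {poly C})).1 - (tree_state r k0 (- 'X^r : {poly C})).2.
have PE x : P.[x] = (tree_state r k0 (- x ^+ r)).1 - (tree_state r k0 (- x ^+ r)).2.
  have E : - x ^+ r = (- 'X^r : {poly C}).[x] by rewrite hornerN hornerXn.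
  by rewrite /P hornerD hornerN E tree_state_horner.
have P0 : P = 0.
  apply: (poly_eq0_on_disc d20 (c := v + t1)) => s hs.
  by rewrite PE -addrA; apply: zero.
have [m] := tree_state_w0 C k0 r_gt0.
have := PE 0; rewrite P0 horner0 expr0n (gtn_eqF r_gt0) oppr0 => <- /eqP.
by rewrite eq_sym signr_eq0.
Qed.

(** For [x = |k|]: dividing [x ^ r - 1 >= 1/2] by [1 + x + ... + x ^ (r - 1)] keeps [x] away from
    [1]. *)
Lemma norm_root_bounds (x : R) : 0 <= x -> 3 / 2 <= x ^+ r -> x ^+ r <= r%:R + 1 ->
  [/\ 1 <= x, x <= r%:R + 1 & (2 * r%:R * (r%:R + 1) ^+ r)^-1 <= x - 1].
Proof.
move=> x0 h1 h2; have rR : 0 < (r%:R : R) by rewrite ltr0n.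
have x1 : 1 <= x.
  rewrite leNgt; apply/negP => hx; have : x ^+ r <= 1 by rewrite exprn_ile1 // ltW.
  lra.
have xr : x <= r%:R + 1 by apply: le_trans h2; rewrite ler_eXnr.
split=> //; have L0 : 0 < 2 * r%:R * (r%:R + 1) ^+ r :> R.
  by rewrite !mulr_gt0 // exprn_gt0 // addr_gt0.
rewrite -[leLHS]mul1r ler_pdivrMr //.
have := subrX1 x r; set T := \sum_(i < r) _ => E.
have hT : T <= r%:R * (r%:R + 1) ^+ r.
  rewrite mulr_natl -[X in _ *+ X](card_ord r) -sumr_const; apply: ler_sum => i _.
  apply: (@le_trans _ _ ((r%:R + 1) ^+ i)).
    by rewrite lerXn2r ?nnegrE ?addr_ge0 // ltW.
  by rewrite ler_weXn2l ?(ltnW (ltn_ord i)) // lerDr ltW.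
have : (x - 1) * T <= (x - 1) * (r%:R * (r%:R + 1) ^+ r) by rewrite ler_wpM2l // subr_ge0.
lra.
Qed.

Theorem zeros_near_circle (q0 : C) (eps : R) : cabs (q0 - 1) = r%:R -> 0 < eps ->
  exists n0 : nat, forall n, (n0 <= n)%N -> exists q, cabs (q - q0) < eps /\
    (tree_state r n (q - 1)).1 + (q - 1) * (tree_state r n (q - 1)).2 = 0.
Proof.
move=> hq0 eps0; apply: contrapT => /forallNP none.
have bad n0 : exists2 n, (n0 <= n)%N & forall q, cabs (q - q0) < eps ->
    (tree_state r n (q - 1)).1 + (q - 1) * (tree_state r n (q - 1)).2 != 0.
  have /existsNP[n /not_implyP[hn /forallNP Hn]] := none n0.
  by exists n => // q hq; apply/eqP => E; apply: (Hn q).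
have rR1 : 2 <= r%:R :> R by rewrite ler_nat.
(* The radius is taken so large that the lemma only provides an [r]-th root of [1 - q0]. *)
have [k0 k0r _] : exists2 x : C, x ^+ r = 1 - q0 & cabs (x - 1) <= cabs (1 - q0 - 1) + 1.
  apply: near1_root_exists => //; first by rewrite addr_ge0 ?cabs_ge0.
  apply: (@le_trans _ _ (cabs (1 - q0 - 1) + 1)); first by rewrite lerDl.
  by rewrite ler_eXnr // lerDr cabs_ge0.
have k0abs : cabs k0 ^+ r = r%:R by rewrite -cabsX k0r cabsC.
have w0E : w_at r k0 0 = q0 - 1 by rewrite /w_at addr0 k0r opprB.
have k00 : 0 < cabs k0.
  rewrite lt_def cabs_ge0 andbT; apply/eqP => h; have := rR1.
  by rewrite -k0abs h expr0n gtn_eqF //= => le20; lra.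
(* [eps / 2] keeps [w + 1] where zeros are excluded; [1/2] ensures [|w| >= r - 1/2 >= 3/2]. *)
pose e := Num.min (eps / 2) 2^-1.
have e0 : 0 < e by rewrite lt_min invr_gt0 ltr0n divr_gt0.
have [eE1 eE2] : e <= eps / 2 /\ e <= 2^-1 by rewrite !ge_min !lexx orbT.
have [d d0 Hd] := disc_alg_ucont (disc_alg_w r k0 1) e0.
pose rU := Num.min 1 d; have rU0 : 0 < rU by rewrite lt_min ltr01.
have wU t : cabs t <= rU -> cabs (w_at r k0 t - w_at r k0 0) <= e.
  by rewrite le_min => /andP[h1 h2]; apply: Hd; rewrite ?cabs0 ?subr0.
pose L := 2 * r%:R * (r%:R + 1) ^+ r : R.
have Lbig : r%:R + 1 <= L.
  have h : r%:R + 1 <= (r%:R + 1) ^+ r :> R by rewrite ler_eXnr //; lra.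
  apply: (le_trans h); apply: ler_peMl; first by apply: exprn_ge0; lra.
  lra.
have L1 : 1 <= L by lra.
have boxU t : cabs t <= rU ->
  [/\ cabs (w_at r k0 t) <= L, 3 / 2 <= cabs (w_at r k0 t), cabs (k0 + t) <= L, 1 <= cabs (k0 + t) &
      forall x : C, cabs x = 1 -> L^-1 <= cabs (1 - x * (k0 + t))].
  move=> ht; have hw := wU t ht.
  have w0r : cabs (w_at r k0 0) = r%:R by rewrite w0E.
  have wlo : 3 / 2 <= cabs (w_at r k0 t).
    by have := cabs_le_sub (w_at r k0 0) (w_at r k0 t); rewrite (cabsC (w_at r k0 0)); lra.
  have whi : cabs (w_at r k0 t) <= r%:R + 1.
    by have := cabs_le_sub (w_at r k0 t) (w_at r k0 0); lra.
  have wE : cabs (w_at r k0 t) = cabs (k0 + t) ^+ r by rewrite /w_at cabsN cabsX.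
  have [b1 b2 b3] := norm_root_bounds (cabs_ge0 (k0 + t))
    ltac:(by rewrite -wE) ltac:(by rewrite -wE).
  split=> //; try lra.
  move=> x x1; apply: (le_trans b3); rewrite cabsC.
  by have := cabs_le_sub (x * (k0 + t)) 1; rewrite cabsM x1 mul1r cabs1.
pose rho := rU / 2; have rho0 : 0 < rho by rewrite divr_gt0.
pose rho4 := rho / (64 * (3 * L) ^+ 10) / 4.
have K10 : 0 < 64 * (3 * L) ^+ 10 by apply: mulr_gt0 => //; apply: exprn_gt0; lra.
have rho40 : 0 < rho4 by rewrite !divr_gt0.
have rho4r : rho4 <= rho.
  rewrite /rho4 -mulrA -invfM ler_pdivrMr; last exact: mulr_gt0.
  apply: ler_peMr; first exact: ltW.
  have : 1 <= (3 * L) ^+ 10 by apply: exprn_ege1; lra.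
  lra.
(* The disc will be centred at [(1 + s) * k0], where [|w| > r], with [s] so small that
   [(1 - s) * k0], where [|w| < r], lies within [rho4] of the centre. *)
pose s := Num.min 2^-1 (rho4 / (4 * cabs k0)).
have s0 : 0 < s by rewrite lt_min invr_gt0 ltr0n divr_gt0 // mulr_gt0.
have s1 : s <= 2^-1 by rewrite ge_min lexx.
have s2 : 4 * (s * cabs k0) <= rho4.
  have : s <= rho4 / (4 * cabs k0) by rewrite ge_min lexx orbT.
  by rewrite ler_pdivlMr ?mulr_gt0 //; lra.
pose c0 : C := (s%:C)%C * k0.
have c0abs : cabs c0 = s * cabs k0 by rewrite cabsM cabs_real gtr0_norm.
have sk0 : 0 < s * cabs k0 by rewrite mulr_gt0.
pose v := k0 + c0.
have wv t : w_at r v t = w_at r k0 (c0 + t) by rewrite /w_at addrA.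
have inU t : cabs t <= rho -> cabs (c0 + t) <= rU.
  by move=> ht; have := cabsD c0 t; rewrite c0abs; move: rho4r ht s2; rewrite /rho; lra.
have box t : cabs t <= rho ->
  [/\ cabs (w_at r v t) <= L, 3 / 2 <= cabs (w_at r v t), cabs (v + t) <= L, 1 <= cabs (v + t) &
      forall x : C, cabs x = 1 -> L^-1 <= cabs (1 - x * (v + t))].
  by move=> /inU /boxU; rewrite wv /v -addrA.
have badv n0 : exists2 n, (n0 <= n)%N & forall t, cabs t <= rho -> p_at r v n t != 0.
  have [n hn Hn] := bad n0; exists n => // t ht.
  have := Hn (w_at r v t + 1); rewrite addrK; apply.
  have := wU _ (inU t ht); rewrite -wv w0E.
  have -> : w_at r v t + 1 - q0 = w_at r v t - (q0 - 1) by ring.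
  lra.
have wv0 : r%:R < cabs (w_at r v 0).
  rewrite /w_at cabsN cabsX addr0.
  have -> : v = ((1 + s)%:C)%C * k0 by rewrite /v /c0 rmorphD rmorph1 mulrDl mul1r.
  rewrite cabsM cabs_real exprMn k0abs gtr0_norm; last by rewrite addr_gt0.
  by rewrite ltr_pMl ?exprn_egt1 ?gtn_eqF //; lra.
have [A [theta [rho1 [A2 th01 rho10 attr]]]] := outside_attracted r_gt1 wv0.
have [c [th [c_gt0 th_01 prop]]] :=
  attraction_propagates r_gt1 rho0 L1 box A2 th01 rho10 attr badv.
apply: (@repelling_contradiction v (- (c0 + c0)) rho4 L c th) => //.
- by move=> t ht; have [b1 b2 _ _ _] := box t (le_trans ht rho4r); split=> //; lra.
- by rewrite cabsN; have := cabsD c0 c0; rewrite c0abs; lra.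
rewrite /w_at cabsN cabsX.
have -> : v - (c0 + c0) = ((1 - s)%:C)%C * k0.
  by rewrite /v /c0 rmorphB rmorph1 mulrBl mul1r; ring.
rewrite cabsM cabs_real exprMn k0abs gtr0_norm; last by rewrite subr_gt0; lra.
rewrite gtr_pMl ?exprn_ilt1 ?gtn_eqF //; lra.
Qed.

End ZerosNearCircle.

(** * Transfer to the pairs of reals of the statement *)

From mathcomp Require Import Rstruct.

Definition to_complex (z : Cplx) : complex R := Complex z.1 z.2.
Definition of_complex (z : complex R) : Cplx := (complex.Re z, complex.Im z).

Lemma of_complexK z : to_complex (of_complex z) = z.
Proof. by case: z. Qed.

Lemma to_complex_add z w : to_complex (Cadd z w) = to_complex z + to_complex w.
Proof. by []. Qed.

Lemma to_complex_sub z w : to_complex (Csub z w) = to_complex z - to_complex w.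
Proof. by []. Qed.

Lemma to_complex_mul z w : to_complex (Cmul z w) = to_complex z * to_complex w.
Proof. by []. Qed.

Lemma to_complex_pow z k : to_complex (Cpow z k) = to_complex z ^+ k.
Proof. by elim: k => //= k IH; rewrite to_complex_mul IH exprS. Qed.

Lemma Cnorm_cabs z : Cnorm z = cabs (to_complex z).
Proof. by rewrite /Cnorm /= RsqrtE. Qed.

Lemma to_complex_sum s :
  to_complex (List.fold_right Cadd Czero s) = \sum_(z <- s) to_complex z.
Proof.
elim: s => [|z s IH]; first by rewrite big_nil.
by rewrite big_cons -IH -to_complex_add.
Qed.

Lemma to_complex_chrom r n q :
  to_complex (chrom r n q) = \sum_(A : {set edge r n}) (-1) ^+ #|A| * to_complex q ^+ ncomp A.
Proof.
rewrite /chrom to_complex_sum big_map big_enum /=.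
rewrite (eq_bigl predT) => [|A]; last exact: finset.in_setT.
by apply: eq_bigr => A _; rewrite to_complex_mul !to_complex_pow.
Qed.

Theorem theorem3p11 (r : nat) (hr : (2 <= r)%N) (q0 : Cplx)
    (hq0 : Cnorm (Csub q0 Cone) = INR r) (eps : R) (heps : Rlt R0 eps) :
  exists n0 : nat, forall n : nat, (n0 <= n)%N ->
    exists q : Cplx, chrom r n q = Czero /\ Rlt (Cnorm (Csub q q0)) eps.
Proof.
have hq : cabs (to_complex q0 - 1) = r%:R.
  by rewrite -[1]/(to_complex Cone) -to_complex_sub -Cnorm_cabs hq0 INRE.
have [n0 Hn0] := zeros_near_circle hr hq (introT RltP heps).
exists n0 => n /Hn0[q [hqe q_root]]; exists (of_complex q); split.
  have : to_complex (chrom r n (of_complex q)) = 0.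
    by rewrite to_complex_chrom of_complexK chrom_tree_state q_root mulr0.
  by case: (chrom r n _) => a b [-> ->].
by apply/RltP; rewrite Cnorm_cabs to_complex_sub of_complexK.
Qed.
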